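(* Let $\{X(n) : n\ge 0\}$ be a $\psi$-irreducible and aperiodic discrete-time Markov chain with transition kernel $P$ on a measurable space $(\mathsf{X},\mathcal{B})$ whose $\sigma$-algebra $\mathcal{B}$ is countably generated, and suppose that the chain is reversible with respect to a probability measure $\pi$. Then the chain is geometrically ergodic if and only if $P$ admits a spectral gap in $L_2=L_2(\pi)$.
   Context: Kernels: $P^n(x,A)=\Pr\{X(n)\in A\mid X(0)=x\}$, $P=P^1$, and $PF(x)=\int_{\mathsf{X}}P(x,dy)F(y)$ whenever the integral exists. $\psi$-irreducible and aperiodic: there is a nonzero $\sigma$-finite measure $\psi$ on $(\mathsf{X},\mathcal{B})$ such that for every $A\in\mathcal{B}$ with $\psi(A)>0$ and every $x\in\mathsf{X}$, $P^n(x,A)>0$ for all $n$ sufficiently large; moreover $\psi$ is maximal, in the sense that any other such $\psi'$ is absolutely continuous with respect to $\psi$. Reversible: there is a probability measure $\pi$ on $(\mathsf{X},\mathcal{B})$ satisfying the detailed balance conditions $\pi(dx)P(x,dy)=\pi(dy)P(y,dx)$ (in particular $\pi$ is invariant). Geometrically ergodic: there exist an invariant measure $\pi$ on $(\mathsf{X},\mathcal{B})$ and functions $\rho:\mathsf{X}\to(0,1)$, $C:\mathsf{X}\to[1,\infty)$ such that $\|P^n(x,\cdot)-\pi\|_{\rm TV}\le C(x)\rho(x)^n$ for all $n\ge0$ and $\pi$-a.e. $x\in\mathsf{X}$, where $\|\mu\|_{\rm TV}=\sup_{A\in\mathcal{B}}|\mu(A)|$. Spectral gap in $L_2$: $L_2=L_2(\pi)$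 is the Hilbert space of measurable $F:\mathsf{X}\to\mathbb{C}$ that are square-integrable under $\pi$, with norm $\|F\|_2=[\int|F|^2d\pi]^{1/2}$, and $P$ is viewed as a linear operator on $L_2$. Its spectrum $\mathcal{S}_2$ is the set of nonzero $\lambda\in\mathbb{C}$ for which the inverse $(I\lambda-P)^{-1}$ does not exist as a bounded linear operator on $L_2$. A pole of finite multiplicity $m$ is an isolated point $\lambda_0$ of the spectrum whose associated spectral projection $\frac{1}{2\pi i}\oint(Iz-P)^{-1}dz$ (over a small circle around $\lambda_0$ enclosing no other point of the spectrum) has finite rank $m$. $P$ admits a spectral gap in $L_2$ if there exists $\varepsilon_0>0$ such that $\mathcal{S}_2\cap\{z:|z|\ge1-\varepsilon_0\}$ is finite and contains only poles of finite multiplicity. *)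

(* Defs.v *)
From HB Require Import structures.
From mathcomp Require Import all_boot all_order all_algebra.
From mathcomp Require Import complex.
From mathcomp Require Import all_classical all_reals all_analysis.

Set Implicit Arguments.
Unset Strict Implicit.
Unset Printing Implicit Defensive.

Import Order.TTheory GRing.Theory Num.Theory.
Import numFieldNormedType.Exports.

Local Open Scope classical_set_scope.
Local Open Scope ring_scope.
Local Open Scope complex_scope.

Definition countably_generated d (T : measurableType d) : Prop :=
  exists G : set (set T), countable G /\ @measurable d T = <<s G >>.

Section markov_kernels.
Context d (T : measurableType d) (R : realType).
Local Open Scope ereal_scope.

(* P^n, given by the Chapman-Kolmogorov equation
   P^(n+1)(x, A) = \int P(x, dy) P^n(y, A) *)
Fixpoint kernel_iter (P : R.-spker T ~> T) (n : nat) : R.-spker T ~> T :=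
  if n is n'.+1 then mkcomp_noparam P (kernel_iter P n')
  else kdirac (@measurable_id _ T setT).

Definition irreducible_aperiodic_for (P : R.-pker T ~> T)
    (psi : set T -> \bar R) : Prop :=
  psi [set: T] != 0 /\
  forall A, measurable A -> 0 < psi A ->
    forall x, \forall n \near \oo, 0 < kernel_iter P n x A.

Definition psi_irreducible_aperiodic (P : R.-pker T ~> T) : Prop :=
  exists psi : {sigma_finite_measure set T -> \bar R},
    irreducible_aperiodic_for P psi /\
    forall psi' : {sigma_finite_measure set T -> \bar R},
      irreducible_aperiodic_for P psi' -> psi' `<< psi.

(* pi(dx)P(x,dy) = pi(dy)P(y,dx), as measures on the product space T * T *)
Definition reversible (P : R.-pker T ~> T) (pi : probability T R) : Prop :=
  forall D : set (T * T), measurable D ->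
    \int[pi]_x P x (xsection D x) = \int[pi]_y P y (ysection D y).

Definition invariant_measure (P : R.-pker T ~> T)
    (mu : {measure set T -> \bar R}) : Prop :=
  forall A, measurable A -> \int[mu]_x P x A = mu A.

Definition tv_dist (m1 m2 : set T -> \bar R) : \bar R :=
  ereal_sup [set `|m1 A - m2 A| | A in measurable].

(* The invariant measure is required to be nonzero, since for mu = 0 the
   "mu-a.e." bound would be vacuous; the bound itself then forces mu to be a
   probability measure. *)
Definition geometrically_ergodic (P : R.-pker T ~> T) : Prop :=
  exists mu : {measure set T -> \bar R},
    [/\ mu [set: T] != 0, invariant_measure P mu &
      exists rho C : T -> R,
        [/\ forall x, (0 < rho x < 1)%R,
            forall x, (1 <= C x)%R &
            {ae mu, forall x, forall n : nat,
              tv_dist (kernel_iter P n x) mu <= (C x * rho x ^+ n)%:E}]].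

End markov_kernels.

Section complex_functions.
Context d (T : measurableType d) (R : realType).

Definition cmeasurable (F : T -> R[i]) : Prop :=
  measurable_fun [set: T] (fun x => complex.Re (F x)) /\
  measurable_fun [set: T] (fun x => complex.Im (F x)).

Definition cintegral (mu : {measure set T -> \bar R}) (D : set T)
    (F : T -> R[i]) : R[i] :=
  (\int[mu]_(x in D) complex.Re (F x)) +i*
  (\int[mu]_(x in D) complex.Im (F x)).

Definition cmod (F : T -> R[i]) : T -> R := fun x => Normc.normc (F x).

Definition L2norm (mu : {measure set T -> \bar R}) (F : T -> R[i]) : \bar R :=
  ('N[mu]_(2%:E) [EFin \o cmod F])%E.

(* Elements of L_2(mu) are represented by functions; equality in L_2(mu) is
   equality mu-a.e. *)
Definition L2 (mu : {measure set T -> \bar R}) : set (T -> R[i]) :=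
  [set F | cmeasurable F /\ finite_norm mu 2%:E (cmod F)].

Definition L2inner (mu : {measure set T -> \bar R}) (F G : T -> R[i]) : R[i] :=
  cintegral mu [set: T] (fun x => F x * (G x)^*%C).

(* Linearity together with boundedness makes S compatible with equality
   mu-a.e., so that S is an operator on L_2(mu). *)
Definition bounded_operator (mu : {measure set T -> \bar R})
    (S : (T -> R[i]) -> (T -> R[i])) : Prop :=
  [/\ forall F, L2 mu F -> L2 mu (S F),
      forall (a : R[i]) F G, L2 mu F -> L2 mu G ->
        S (fun x => a * F x + G x) = (fun x => a * S F x + S G x) %[ae mu] &
      exists M : R, forall F, L2 mu F ->
        (L2norm mu (S F) <= M%:E * L2norm mu F)%E].

Definition has_rank (mu : {measure set T -> \bar R})
    (S : (T -> R[i]) -> (T -> R[i])) (m : nat) : Prop :=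
  exists e : 'I_m -> T -> R[i],
    [/\ forall i, L2 mu (e i) /\ exists2 F, L2 mu F & e i = S F %[ae mu],
        forall c : 'I_m -> R[i],
          (fun x => \sum_(i < m) c i * e i x) = (fun=> 0) %[ae mu] ->
          forall i, c i = 0 &
        forall F, L2 mu F -> exists c : 'I_m -> R[i],
          S F = (fun x => \sum_(i < m) c i * e i x) %[ae mu]].

End complex_functions.

Section contour_integral.
Context (R : realType).

Definition cexpi (t : R) : R[i] := cos t +i* sin t.

(* \oint f(z) dz over z = c + r e^(i t), t in [0, 2 pi] *)
Definition circle_integral (f : R[i] -> R[i]) (c : R[i]) (r : R) : R[i] :=
  cintegral (@lebesgue_measure R) `[0, 2 * pi]
    (fun t => f (c + r%:C * cexpi t) * ('i%C * r%:C * cexpi t)).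

End contour_integral.

Section spectrum.
Context d (T : measurableType d) (R : realType).
Implicit Types (P : R.-pker T ~> T) (mu : probability T R).

(* PF(x) = \int P(x,dy) F(y); for F in L_2(mu) with mu invariant, the integral
   exists for mu-a.e. x. *)
Definition kernel_op P (F : T -> R[i]) : T -> R[i] :=
  fun x => cintegral (P x) [set: T] F.

Definition is_resolvent P mu (z : R[i]) (S : (T -> R[i]) -> (T -> R[i])) :
    Prop :=
  bounded_operator mu S /\
  forall F, L2 mu F ->
    S (fun x => z * F x - kernel_op P F x) = F %[ae mu] /\
    (fun x => z * S F x - kernel_op P (S F) x) = F %[ae mu].

Definition spectrum2 P mu : set R[i] :=
  [set z | z != 0 /\ ~ exists S, is_resolvent P mu z S].

(* Q = (2 i pi)^-1 \oint (I z - P)^-1 dz over the circle of radius r around l,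
   the operator-valued integral being understood in the weak sense. The
   condition r < |l| keeps the point 0, which spectrum2 leaves out, outside
   the circle. *)
Definition spectral_projection P mu (l : R[i])
    (Q : (T -> R[i]) -> (T -> R[i])) : Prop :=
  bounded_operator mu Q /\
  exists (r : R) (S : R[i] -> (T -> R[i]) -> (T -> R[i])),
    [/\ 0 < r < Normc.normc l,
        forall z, spectrum2 P mu z -> Normc.normc (z - l) <= r -> z = l,
        forall z, Normc.normc (z - l) = r -> is_resolvent P mu z (S z) &
        forall F G, L2 mu F -> L2 mu G ->
          L2inner mu (Q F) G =
            (2 * 'i%C * pi%:C)^-1 *
            circle_integral (fun z => L2inner mu (S z F) G) l r].

Definition pole_of_multiplicity P mu (l : R[i]) (m : nat) : Prop :=
  spectrum2 P mu l /\
  exists2 Q, spectral_projection P mu l Q & has_rank mu Q m.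

Definition spectral_gap P mu : Prop :=
  exists2 eps : R, 0 < eps &
    let U := spectrum2 P mu `&` [set z | 1 - eps <= Normc.normc z] in
    finite_set U /\
    forall z, U z -> exists m : nat, pole_of_multiplicity P mu z m.

End spectrum.

(* Main.v *)
Require Import Defs.
From HB Require Import structures.
From mathcomp Require Import all_boot all_order all_algebra.
From mathcomp Require Import complex.
From mathcomp Require Import all_classical all_reals all_analysis.
From mathcomp Require Import measurable_realfun ring lra.


Set Implicit Arguments.
Unset Strict Implicit.
Unset Printing Implicit Defensive.

Import Order.TTheory GRing.Theory Num.Theory.
Import numFieldNormedType.Exports.
Import Normc.

Local Open Scope classical_set_scope.
Local Open Scope ring_scope.
Local Open Scope complex_scope.

(** Everything turns on one property: for some r < 1, [N (kop P f) <= r * N f] for all bounded [f]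
    of mean zero, where [N] is the norm of L_2(pi). It is linked to each side of the equivalence, in
    both directions.

    From ergodicity to contraction. The measure in the definition of geometric ergodicity is pi
    ([geometric_pi]), and on some set C of positive measure the constant and the rate can be taken
    uniform ([exists_uniform_set]). Reversibility then gives P^(2m)(x, A) >= pi(A)/4 for x in C and
    A inside C ([uniform_minorization]). Hence S = P^(2m) is the sum of the rank one operator f |->
    <f, e> e, with e = 1_C/2, and of a positive symmetric operator Q. The numbers <S^n e, e> and
    <Q^n e, e> are linked by a renewal equation, and geometric convergence of the former forces
    geometric decay of the latter ([renewal_decay]). For symmetric Q the map n |-> |Q^n f| is
    log-convex, so decay at infinity is decay at the first step ([nrm_rate]); with positivity and
    irreducibility this makes Q a strict contraction. Adding back the rank one term lifts only one
    direction, and the constants, fixed by S, account for it ([rank_one_gap]).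

    From contraction to spectral gap. The contraction extends to L_2(pi) by density. On mean zero
    functions z - P is inverted by a Neumann series when |z| > r, and on constants it is
    multiplication by z - 1. So 1 is the only spectral point outside the disc of radius r, and the
    contour integral of the Laurent expansion there is the mean, of rank one ([mean_op_projection]).

    From spectral gap to contraction. A ring just inside the unit circle is free of spectrum, so t^2
    - P^2 = (t - P)(t + P) is bounded below for t < 1 close to 1. For the positive operator A = P^2
    this forces uniform decay of A^n on the range of 1 - A ([isolated_gap]). Limits of A^n f are
    harmonic, hence constant by irreducibility and aperiodicity ([harmonic_trivial]), so mean zero
    functions are limits of that range ([resolvent_contraction]).

    From contraction to ergodicity. Decay in L_2 must become pointwise, uniformly over events. Some
    P^(n+1) dominates a kernel with bounded density against pi ([exists_small_kernel]), and that
    kernel sends L_2 into bounded functions. What remains is positive and a strict contraction of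
    L_2 ([remainder_contraction]), so its iterates on the constant 1 decay geometrically at almost
    every point. Expanding the powers of P^(n+1) along this splitting bounds all mean zero functions
    at once ([gap_pointwise]). *)

(** * Semidefinite inner products and symmetric operators *)

Section bilinear.
Context (R : realType) (V : lmodType R) (ip : V -> V -> R).
Hypothesis ipC : forall x y, ip x y = ip y x.
Hypothesis ipDl : forall x y z, ip (x + y) z = ip x z + ip y z.
Hypothesis ipZl : forall a x y, ip (a *: x) y = a * ip x y.
Hypothesis ip_ge0 : forall x, 0 <= ip x x.

Lemma ipDr x y z : ip x (y + z) = ip x y + ip x z.
Proof. by rewrite ipC ipDl !(ipC x). Qed.

Lemma ipZr a x y : ip x (a *: y) = a * ip x y.
Proof. by rewrite ipC ipZl (ipC x). Qed.

Lemma ipNl x y : ip (- x) y = - ip x y.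
Proof. by rewrite -scaleN1r ipZl mulN1r. Qed.

Lemma ipNr x y : ip x (- y) = - ip x y.
Proof. by rewrite -scaleN1r ipZr mulN1r. Qed.

Lemma ip0l x : ip 0 x = 0.
Proof. by rewrite -(scale0r 0) ipZl mul0r. Qed.

Lemma ip0r x : ip x 0 = 0.
Proof. by rewrite ipC ip0l. Qed.

Let ipE := (ipDl, ipDr, ipNl, ipNr, ipZl, ipZr).

(** Kept for semidefinite forms, since it is applied below to forms [ip (B x) y] with [B] a positive
    operator. When [ip y y = 0] the quadratic in [t] is affine, and [t] is chosen to give it the
    value -1. *)
Lemma cauchy_schwarz_form x y : ip x y ^+ 2 <= ip x x * ip y y.
Proof.
have h (t : R) : 0 <= ip x x + 2 * t * ip x y + t ^+ 2 * ip y y.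
  have := ip_ge0 (x + t *: y).
  by rewrite !ipE (ipC y x); congr (0 <= _); ring.
have [y0|y0] := eqVneq (ip y y) 0.
  rewrite y0 mulr0.
  have [->|xy0] := eqVneq (ip x y) 0; first by rewrite expr0n.
  have := h (- (ip x x + 1) / (2 * ip x y)); rewrite y0.
  have -> : 2 * (- (ip x x + 1) / (2 * ip x y)) * ip x y = - (ip x x + 1).
    by field.
  by lra.
have yp : 0 < ip y y by rewrite lt_neqAle eq_sym y0 ip_ge0.
have := h (- ip x y / ip y y).
have -> : ip x x + 2 * (- ip x y / ip y y) * ip x y +
    (- ip x y / ip y y) ^+ 2 * ip y y = ip x x - ip x y ^+ 2 / ip y y.
  by field.
by rewrite subr_ge0 ler_pdivrMr.
Qed.

End bilinear.

Section pre_hilbert.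
Context (R : realType) (V : lmodType R) (ip : V -> V -> R).
Hypothesis ipC : forall x y, ip x y = ip y x.
Hypothesis ipDl : forall x y z, ip (x + y) z = ip x z + ip y z.
Hypothesis ipZl : forall a x y, ip (a *: x) y = a * ip x y.
Hypothesis ip_ge0 : forall x, 0 <= ip x x.

Let ipDr := ipDr ipC ipDl.
Let ipZr := ipZr ipC ipZl.
Let ipNl := ipNl ipZl.
Let ipNr := ipNr ipC ipZl.
Let ip0l := ip0l ipZl.
Let ip0r := ip0r ipC ipZl.
Let ipE := (ipDl, ipDr, ipNl, ipNr, ipZl, ipZr).
Let cauchy_schwarz := cauchy_schwarz_form ipC ipDl ipZl ip_ge0.

Definition nrm x := Num.sqrt (ip x x).

Lemma nrm_ge0 x : 0 <= nrm x. Proof. exact: sqrtr_ge0. Qed.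

Lemma nrm_sq x : nrm x ^+ 2 = ip x x.
Proof. by rewrite sqr_sqrtr. Qed.

Lemma nrm0 : nrm 0 = 0.
Proof. by rewrite /nrm ip0l sqrtr0. Qed.

Lemma ip_le_nrm x y : `|ip x y| <= nrm x * nrm y.
Proof.
rewrite -(@ler_pXn2r _ 2) ?nnegrE ?mulr_ge0 ?nrm_ge0//.
by rewrite real_normK ?num_real// exprMn !nrm_sq cauchy_schwarz.
Qed.

Lemma nrmZ a x : nrm (a *: x) = `|a| * nrm x.
Proof.
by rewrite /nrm !ipE mulrA -expr2 sqrtrM ?sqr_ge0// sqrtr_sqr.
Qed.

Lemma nrmN x : nrm (- x) = nrm x.
Proof. by rewrite -scaleN1r nrmZ normrN1 mul1r. Qed.

Lemma nrmD x y : nrm (x + y) <= nrm x + nrm y.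
Proof.
rewrite -(@ler_pXn2r _ 2) ?nnegrE ?addr_ge0 ?nrm_ge0//.
rewrite sqrrD !nrm_sq !ipE (ipC y x).
have := le_trans (ler_norm _) (ip_le_nrm x y).
by rewrite mulr2n; lra.
Qed.

Lemma nrmB x y : nrm (x - y) <= nrm x + nrm y.
Proof. by rewrite -(nrmN y) nrmD. Qed.

Lemma nrm_sum n (F : 'I_n -> V) : nrm (\sum_(i < n) F i) <= \sum_(i < n) nrm (F i).
Proof.
elim/big_ind2: _ => [|x1 x2 y1 y2 h1 h2|//]; first by rewrite nrm0.
by rewrite (le_trans (nrmD _ _))// lerD.
Qed.

Section symmetric_operator.
Variable A : {linear V -> V}.
Hypothesis A_sym : forall x y, ip (A x) y = ip x (A y).

Lemma iter_sym n x y : ip (iter n A x) y = ip x (iter n A y).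
Proof. by elim: n x y => //= n IH x y; rewrite A_sym IH -iterSr. Qed.

Lemma nrm_sym_sq x : nrm (A x) ^+ 2 <= nrm x * nrm (A (A x)).
Proof. by rewrite nrm_sq A_sym (le_trans (ler_norm _))// ip_le_nrm. Qed.

(** By [nrm_sym_sq] the ratios of successive norms |A^n x| are nondecreasing, so a lower bound for
    the first ratio persists. *)
Lemma nrm_iter_ge x q n : 0 <= q -> q * nrm x <= nrm (A x) -> 0 < nrm x ->
  q * nrm (iter n A x) <= nrm (iter n.+1 A x).
Proof.
move=> q0 hq x0; case: (ltP 0 q) => [{}q0|q0']; last first.
  by rewrite (@le_trans _ _ 0)// ?nrm_ge0// mulr_le0_ge0// nrm_ge0.
have : q * nrm (iter n A x) <= nrm (iter n.+1 A x) /\ 0 < nrm (iter n A x).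
  elim: n => [//|n [IH hn]].
  have h1 : 0 < nrm (iter n.+1 A x) by rewrite (lt_le_trans _ IH)// mulr_gt0.
  split=> //; rewrite -(ler_pM2l hn) /=.
  have := nrm_sym_sq (iter n A x) => /=; apply: le_trans.
  rewrite expr2 mulrA; apply: ler_wpM2r; first exact: ltW.
  by rewrite mulrC.
by case.
Qed.

Lemma nrm_iter_ge_exp x q n : 0 <= q -> q * nrm x <= nrm (A x) -> 0 < nrm x ->
  q ^+ n * nrm x <= nrm (iter n A x).
Proof.
move=> q0 hq x0; elim: n => [|n IH]; first by rewrite expr0 mul1r.
rewrite (le_trans _ (nrm_iter_ge n q0 hq x0))//.
by rewrite exprS -mulrA ler_wpM2l.
Qed.

(* Log-convexity of n |-> |A^n x|: an eventual rate of decay is a rate of decay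
   at the first step. *)
Lemma nrm_rate x K r : 0 <= r -> (forall n, nrm (iter n A x) <= K * r ^+ n) ->
  nrm (A x) <= r * nrm x.
Proof.
move=> r0 h; have [x0|x0] := leP (nrm x) 0.
  have xe : nrm x = 0 by apply/eqP; rewrite eq_le x0 nrm_ge0.
  rewrite xe mulr0.
  have := nrm_sym_sq x; rewrite xe mul0r => h2.
  have : nrm (A x) ^+ 2 = 0 by apply/eqP; rewrite eq_le h2 sqr_ge0.
  by move/eqP; rewrite sqrf_eq0 => /eqP ->.
rewrite leNgt; apply/negP => hlt.
have K0 : 0 < K by have := h 0%N; rewrite /= expr0 mulr1; exact: lt_le_trans.
(* The first ratio [q] exceeds [r], so |A^n x| grows at least like q^n, against the bound K r^n. *)
have [q [rq hq]] : exists q, r < q /\ q * nrm x <= nrm (A x).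
  exists (nrm (A x) / nrm x); split; first by rewrite ltr_pdivlMr.
  by rewrite divfK// gt_eqF.
have q0 : 0 < q by apply: le_lt_trans rq.
have hn n : nrm x / K <= (r / q) ^+ n.
  rewrite ler_pdivrMr// expr_div_n mulrAC ler_pdivlMr ?exprn_gt0// mulrC.
  by rewrite (le_trans (nrm_iter_ge_exp n (ltW q0) hq x0))// mulrC.
have : (fun n => (r / q) ^+ n) @ \oo --> (0 : R).
  by apply: cvg_expr; rewrite ger0_norm ?divr_ge0// ?(ltW q0)// ltr_pdivrMr ?mul1r.
move/cvgrPdist_lt => /(_ (nrm x / K)).
rewrite divr_gt0// => /(_ isT)[N _ /(_ N (leqnn N))] /=.
rewrite sub0r normrN ger0_norm ?exprn_ge0 ?divr_ge0// ?ltW// ltNge.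
by rewrite hn.
Qed.

End symmetric_operator.

(** A min-max argument: some combination [w] of [g] and the eigenvector [o] is orthogonal to [e]. As
    [g] is orthogonal to [o], the form of [S] at [w] splits into [ip g e ^+ 2] plus [ip o e ^+ 2]
    times the form at [g], and [q <= 1] discards the first part. *)
Lemma rank_one_gap (S : {linear V -> V}) (e o : V) (q : R) :
  ip o o = 1 -> ip o e != 0 -> S o = o -> q <= 1 ->
  (forall x y, ip (S x) y = ip x (S y)) ->
  (forall w, ip w e = 0 -> ip (S w) w <= q * ip w w) ->
  forall g, ip g o = 0 -> ip (S g) g <= q * ip g g.
Proof.
move=> oo oe So q1 Ssym hw g go.
pose w := ip g e *: o - ip o e *: g.
have we : ip w e = 0 by rewrite /w !ipE; ring.
have := hw _ we; rewrite /w linearB !linearZ_LR So !ipE (ipC o g) go oo.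
rewrite (Ssym g o) So go.
set b := ip o e; set a := ip g e => h.
have {}h : b ^+ 2 * ip (S g) g <= b ^+ 2 * (q * ip g g).
  have : 0 <= (1 - q) * a ^+ 2 by rewrite mulr_ge0 ?subr_ge0 ?sqr_ge0.
  move: h; rewrite !(mulr0, oppr0, addr0, add0r, mulr1, mulrN, opprK, sub0r) => h.
  by nra.
by move: h; rewrite ler_pM2l// lt_neqAle sqr_ge0 eq_sym sqrf_eq0 oe.
Qed.



(** * An isolated top of the spectrum of a positive contraction *)

Section isolated_point.
Variable A : {linear V -> V}.
Hypothesis A_sym : forall x y, ip (A x) y = ip x (A y).
Hypothesis A_ge0 : forall x, 0 <= ip (A x) x.
Hypothesis A_le1 : forall x, nrm (A x) <= nrm x.

Let D x := x - A x.

Let D_ge0 x : 0 <= ip (D x) x.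
Proof.
rewrite /D !ipE subr_ge0 (le_trans (ler_norm _))// (le_trans (ip_le_nrm _ _))//.
by rewrite -nrm_sq expr2 ler_wpM2r// nrm_ge0.
Qed.

(* If m is the largest lower bound of t - A, then B = (t - A)^2 - m^2 >= 0
   is not bounded below, and B = (t - m - A)(t + m - A). *)
Lemma isolated_lower_bound eps t : 0 < eps ->
  (forall s, 1 - eps < s < 1 -> exists2 c, 0 < c &
    forall x, c * nrm x <= nrm (s *: x - A x)) ->
  1 - eps / 2 < t < 1 -> 0 <= t ->
  forall x, (1 - t) * nrm x <= nrm (t *: x - A x).
Proof.
move=> e0 h /andP[t1 t2] t0 x0; rewrite leNgt; apply/negP => hx0.
have nx0 : 0 < nrm x0.
  rewrite lt_neqAle nrm_ge0 andbT; apply: contraTneq hx0 => <-.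
  by rewrite mulr0 -leNgt nrm_ge0.
pose E := [set c | 0 <= c /\ forall x, c * nrm x <= nrm (t *: x - A x)].
pose q := nrm (t *: x0 - A x0) / nrm x0.
have q1 : q < 1 - t by rewrite ltr_pdivrMr.
have Eq c : E c -> c <= q by move=> [_ /(_ x0)]; rewrite ler_pdivlMr.
have E0 : E 0 by split => // x; rewrite mul0r nrm_ge0.
have supE : has_sup E by split; [exists 0 | exists q => c /Eq].
pose m := sup E.
have mq : m <= q by apply: sup_le_ub; [exists 0 | move=> c /Eq].
have m0 : 0 <= m by apply: ub_le_sup => //; case: supE.
have mE x : m * nrm x <= nrm (t *: x - A x).
  have [nx|nx] := leP (nrm x) 0.
    by rewrite (le_trans _ (nrm_ge0 _))// mulr_ge0_le0.
  rewrite -ler_pdivlMr//; apply: sup_le_ub; first by exists 0.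
  by move=> c [_ hc]; rewrite ler_pdivlMr.
(* Since [m < 1 - t] and [t > 1 - eps / 2], both [t - m] and [t + m] lie in the interval where [h]
   applies. *)
have [c1 c10 hc1] : exists2 c, 0 < c &
    forall x, c * nrm x <= nrm ((t - m) *: x - A x).
  by apply: h; apply/andP; split; lra.
have [c2 c20 hc2] : exists2 c, 0 < c &
    forall x, c * nrm x <= nrm ((t + m) *: x - A x).
  by apply: h; apply/andP; split; lra.
have [C CE] : exists C, forall x, C x = t *: x - A x by exists (fun x => t *: x - A x).
have [B BE] : exists B, forall x, B x = C (C x) - m ^+ 2 *: x.
  by exists (fun x => C (C x) - m ^+ 2 *: x).
have Csym x y : ip (C x) y = ip x (C y) by rewrite !CE !ipE A_sym.
have CD x y : C (x + y) = C x + C y.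
  by rewrite !CE scalerDr (linearD A) opprD addrACA.
have CZ a x : C (a *: x) = a *: C x.
  by rewrite !CE (linearZ_LR A) scalerBr !scalerA mulrC.
have Bsym x y : ip (B x) y = ip x (B y) by rewrite !BE !ipE !Csym.
have Bxx x : ip (B x) x = nrm (C x) ^+ 2 - m ^+ 2 * nrm x ^+ 2.
  by rewrite !BE !ipE Csym !nrm_sq.
have B0 x : 0 <= ip (B x) x.
  rewrite Bxx -exprMn subr_ge0 ler_pXn2r ?nnegrE ?mulr_ge0 ?nrm_ge0//.
  by rewrite CE mE.
have BC x y : ip (B x) y ^+ 2 <= ip (B x) x * ip (B y) y.
  apply: (@cauchy_schwarz_form _ _ (fun x y => ip (B x) y)) => //.
  - by move=> u v; rewrite Bsym ipC.
  - move=> u v w; have -> : B (u + v) = B u + B v.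
      by rewrite !BE (CD u v) (CD (C u)) [m ^+ 2 *: (u + v)]scalerDr opprD addrACA.
    exact: ipDl.
  - move=> a u v; have -> : B (a *: u) = a *: B u.
      by rewrite !BE (CZ a u) (CZ a (C u)) scalerBr !scalerA mulrC.
    exact: ipZl.
have C2 x : nrm (C x) <= 2 * nrm x.
  rewrite CE (le_trans (nrmB _ _))// nrmZ ger0_norm//.
  have := A_le1 x; have := nrm_ge0 x => h1 h2.
  have : t * nrm x <= 1 * nrm x by rewrite ler_wpM2r// ltW.
  by lra.
(* Cauchy-Schwarz for the form of [B] between [x] and [B x], together with B <= C^2 <= 4. *)
have BB x : nrm (B x) ^+ 2 <= 4 * ip (B x) x.
  have [b0|b0] := eqVneq (nrm (B x)) 0.
    by rewrite b0 expr0n mulr_ge0.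
  have bp : 0 < nrm (B x) ^+ 2 by rewrite exprn_gt0// lt_neqAle eq_sym b0 nrm_ge0.
  rewrite -(ler_pM2r bp) -expr2 nrm_sq (le_trans (BC _ _))//.
  rewrite -nrm_sq [leRHS](_ : _ = ip (B x) x * (4 * nrm (B x) ^+ 2)); last by ring.
  apply: ler_wpM2l; first exact: B0.
  rewrite Bxx (@le_trans _ _ (nrm (C (B x)) ^+ 2))//.
    by rewrite gerDl oppr_le0 mulr_ge0 ?sqr_ge0.
  have -> : 4 * nrm (B x) ^+ 2 = (2 * nrm (B x)) ^+ 2 by ring.
  by rewrite ler_pXn2r ?nnegrE ?mulr_ge0 ?nrm_ge0.
have Blow x : c1 * c2 * nrm x <= nrm (B x).
  have -> : B x = (t - m) *: ((t + m) *: x - A x) - A ((t + m) *: x - A x).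
    have EAB a b : a *: (b *: x - A x) - A (b *: x - A x) =
        (a * b) *: x - (a + b) *: A x + A (A x).
      rewrite scalerBr scalerA (linearB A) (linearZ_LR A) opprB scalerDl opprD.
      by rewrite -!addrA; congr (_ + (_ + _)); rewrite addrC.
    rewrite BE !CE !EAB.
    have -> : (t - m) * (t + m) = t * t - m ^+ 2 by ring.
    have -> : t - m + (t + m) = t + t by ring.
    by rewrite scalerBl -!addrA; congr (_ + _); rewrite [RHS]addrC -addrA.
  rewrite (le_trans _ (hc1 _))// -mulrA ler_wpM2l// ltW//.
have c0 : 0 < c1 * c2 by rewrite mulr_gt0.
(* Combining [Blow] and [BB] improves the lower bound of [C] strictly beyond the supremum [m]. *)
pose m' := Num.sqrt (m ^+ 2 + (c1 * c2) ^+ 2 / 4).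
have m'E : E m'.
  split; first exact: sqrtr_ge0.
  move=> x; rewrite -(@ler_pXn2r _ 2) ?nnegrE ?mulr_ge0 ?nrm_ge0 ?sqrtr_ge0//.
  rewrite exprMn sqr_sqrtr; last by rewrite addr_ge0 ?sqr_ge0// divr_ge0 ?sqr_ge0.
  have := BB x; rewrite Bxx.
  have : (c1 * c2 * nrm x) ^+ 2 <= nrm (B x) ^+ 2.
    by rewrite ler_pXn2r ?nnegrE ?nrm_ge0 ?mulr_ge0 ?nrm_ge0// ?ltW.
  rewrite exprMn CE; lra.
have : m' <= m by apply: ub_le_sup => //; case: supE.
apply/negP; rewrite -ltNge -(@ltr_pXn2r _ 2) ?nnegrE ?sqrtr_ge0//.
rewrite sqr_sqrtr; last by rewrite addr_ge0 ?sqr_ge0// divr_ge0 ?sqr_ge0.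
by rewrite ltrDl divr_gt0// exprn_gt0.
Qed.

(** With D = 1 - A, [isolated_lower_bound] at 1 - k/2 says D^2 >= k D: the spectrum of D has a hole
    between 0 and k. On the range of D this becomes A <= 1 - k. *)
Lemma isolated_gap eps : 0 < eps ->
  (forall s, 1 - eps < s < 1 -> exists2 c, 0 < c &
    forall x, c * nrm x <= nrm (s *: x - A x)) ->
  exists k, [/\ 0 < k, k < 1 &
    forall x n, nrm (iter n A (x - A x)) <= (1 - k) ^+ n * nrm (x - A x)].
Proof.
move=> e0 h; pose k := Num.min eps 1 / 2.
have k0 : 0 < k by rewrite divr_gt0// lt_min e0 ltr01.
have ke : k <= eps / 2 by rewrite ler_pM2r ?invr_gt0// ge_min lexx.
have k1 : k <= 1 / 2 by rewrite ler_pM2r ?invr_gt0// ge_min lexx orbT.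
exists k; split => //; first by lra.
(* Obtained by squaring |D x - (k/2) x| >= (k/2) |x|. *)
have D1 x : k * ip (D x) x <= ip (D x) (D x).
  have t1 : 1 - eps / 2 < 1 - k / 2 < 1 by apply/andP; split; lra.
  have t0 : 0 <= 1 - k / 2 by lra.
  have := isolated_lower_bound e0 h t1 t0 x.
  have -> : (1 - k / 2) *: x - A x = D x - (k / 2) *: x.
    by rewrite /D scalerBl scale1r addrAC.
  have kk : 0 <= 1 - (1 - k / 2) by lra.
  move: (D x) => y hD.
  have : ((1 - (1 - k / 2)) * nrm x) ^+ 2 <= nrm (y - (k / 2) *: x) ^+ 2.
    by rewrite ler_pXn2r ?nnegrE ?mulr_ge0 ?nrm_ge0.
  rewrite exprMn !nrm_sq !ipE (ipC x y).
  have -> : 1 - (1 - k / 2) = k / 2 by ring.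
  by nra.
have Dsym x y : ip (D x) y = ip x (D y) by rewrite /D !ipE A_sym.
(* Cauchy-Schwarz for the form of [D] between [x] and [D x], the factor [ip (D x) x] being bounded
   by [D1]. *)
have D2 x : k * ip (D x) (D x) <= ip (D (D x)) (D x).
  have [->|a2] := eqVneq (ip (D x) (D x)) 0; first by rewrite mulr0.
  have a2p : 0 < ip (D x) (D x) by rewrite lt_neqAle eq_sym a2 ip_ge0.
  have : ip (D x) (D x) ^+ 2 <= ip (D x) x * ip (D (D x)) (D x).
    apply: (@cauchy_schwarz_form _ _ (fun x y => ip (D x) y)) => //.
    - by move=> u v; rewrite Dsym ipC.
    - by move=> u v w; rewrite /D linearD opprD addrACA ipDl.
    - by move=> a u v; rewrite /D linearZ_LR -scalerBr ipZl.
  have := D1 x; have := D_ge0 (D x); move: a2p.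
  set a := ip (D x) (D x); set b := ip (D x) x; set c := ip (D (D x)) _.
  move=> a0 c0 ab abc; rewrite -(ler_pM2r a0).
  have : k * (a ^+ 2) <= k * (b * c) by rewrite ler_wpM2l// ltW.
  have : k * b * c <= a * c by rewrite ler_wpM2r.
  by lra.
have Ax u : A u = u - D u by rewrite /D opprB addrC subrK.
have A1 x : ip (A (D x)) (D x) <= (1 - k) * ip (D x) (D x).
  by rewrite Ax ipDl ipNl; have := D2 x; lra.
have AD x : A (D x) = D (A x) by rewrite /D linearB.
(* From the form to the norm: Cauchy-Schwarz for the form of [A] between [u] and [A u], with [A1]
   used at both points since [A] commutes with [D]. *)
have A2 x : nrm (A (D x)) <= (1 - k) * nrm (D x).
  set u := D x.
  have : ip (A u) (A u) ^+ 2 <= ip (A u) u * ip (A (A u)) (A u).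
    apply: (@cauchy_schwarz_form _ _ (fun x y => ip (A x) y)) => //.
    - by move=> v w; rewrite A_sym ipC.
    - by move=> v w z; rewrite linearD ipDl.
    - by move=> a v w; rewrite linearZ_LR ipZl.
  have [->|Au] := eqVneq (nrm (A u)) 0; first by rewrite mulr_ge0 ?nrm_ge0//; lra.
  have Aup : 0 < nrm (A u) by rewrite lt_neqAle eq_sym Au nrm_ge0.
  have := A1 (A x); rewrite -AD -/u => h1 h2.
  have k1' : 0 <= 1 - k by lra.
  have {}h2 : ip (A u) (A u) ^+ 2 <= (1 - k) * ip u u * ((1 - k) * ip (A u) (A u)).
    by rewrite (le_trans h2)// ler_pM// A1.
  move: h2; rewrite -!nrm_sq => h2.
  rewrite -(@ler_pXn2r _ 2) ?nnegrE ?mulr_ge0 ?nrm_ge0//.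
  rewrite -(@ler_pM2r _ (nrm (A u) ^+ 2)) ?exprn_gt0//.
  by move: h2; rewrite exprMn; set a := nrm (A u); set b := nrm u; lra.
move=> x; elim=> [|n IH]; first by rewrite expr0 mul1r.
have De : iter n A (x - A x) = D (iter n A x).
  by elim: n {IH} => //= n ->; rewrite AD.
rewrite iterS De (le_trans (A2 _))// exprS -mulrA -De ler_wpM2l//.
by lra.
Qed.

End isolated_point.
End pre_hilbert.

(* With u_n = c + v_n the renewal equation reads
   c (1 - F_n) = f_(n+1) + sum_(j <= n) v_j f_(n-j) - v_(n+1), F_n the partial
   sums of f. Hence A_n = sum_(j <= n) r^j f_(n-j) dominates 1 - F_n up to
   O(r^n), and A_n + (1 - F_n) is a Lyapunov function, since it decreases by
   exactly (1 - r) A_n. *)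
Lemma renewal_decay (R : realType) (f u : nat -> R) (c K r : R) :
  (forall n, 0 <= f n) -> (forall n, \sum_(i < n.+1) f i <= 1) ->
  (forall n, u n.+1 = f n.+1 + \sum_(j < n.+1) f (n - j)%N * u j) ->
  0 < c -> 0 < r < 1 -> (forall n, `|u n - c| <= K * r ^+ n) ->
  exists C q, [/\ 0 < q < 1 & forall n, f n <= C * q ^+ n].
Proof.
move=> f0 F1 ren c0 /andP[r0 r1] hu.
have K0 : 0 <= K by have := hu 0%N; rewrite expr0 mulr1; exact: le_trans.
pose g n := 1 - \sum_(i < n.+1) f i.
pose A n := \sum_(j < n.+1) r ^+ j * f (n - j)%N.
have g0 n : 0 <= g n by rewrite subr_ge0.
have gS n : g n.+1 = g n - f n.+1 by rewrite /g big_ord_recr /= opprD addrA.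
have A0 n : 0 <= A n.
  by apply: sumr_ge0 => j _; rewrite mulr_ge0// exprn_ge0// ltW.
have AS n : A n.+1 = r * A n + f n.+1.
  rewrite /A big_ord_recl expr0 mul1r subn0 addrC; congr (_ + _).
  by rewrite big_distrr; apply: eq_bigr => j _ /=; rewrite exprS mulrA subSS.
have fA n : f n <= A n.
  rewrite /A big_ord_recl expr0 mul1r subn0 lerDl.
  by apply: sumr_ge0 => j _; rewrite mulr_ge0// exprn_ge0// ltW.
have gA n : c * g n <= f n.+1 + K * A n + K * r ^+ n.+1.
  have -> : c * g n = f n.+1 + \sum_(j < n.+1) (u j - c) * f (n - j)%N
      - (u n.+1 - c).
    rewrite ren /g.
    have -> : \sum_(i < n.+1) f i = \sum_(j < n.+1) f (n - j)%N.
      rewrite (reindex_inj rev_ord_inj) /=; apply: eq_bigr => j _.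
      by rewrite subSS.
    rewrite mulrBr mulr1 big_distrr /=.
    have -> : \sum_(j < n.+1) (u j - c) * f (n - j)%N =
      \sum_(j < n.+1) f (n - j)%N * u j - \sum_(j < n.+1) c * f (n - j)%N.
      by rewrite -sumrB; apply: eq_bigr => j _; ring.
    by ring.
  rewrite -addrA -[leRHS]addrA lerD2l lerD//.
    rewrite big_distrr /=; apply: ler_sum => j _; rewrite mulrA ler_wpM2r//.
    by rewrite (le_trans _ (hu j))// ler_norm.
  by rewrite (le_trans _ (hu _))// -normrN ler_norm.
pose L := 1 + K / r.
have L0 : 0 < L by rewrite ltr_pwDl// divr_ge0// ltW.
have gL n : c * g n.+1 <= L * A n.+1 + K * r ^+ n.+1.
  apply: (@le_trans _ _ (c * g n)).
    by apply: ler_wpM2l; [exact: ltW | rewrite gS gerDl oppr_le0].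
  apply: le_trans (gA n) _; rewrite lerD2r mulrDl mul1r lerD// mulrAC.
  by rewrite -mulrA ler_wpM2l// ler_pdivlMr// AS mulrC lerDl.
(* Up to O(r^n), [gL] bounds c psi by (c + L) A, so subtracting (1 - r) A multiplies psi by at most
   this [q]. *)
pose q := 1 - (1 - r) * (c / (c + L)).
have cL : 0 < c + L by rewrite addr_gt0.
have cL1 : c / (c + L) < 1 by rewrite ltr_pdivrMr// mul1r ltrDl.
have cL0 : 0 < c / (c + L) by rewrite divr_gt0.
have q1 : q < 1 by rewrite /q ltrBlDr ltrDl mulr_gt0// subr_gt0.
have rq : r < q by rewrite /q; nra.
pose psi n := A n.+1 + g n.+1.
have psiS n : psi n.+1 <= q * psi n + K * r ^+ n.
  have -> : psi n.+1 = psi n - (1 - r) * A n.+1 by rewrite /psi AS gS; ring.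
  have : c / (c + L) * psi n - K * r ^+ n <= A n.+1.
    have h : c * psi n <= (c + L) * A n.+1 + K * r ^+ n.+1.
      by rewrite /psi; have := gL n; lra.
    have h2 : c / (c + L) * psi n <= A n.+1 + K * r ^+ n.+1 / (c + L).
      rewrite mulrAC ler_pdivrMr// mulrDl divfK ?gt_eqF// (mulrC (A _)).
      exact: h.
    have h3 : K * r ^+ n.+1 / (c + L) <= K * r ^+ n.
      rewrite ler_pdivrMr// -mulrA ler_wpM2l//.
      rewrite exprS mulrC ler_wpM2l ?exprn_ge0 ?ltW//.
      have : 1 <= L by rewrite /L lerDl divr_ge0// ltW.
      by lra.
    by lra.
  rewrite /q => h; have : (1 - r) * (c / (c + L) * psi n - K * r ^+ n) <=
    (1 - r) * A n.+1 by rewrite ler_wpM2l// subr_ge0 ltW.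
  have : r * (K * r ^+ n) >= 0 by rewrite !mulr_ge0 ?exprn_ge0// ltW.
  by lra.
(* The value for which the term [- E * r ^+ n] absorbs the forcing [K * r ^+ n] in the recursion. *)
pose E := K / (q - r).
have qr : 0 < q - r by rewrite subr_gt0.
have psin n : psi n <= (psi 0%N + E) * q ^+ n - E * r ^+ n.
  elim: n => [|n IH]; first by rewrite !expr0 !mulr1 addrK.
  apply: le_trans (psiS n) _.
  have : q * psi n <= q * ((psi 0%N + E) * q ^+ n - E * r ^+ n).
    by rewrite ler_wpM2l// ltW// (lt_trans r0).
  have KE : K = E * (q - r) by rewrite /E divfK// gt_eqF.
  rewrite !exprS; set x := q ^+ n; set y := r ^+ n => hx.
  by rewrite KE; lra.
have q0 : 0 < q by exact: lt_trans rq.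
have E0 : 0 <= E by rewrite divr_ge0// ltW.
exists (Num.max (f 0%N) ((psi 0%N + E) / q)), q; split; first by rewrite q0 q1.
case=> [|n]; first by rewrite expr0 mulr1 le_max lexx.
apply: (@le_trans _ _ ((psi 0%N + E) / q * q ^+ n.+1)); last first.
  apply: ler_wpM2r; first by rewrite exprn_ge0// ltW.
  by rewrite le_max lexx orbT.
rewrite exprS mulrA divfK ?gt_eqF//.
apply: le_trans (fA _) _; apply: (@le_trans _ _ (psi n)); first by rewrite lerDl.
by apply: le_trans (psin n) _; rewrite gerDl oppr_le0 mulr_ge0 ?exprn_ge0// ltW.
Qed.

(** * Bounded measurable functions and positive functionals *)

Section bounded_measurable.
Context d (T : measurableType d) (R : realType).

(** Genuine functions rather than classes: a kernel acts on them at every point, pointwise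
    inequalities make sense, and the inner product of L_2(pi) is a semidefinite form on them. *)
Definition bounded_mfun : {pred T -> R} :=
  mem [set f : T -> R | measurable_fun [set: T] f /\ exists M, forall x, `|f x| <= M].

Structure bfun := Bfun { bfun_val :> T -> R ; _ : bfun_val \in bounded_mfun }.

HB.instance Definition _ := [isSub for bfun_val].
HB.instance Definition _ := [Choice of bfun by <:].

Lemma bounded_mfun_submod_closed : submod_closed bounded_mfun.
Proof.
split; first by rewrite inE; split; [exact: measurable_cst | exists 0 => x; rewrite normr0].
move=> a f g; rewrite !inE => -[mf [M hM]] [mg [N hN]]; split.
  by apply: measurable_funD => //; exact: measurable_funM.
exists (`|a| * M + N) => x; rewrite (le_trans (ler_normD _ _))// lerD//.
by rewrite normrM ler_wpM2l.
Qed.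

HB.instance Definition _ :=
  GRing.isSubmodClosed.Build _ _ bounded_mfun bounded_mfun_submod_closed.
HB.instance Definition _ := [SubChoice_isSubLmodule of bfun by <:].

Implicit Types f g h : bfun.

Lemma bfunP (f g : bfun) : (forall x, f x = g x) -> f = g.
Proof. by move=> fg; apply/val_inj/funext. Qed.

Lemma bfun_measurable (f : bfun) : measurable_fun [set: T] f.
Proof. by case: f => f /=; rewrite inE => -[]. Qed.

Lemma bfun_bounded (f : bfun) : exists2 M, 0 <= M & forall x, `|f x| <= M.
Proof.
case: f => f /=; rewrite inE => -[_ [M hM]].
by exists (Num.max M 0) => [|x]; rewrite ?le_max ?hM ?lexx ?orbT.
Qed.

Lemma bfunD (f g : bfun) x : (f + g) x = f x + g x. Proof. by []. Qed.
Lemma bfunN (f : bfun) x : (- f) x = - f x. Proof. by []. Qed.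
Lemma bfunB f g x : (f - g) x = f x - g x. Proof. by []. Qed.
Lemma bfunZ a (f : bfun) x : (a *: f) x = a * f x. Proof. by []. Qed.
Lemma bfun0 x : (0 : bfun) x = 0. Proof. by []. Qed.
Lemma bfun_sum n (F : 'I_n -> bfun) x : (\sum_(i < n) F i) x = \sum_(i < n) F i x.
Proof. by elim/big_rec2: _ => [|i y z _ <-]. Qed.
Definition bfunE := (bfunD, bfunN, bfunZ, bfun0).

(** A total constructor with default value 0; every operation goes through it and is used only via
    its pointwise equation. *)
Definition mkb (f : T -> R) : bfun := insubd 0 f.

Lemma mkbE (f : T -> R) : measurable_fun [set: T] f ->
  (exists M, forall x, `|f x| <= M) -> forall x, mkb f x = f x.
Proof.
by move=> mf bf x; rewrite /mkb -[in RHS](@insubdK _ _ bfun 0 f)// inE.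
Qed.

Definition bcst (a : R) : bfun := mkb (cst a).
Lemma bcstE a x : bcst a x = a.
Proof. by apply: mkbE => //; exists `|a|. Qed.

Definition bmul (f g : bfun) : bfun := mkb (f \* g).
Lemma bmulE f g x : bmul f g x = f x * g x.
Proof.
apply: mkbE; first exact: measurable_funM (bfun_measurable f) (bfun_measurable g).
have [M M0 hM] := bfun_bounded f; have [N N0 hN] := bfun_bounded g.
by exists (M * N) => y; rewrite normrM ler_pM.
Qed.

Definition babs (f : bfun) : bfun := mkb (fun x => `|f x|).
Lemma babsE f x : babs f x = `|f x|.
Proof.
apply: (@mkbE (fun x => `|f x|)).
  by apply: measurableT_comp => //; exact: bfun_measurable.
by have [M M0 hM] := bfun_bounded f; exists M => y; rewrite normr_id.
Qed.

Definition bind (A : set T) : bfun := mkb \1_A.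
Lemma bindE A x : measurable A -> bind A x = \1_A x.
Proof.
move=> mA; apply: mkbE => //; exists 1 => y.
by rewrite ger0_norm// indicE ler_nat; case: (_ \in _).
Qed.

Lemma bind_ge0 A x : measurable A -> 0 <= bind A x.
Proof. by move=> mA; rewrite bindE. Qed.

Lemma bind_in A x : measurable A -> A x -> bind A x = 1.
Proof. by move=> mA Ax; rewrite bindE// indicE mem_set. Qed.

Lemma bind_out A x : measurable A -> ~ A x -> bind A x = 0.
Proof. by move=> mA Ax; rewrite bindE// indicE memNset. Qed.

Lemma bind_le1 A x : measurable A -> bind A x <= 1.
Proof. by move=> mA; rewrite bindE// indicE ler_nat; case: (_ \in _). Qed.

(* The layer-cake approximation: f is within M/k of (M/k) times the number of
   levels j M / k, 0 < j <= k, that it reaches. *)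
Lemma levels_count (k : nat) (y : R) : 0 <= y <= k%:R ->
  `|y - \sum_(j < k) (nat_of_bool (j.+1%:R <= y)%R)%:R| <= 1.
Proof.
elim: k => [|k IH] /andP[y0 yk].
  by rewrite big_ord0 subr0 ger0_norm// (le_trans yk)// ler01.
rewrite big_ord_recr /=; have [yk'|yk'] := leP y k%:R.
  rewrite [_ <= y]lt_geF ?addr0; first by apply: IH; rewrite y0.
  by rewrite (le_lt_trans yk')// ltr_nat.
have -> : \sum_(i < k) (nat_of_bool (i.+1%:R <= y)%R)%:R = k%:R :> R.
  under eq_bigr => i _ do rewrite (le_trans _ (ltW yk')) ?ler_nat//.
  by rewrite sumr_const card_ord.
rewrite -natr1 in yk *; have [h|h] := leP (k%:R + 1) y.
  have -> : y = k%:R + 1 by apply/eqP; rewrite eq_le yk h.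
  by rewrite subrr normr0 ler01.
by rewrite addr0 ger0_norm; lra.
Qed.

Definition blin (L : bfun -> R) : Prop := forall a (f g : bfun), L (a *: f + g) = a * L f + L g.
(** Quantifying over all bounds [M] of |f| avoids forming a supremum norm. *)
Definition bcont (L : bfun -> R) : Prop :=
  exists C : R, forall (f : bfun) M, (forall x, `|f x| <= M) -> `|L f| <= C * M.

Lemma blin0 L : blin L -> L 0 = 0.
Proof.
by move=> h; have := h (-1) 0 0; rewrite scaler0 addr0 mulN1r addNr.
Qed.

Lemma blinZ L a f : blin L -> L (a *: f) = a * L f.
Proof. by move=> h; have := h a f 0; rewrite (blin0 h) !addr0. Qed.

Lemma blinD L f g : blin L -> L (f + g) = L f + L g.
Proof. by move=> h; have := h 1 f g; rewrite scale1r mul1r. Qed.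

Lemma blinN L f : blin L -> L (- f) = - L f.
Proof. by move=> h; rewrite -scaleN1r blinZ// mulN1r. Qed.

Lemma blinB L f g : blin L -> L (f - g) = L f - L g.
Proof. by move=> h; rewrite blinD// blinN. Qed.

Lemma blin_sum L n (F : 'I_n -> bfun) : blin L ->
  L (\sum_(i < n) F i) = \sum_(i < n) L (F i).
Proof.
move=> h; elim/big_rec2: _ => [|i y z _ <-]; first exact: blin0.
by rewrite blinD.
Qed.

(** A nonnegative [f] is a uniform limit of nonnegative multiples of sums of indicators of its level
    sets, by [levels_count]. This replaces simple functions and monotone limits, and with [blin_le]
    and [blin_eq] extends relations between kernels from sets to functions. *)
Lemma blin_ge0 L : blin L -> bcont L ->
  (forall A, measurable A -> 0 <= L (bind A)) ->
  forall f, (forall x, 0 <= f x) -> 0 <= L f.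
Proof.
move=> linL [C hC] L0 f f0.
have [M M0 hM] := bfun_bounded f.
have C0 : 0 <= C.
  have h1 x : `|(0 : bfun) x| <= 1 by rewrite bfun0 normr0 ler01.
  by have := hC _ _ h1; rewrite mulr1; apply: le_trans; exact: normr_ge0.
have mA (c : R) : measurable [set x | c <= f x].
  by rewrite -[X in measurable X]setTI; have := bfun_measurable f measurableT (measurable_itv `[c, +oo[);
   rewrite set_itvE.
have key (k : nat) : - (C * (M + 1)) / k.+1%:R <= L f.
  (* With this mesh f/e stays at most k + 1, the number of levels. *)
  pose e := (M + 1) / k.+1%:R.
  have e0 : 0 < e by rewrite divr_gt0// ltr_wpDl.
  pose s : bfun := e *: \sum_(j < k.+1) bind [set x | e * j.+1%:R <= f x].
  have hs x : `|(f - s) x| <= e.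
    have -> : (f - s) x = e * (f x / e - \sum_(j < k.+1) (nat_of_bool (j.+1%:R <= f x / e)%R)%:R).
      rewrite !bfunE bfun_sum mulrBr; congr (_ - e * _).
        by rewrite mulrC divfK ?gt_eqF.
      apply: eq_bigr => j _; rewrite bindE// indicE; congr ((nat_of_bool _)%:R).
      rewrite ler_pdivlMr// mulrC.
      by apply/idP/idP => [/set_mem//|h]; rewrite mem_set.
    rewrite normrM gtr0_norm// ger_pMr// levels_count//.
    apply/andP; split; first by rewrite divr_ge0// ltW.
    rewrite ler_pdivrMr// mulrC /e divfK ?pnatr_eq0//.
    by have := hM x; rewrite ger0_norm//; lra.
  have := hC _ _ hs; rewrite blinB// => h1.
  have : 0 <= L s.
    rewrite blinZ// blin_sum//; apply: mulr_ge0; first exact: ltW.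
    by apply: sumr_ge0 => j _; exact: L0.
  have -> : - (C * (M + 1)) / k.+1%:R = - (C * e) by rewrite /e mulrA mulNr.
  by move: h1; rewrite ler_norml => /andP[h1 _] h2; lra.
rewrite leNgt; apply/negP => Lf.
have [k hk] : exists k : nat, C * (M + 1) / (- L f) < k.+1%:R.
  exists (Num.truncn (C * (M + 1) / (- L f))).
  exact: truncnS_gt.
have := key k; rewrite leNgt => /negP; apply.
rewrite ltr_pdivlMr ?ltr0n//.
move: hk; rewrite ltr_pdivrMr ?oppr_gt0//; lra.
Qed.

Lemma blin_le L1 L2 : blin L1 -> blin L2 -> bcont L1 -> bcont L2 ->
  (forall A, measurable A -> L1 (bind A) <= L2 (bind A)) ->
  forall f, (forall x, 0 <= f x) -> L1 f <= L2 f.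
Proof.
move=> l1 l2 [C1 c1] [C2 c2] h f f0; rewrite -subr_ge0.
apply: (@blin_ge0 (fun f => L2 f - L1 f)) => //.
- by move=> a u v; rewrite l1 l2; ring.
- exists (C2 + C1) => u M uM; rewrite (le_trans (ler_normB _ _))// mulrDl.
  by rewrite lerD ?c1 ?c2.
- by move=> A mA; rewrite subr_ge0 h.
Qed.

Lemma blin_eq L1 L2 : blin L1 -> blin L2 -> bcont L1 -> bcont L2 ->
  (forall A, measurable A -> L1 (bind A) = L2 (bind A)) ->
  forall f, L1 f = L2 f.
Proof.
move=> l1 l2 c1 c2 h f.
have [M M0 hM] := bfun_bounded f.
have pos g : (forall x, 0 <= g x) -> L1 g = L2 g.
  by move=> g0; apply/eqP; rewrite eq_le !blin_le// => A mA; rewrite h.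
have -> : f = (f + bcst M) - bcst M by rewrite addrK.
rewrite !blinB// !pos// => x; rewrite ?bfunE bcstE//.
by have := hM x; rewrite ler_norml => /andP[]; lra.
Qed.

Section integral.
Variable mu : {measure set T -> \bar R}.
Hypothesis muT : (mu [set: T] < +oo)%E.

Definition bint (f : bfun) : R := \int[mu]_x f x.

Lemma bfun_integrable (f : bfun) : mu.-integrable [set: T] (EFin \o f).
Proof.
apply: measurable_bounded_integrable => //; first exact: bfun_measurable.
have [M M0 hM] := bfun_bounded f.
exists M; split; first exact: num_real.
by move=> y My x _ /=; rewrite (le_trans (hM x))// ltW.
Qed.

Lemma bintE (f : bfun) : (bint f)%:E = (\int[mu]_x (f x)%:E)%E.
Proof. by rewrite /bint fineK//; exact: integrable_fin_num (bfun_integrable f). Qed.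

Lemma bint_lin : blin bint.
Proof.
move=> a f g; rewrite /bint RintegralD//=; first rewrite RintegralZl//.
- exact: bfun_integrable.
- exact: (bfun_integrable (a *: f)).
- exact: bfun_integrable.
Qed.

Lemma bint_mono (f g : bfun) : (forall x, f x <= g x) -> bint f <= bint g.
Proof. by move=> fg; apply: le_Rintegral => //; exact: bfun_integrable. Qed.

Lemma bint_ge0 (f : bfun) : (forall x, 0 <= f x) -> 0 <= bint f.
Proof. by move=> f0; exact: Rintegral_ge0. Qed.

Lemma bint_cst a : bint (bcst a) = a * fine (mu [set: T]).
Proof.
rewrite -Rintegral_cst//; apply: eq_Rintegral => x _; exact: bcstE.
Qed.

Lemma bint_le (f : bfun) M : (forall x, `|f x| <= M) ->
  `|bint f| <= fine (mu [set: T]) * M.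
Proof.
move=> fM; rewrite mulrC -bint_cst ler_norml -(blinN _ bint_lin).
by apply/andP; split; apply: bint_mono => x; rewrite ?bfunE bcstE;
  have := fM x; rewrite ler_norml => /andP[].
Qed.

Lemma bint_cont : bcont bint.
Proof. by exists (fine (mu [set: T])) => f M; exact: bint_le. Qed.

Lemma bint_ind A : measurable A -> bint (bind A) = fine (mu A).
Proof.
move=> mA; rewrite /bint /Rintegral; congr fine.
under eq_integral do rewrite bindE//.
by rewrite integral_indic// setIT.
Qed.

Lemma bint_abs (f : bfun) : `|bint f| <= bint (babs f).
Proof.
rewrite ler_norml -(blinN _ bint_lin); apply/andP; split;
  apply: bint_mono => x; rewrite ?bfunE babsE ?ler_norm//.
by rewrite lerNl -normrN ler_norm.
Qed.

Lemma bint_eq0 (f : bfun) : (forall x, 0 <= f x) -> bint f = 0 ->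
  {ae mu, forall x, f x = 0}.
Proof.
move=> f0 If.
have mf : measurable_fun [set: T] (EFin \o f).
  by apply/measurable_EFinP; exact: bfun_measurable.
have : ae_eq mu [set: T] (EFin \o f) (cst 0%E).
  apply/(ae_eq_integral_abs mu measurableT mf).
  under eq_integral => x _ do rewrite gee0_abs ?lee_fin//.
  by rewrite -bintE If.
by apply: filterS => x /(_ I) /= [].
Qed.

Lemma bint_ae_eq (f g : bfun) : {ae mu, forall x, f x = g x} -> bint f = bint g.
Proof.
move=> fg; rewrite /bint /Rintegral; congr fine; apply: ae_eq_integral => //.
- by apply/measurable_EFinP; exact: bfun_measurable.
- by apply/measurable_EFinP; exact: bfun_measurable.
- by apply: filterS fg => x /= -> _.
Qed.

Definition bip (f g : bfun) := bint (bmul f g).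

Lemma bipC f g : bip f g = bip g f.
Proof. by congr bint; apply/bfunP => x; rewrite !bmulE mulrC. Qed.

Lemma bip_linl g : blin (bip^~ g).
Proof.
move=> a u v; rewrite /bip -bint_lin; congr bint; apply/bfunP => x.
by rewrite !(bmulE, bfunE); ring.
Qed.

Lemma bipDl f g h : bip (f + g) h = bip f h + bip g h.
Proof. exact: (blinD _ _ (bip_linl h)). Qed.

Lemma bipZl a f g : bip (a *: f) g = a * bip f g.
Proof. exact: (blinZ _ _ (bip_linl g)). Qed.

Lemma bipBl f g h : bip (f - g) h = bip f h - bip g h.
Proof. exact: (blinB _ _ (bip_linl h)). Qed.

Lemma bip_ge0 f g : (forall x, 0 <= f x) -> (forall x, 0 <= g x) -> 0 <= bip f g.
Proof. by move=> f0 g0; apply: bint_ge0 => x; rewrite bmulE mulr_ge0. Qed.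

Lemma bip_diag_ge0 f : 0 <= bip f f.
Proof. by apply: bint_ge0 => x; rewrite bmulE -expr2 sqr_ge0. Qed.

Lemma bip_cont g : bcont (bip^~ g).
Proof.
have [N N0 hN] := bfun_bounded g.
exists (fine (mu [set: T]) * N) => f M fM; rewrite -mulrA; apply: bint_le => x.
by rewrite bmulE normrM mulrC ler_pM.
Qed.

Lemma bip1 f : bip f (bcst 1) = bint f.
Proof. by congr bint; apply/bfunP => x; rewrite bmulE bcstE mulr1. Qed.

Lemma bip_le f g h : (forall x, f x <= g x) -> (forall x, 0 <= h x) ->
  bip f h <= bip g h.
Proof.
by move=> fg h0; apply: bint_mono => x; rewrite !bmulE ler_wpM2r.
Qed.

End integral.

Section kernel_operator.
Variable k : R.-fker T ~> T.

Lemma fker_lty x : (k x [set: T] < +oo)%E.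
Proof. by have := fin_num_fun_lty (finite_kernel_measure k x). Qed.

Lemma fker_bound : exists2 C, 0 <= C & forall x, fine (k x [set: T]) <= C.
Proof.
have [r hr] := measure_uub k; exists `|r| => // x.
rewrite -lee_fin fineK ?ge0_fin_numE ?fker_lty//.
by rewrite (le_trans (ltW (hr x)))// lee_fin ler_norm.
Qed.

Definition kop (f : bfun) : bfun := mkb (fun x => bint (k x) f).

Lemma kopE f x : kop f x = bint (k x) f.
Proof.
apply: (@mkbE (fun x => bint (k x) f)).
  rewrite /bint /Rintegral; apply: measurableT_comp => //.
  under eq_fun do rewrite integralE.
  have mf : measurable_fun [set: T] (EFin \o f).
    by apply/measurable_EFinP; exact: bfun_measurable.
  apply: emeasurable_funB; apply: measurable_fun_integral_kernel => //.
  - by move=> U; exact: measurable_kernel.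
  - exact: measurable_funepos.
  - by move=> U; exact: measurable_kernel.
  - exact: measurable_funeneg.
have [M M0 hM] := bfun_bounded f.
have [C C0 hC] := fker_bound.
exists (C * M) => y; rewrite (le_trans (bint_le (fker_lty y) hM))//.
by rewrite ler_wpM2r.
Qed.

Lemma kop_linear : linear kop.
Proof.
by move=> a f g; apply/bfunP => x; rewrite kopE !bfunE !kopE bint_lin// fker_lty.
Qed.

HB.instance Definition _ := GRing.isLinear.Build R bfun bfun _ kop kop_linear.

Lemma kop_ge0 f : (forall x, 0 <= f x) -> forall x, 0 <= kop f x.
Proof. by move=> f0 x; rewrite kopE bint_ge0. Qed.

Lemma kop_mono f g : (forall x, f x <= g x) -> forall x, kop f x <= kop g x.
Proof. by move=> fg x; rewrite !kopE bint_mono// fker_lty. Qed.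

Lemma kop_ind A x : measurable A -> kop (bind A) x = fine (k x A).
Proof. by move=> mA; rewrite kopE bint_ind. Qed.

End kernel_operator.
End bounded_measurable.

(* Unfolding these makes unification compare the underlying functions. *)
#[global] Opaque mkb bcst bmul babs bind kop.

(** * The chain as a symmetric contraction *)

Section markov_chain.
Context d (T : measurableType d) (R : realType) (P : R.-pker T ~> T).
Local Notation V := (bfun T R).
Implicit Types f g h : V.

Lemma kop_cst a : kop P (bcst T a) = bcst T a.
Proof.
by apply/bfunP => x; rewrite kopE bint_cst prob_kernel mulr1 bcstE.
Qed.

Lemma iter_kop_cst n a : iter n (kop P) (bcst T a) = bcst T a.
Proof. by elim: n => //= n ->; rewrite kop_cst. Qed.

Lemma kop_bound f M : (forall x, `|f x| <= M) -> forall x, `|kop P f x| <= M.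
Proof.
move=> fM x; rewrite kopE (le_trans (bint_le (fker_lty P x) fM))//.
by rewrite prob_kernel mul1r.
Qed.

Lemma iter_kop_bound n f M : (forall x, `|f x| <= M) ->
  forall x, `|iter n (kop P) f x| <= M.
Proof. by move=> fM; elim: n => //= n IH x; exact: kop_bound. Qed.

Lemma iter_kop_ge0 n f : (forall x, 0 <= f x) -> forall x, 0 <= iter n (kop P) f x.
Proof. by move=> f0; elim: n => //= n IH x; exact: kop_ge0. Qed.

Lemma iter_kop_linear n a f g :
  iter n (kop P) (a *: f + g) = a *: iter n (kop P) f + iter n (kop P) g.
Proof. by elim: n => //= n ->; rewrite linearP. Qed.

Lemma iter_kopZ n a f : iter n (kop P) (a *: f) = a *: iter n (kop P) f.
Proof. by elim: n => //= n ->; rewrite linearZ. Qed.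

Lemma iter_kopD n f g : iter n (kop P) (f + g) = iter n (kop P) f + iter n (kop P) g.
Proof. by elim: n => //= n ->; rewrite linearD. Qed.

Lemma iter_kopB n f g : iter n (kop P) (f - g) = iter n (kop P) f - iter n (kop P) g.
Proof. by elim: n => //= n ->; rewrite linearB. Qed.

Lemma iter_kop_mono n f g : (forall x, f x <= g x) ->
  forall x, iter n (kop P) f x <= iter n (kop P) g x.
Proof. by move=> fg; elim: n => //= n IH x; exact: kop_mono. Qed.

Lemma kernel_iterT n x : kernel_iter P n x [set: T] = 1%E.
Proof.
elim: n x => [|n IH] x /=; first by rewrite /kdirac diracT.
rewrite /kcomp_noparam.
under eq_integral do rewrite IH.
by rewrite integral_cst// prob_kernel mul1e.
Qed.

Lemma kernel_iterE n x A : measurable A ->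
  kernel_iter P n x A = (iter n (kop P) (bind R A) x)%:E.
Proof.
move=> mA; elim: n x => [|n IH] x /=.
  by rewrite bindE// /kdirac/= diracE.
rewrite /kcomp_noparam.
under eq_integral do rewrite IH.
by rewrite kopE bintE// fker_lty.
Qed.

Lemma bint_kernel_iter n x f : bint (kernel_iter P n x) f = iter n (kop P) f x.
Proof.
have fin : (kernel_iter P n x [set: T] < +oo)%E by rewrite kernel_iterT ltry.
move: f; apply: blin_eq.
- exact: bint_lin.
- by move=> a f g; rewrite iter_kop_linear !bfunE.
- exact: bint_cont.
- by exists 1 => f M fM; rewrite mul1r; exact: iter_kop_bound.
- by move=> A mA; rewrite bint_ind// kernel_iterE.
Qed.

Section reversible.
Variables (pi : probability T R) (hrev : reversible P pi).

Lemma prob_lty : (pi [set: T] < +oo)%E.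
Proof. by rewrite probability_setT ltry. Qed.
Local Notation I := (bint pi).
Local Notation ip := (bip pi).
Local Notation N := (nrm (bip pi)).

Lemma pint_cst a : I (bcst T a) = a.
Proof. by rewrite bint_cst/= probability_setT/= mulr1. Qed.

Lemma pip_cst a f : ip f (bcst T a) = a * I f.
Proof.
rewrite -(blinZ _ _ (bint_lin prob_lty)); congr bint; apply/bfunP => x.
by rewrite bmulE bcstE bfunE mulrC.
Qed.

Let ipDl := bipDl prob_lty.
Let ipZl := bipZl prob_lty.
Let ipC := bipC pi.
Let ip0 := bip_diag_ge0 pi.

(** Detailed balance on rectangles is the identity for indicators; [blin_eq] extends it in one
    argument, then in the other. *)
Lemma kop_sym f g : ip (kop P f) g = ip f (kop P g).
Proof.
have rect A B : measurable A -> measurable B ->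
    ip (kop P (bind R A)) (bind R B) = ip (bind R A) (kop P (bind R B)).
  move=> mA mB.
  have := hrev (measurableX mB mA).
  have -> : (\int[pi]_x P x (xsection (B `*` A) x) =
      (ip (kop P (bind R A)) (bind R B))%:E)%E.
    rewrite bintE ?prob_lty//; apply: eq_integral => x _.
    rewrite bmulE kop_ind//; have [xB|xB] := boolP (x \in B).
      rewrite in_xsectionX// bind_in ?mulr1 ?fineK//; last exact/set_mem.
      exact: (finite_kernel_measure P x).
    by rewrite notin_xsectionX// measure0 bind_out ?mulr0// => /mem_set; exact/negP.
  have -> : (\int[pi]_x P x (ysection (B `*` A) x) =
      (ip (bind R A) (kop P (bind R B)))%:E)%E.
    rewrite bintE ?prob_lty//; apply: eq_integral => x _.
    rewrite bmulE kop_ind//; have [xA|xA] := boolP (x \in A).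
      rewrite in_ysectionX// bind_in ?mul1r ?fineK//; last exact/set_mem.
      exact: (finite_kernel_measure P x).
    by rewrite notin_ysectionX// measure0 bind_out ?mul0r// => /mem_set; exact/negP.
  by move=> [].
have linP h : blin (fun f => ip h (kop P f)).
  by move=> a u v; rewrite linearP/= !(ipC h) ipDl ipZl.
have contP h : bcont (fun f => ip h (kop P f)).
  have [C hC] := bip_cont prob_lty h; exists C => u M uM.
  by rewrite ipC; apply: hC; exact: kop_bound.
have half A g' : measurable A -> ip (kop P (bind R A)) g' = ip (bind R A) (kop P g').
  move=> mA; move: g'; apply: blin_eq => //.
  - by move=> a u v; rewrite !(ipC (kop _ _)) ipDl ipZl.
  - have [C hC] := bip_cont prob_lty (kop P (bind R A)); exists C => u M uM.
    by rewrite ipC; exact: hC.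
  - by move=> B mB; exact: rect.
move: f; apply: blin_eq.
- by move=> a u v; rewrite ipC linP -!(ipC (kop _ _)).
- by move=> a u v; rewrite ipDl ipZl.
- have [C hC] := contP g; exists C => u M uM; rewrite ipC; exact: hC.
- exact: (bip_cont prob_lty (kop P g)).
- by move=> A mA; exact: half.
Qed.

Lemma iter_kop_sym n f g : ip (iter n (kop P) f) g = ip f (iter n (kop P) g).
Proof. exact: (iter_sym kop_sym). Qed.

Lemma kop_inv f : I (kop P f) = I f.
Proof. by rewrite -bip1 kop_sym kop_cst bip1. Qed.

Lemma iter_kop_inv n f : I (iter n (kop P) f) = I f.
Proof. by elim: n => //= n <-; rewrite kop_inv. Qed.

(** (P f)^2 <= P(f^2) by Cauchy-Schwarz under each P(x, .), and P preserves the integral. *)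
Lemma kop_contraction f : N (kop P f) <= N f.
Proof.
rewrite /nrm ler_sqrt ?ip0// [leRHS](_ : _ = I (kop P (bmul f f))); last first.
  by rewrite kop_inv.
apply: bint_mono; first exact: prob_lty.
move=> x; rewrite bmulE !kopE -expr2.
have h := fker_lty P x.
have := cauchy_schwarz_form (bipC (P x)) (bipDl h) (bipZl h)
  (bip_diag_ge0 (P x)) f (bcst T 1).
rewrite !bip1 bint_cst prob_kernel mulr1 => /le_trans; apply.
by rewrite mulr1.
Qed.

Lemma iter_kop_contraction n f : N (iter n (kop P) f) <= N f.
Proof.
by elim: n => //= n IH; rewrite (le_trans (kop_contraction _)).
Qed.

Lemma nrm_eq0_ae f : N f = 0 -> {ae pi, forall x, f x = 0}.
Proof.
move=> f0; have : ip f f = 0 by rewrite -nrm_sq// f0 expr0n.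
move/(bint_eq0 prob_lty) => h; have {}h := h _; apply: filterS (h _) => [x|x].
  by rewrite bmulE => /eqP; rewrite mulf_eq0 orbb => /eqP.
by rewrite bmulE -expr2 sqr_ge0.
Qed.

Lemma bip_nonneg_eq0 f g : (forall x, 0 <= f x) -> (forall x, 0 <= g x) ->
  ip f g = 0 -> {ae pi, forall x, f x * g x = 0}.
Proof.
move=> f0 g0 /(bint_eq0 prob_lty) h; apply: filterS (h _) => [x|x].
  by rewrite bmulE.
by rewrite bmulE mulr_ge0.
Qed.

Lemma ae_notin_null A : measurable A -> {ae pi, forall x, ~ A x} -> pi A = 0%E.
Proof.
move=> mA h; apply/(negligibleP pi mA); apply: negligibleS h => x Ax /=.
by move=> /(_ Ax).
Qed.

(** If the pairings vanish, almost no point of [B] can be in [B'] at an even time, whereas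
    irreducibility and aperiodicity bring every point into [B'] at all large times. Even times are
    the ones that harmonic functions of P^2 control. *)
Lemma unreached_null (psi : {measure set T -> \bar R}) B B' :
  (forall A, measurable A -> (0 < psi A)%E ->
    forall x, \forall n \near \oo, (0 < kernel_iter P n x A)%E) ->
  measurable B -> measurable B' -> (0 < psi B')%E ->
  (forall n, ip (iter n.*2 (kop P) (bind R B')) (bind R B) = 0) ->
  pi B = 0%E.
Proof.
move=> irr mB mB' psiB' h; apply: ae_notin_null => //.
have : {ae pi, forall x, forall n,
    iter n.*2 (kop P) (bind R B') x * bind R B x = 0}.
  apply: ae_foralln => n; apply: bip_nonneg_eq0 => // x; last exact: bind_ge0.
  by apply: iter_kop_ge0 => y; exact: bind_ge0.
apply: filterS => x hx Bx.
have [n _ hn] := irr _ mB' psiB' x.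
have := hn n.*2; rewrite /= -addnn leq_addr => /(_ isT).
rewrite kernel_iterE// lte_fin.
have := hx n; rewrite bind_in// mulr1 addnn => ->.
by rewrite ltxx.
Qed.

(** One of [B] and its complement is charged by psi, and then the other is pi-null by
    [unreached_null]; symmetry of the iterates makes the hypothesis serve both cases. *)
Lemma dichotomy (psi : {measure set T -> \bar R}) B :
  (psi [set: T] != 0)%E ->
  (forall A, measurable A -> (0 < psi A)%E ->
    forall x, \forall n \near \oo, (0 < kernel_iter P n x A)%E) ->
  measurable B ->
  (forall n, ip (iter n.*2 (kop P) (bind R (~` B))) (bind R B) = 0) ->
  pi B = 0%E \/ pi (~` B) = 0%E.
Proof.
move=> psiT irr mB h; have mB' := measurableC mB.
have [p0|p0] := eqVneq (psi B) 0%E; last first.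
  right; apply: (unreached_null irr mB' mB); first by rewrite lt0e p0/=.
  by move=> n; rewrite iter_kop_sym ipC h.
left; apply: (unreached_null irr mB mB') => //.
rewrite lt0e measure_ge0 andbT; apply: contra psiT => /eqP p0'.
by have := measureU psi mB mB' (setICr B); rewrite setUv => ->;
  rewrite [X in (X + _)%E]p0 [X in (_ + X)%E]p0' adde0.
Qed.

End reversible.
End markov_chain.

(** * Countably generated sigma-algebras *)

Section countable_algebra.
Context d (T : measurableType d).

(** The generated Boolean algebra is built in stages so that its countability is an induction. *)
Fixpoint boolean_level (G : set (set T)) (n : nat) : set (set T) :=
  if n is n'.+1 then
    let F := boolean_level G n' in
    F `|` (setC @` F) `|` ((fun p : set T * set T => p.1 `|` p.2) @` (F `*` F))
  else set0 |` G.

Lemma boolean_level_countable G n : countable G -> countable (boolean_level G n).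
Proof.
have countU2 (X Y : set (set T)) : countable X -> countable Y -> countable (X `|` Y).
  by move=> cX cY; rewrite -bigcup2E; apply: bigcup_countable => // -[|[|i]].
move=> cG; elim: n => [|n IH] /=; first exact: (countU2 _ _).
apply: (countU2 _ _ _ _); first apply: (countU2 _ _ _ _) => //.
  exact: sub_countable (card_image_le _ _) IH.
by apply: sub_countable (card_image_le _ _) _; exact: countableX.
Qed.

Lemma boolean_level_mono G n m : (n <= m)%N ->
  boolean_level G n `<=` boolean_level G m.
Proof.
move=> /subnK <-; elim: (m - n)%N => // k IH A /IH h.
by rewrite addSn /=; left; left.
Qed.

Definition boolean_closure G := \bigcup_n boolean_level G n.

Lemma boolean_closureC G A : boolean_closure G A -> boolean_closure G (~` A).
Proof. by move=> [n _ An]; exists n.+1 => //=; left; right; exists A. Qed.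

Lemma boolean_closureU G A B :
  boolean_closure G A -> boolean_closure G B -> boolean_closure G (A `|` B).
Proof.
move=> [n _ An] [m _ Bm]; exists (maxn n m).+1 => //=; right; exists (A, B) => //.
by split => /=; [apply: boolean_level_mono An; exact: leq_maxl |
                 apply: boolean_level_mono Bm; exact: leq_maxr].
Qed.

Lemma boolean_closure_measurable G : G `<=` measurable ->
  boolean_closure G `<=` measurable.
Proof.
move=> mG A [n _]; elim: n A => [|n IH] A /=.
  by case=> [->|/mG//]; exact: measurable0.
case=> [[/IH//|[B /IH mB <-]]|[[B C] /= [/IH mB /IH mC] <-]].
  exact: measurableC.
exact: measurableU.
Qed.

End countable_algebra.

Section finite_measure_real.
Context d (T : measurableType d) (R : realType) (m : {measure set T -> \bar R}).
Hypothesis mT : (m [set: T] < +oo)%E.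

Lemma finite_measure_fin A : measurable A -> m A \is a fin_num.
Proof.
move=> mA; rewrite ge0_fin_numE// (le_lt_trans _ mT)//.
by apply: le_measure; rewrite ?inE.
Qed.

Lemma fine_measure_le A B : measurable A -> measurable B -> A `<=` B ->
  fine (m A) <= fine (m B).
Proof.
move=> mA mB AB; apply: fine_le; rewrite ?finite_measure_fin//.
by apply: le_measure; rewrite ?inE.
Qed.

Lemma fine_measureU A B : measurable A -> measurable B ->
  fine (m (A `|` B)) <= fine (m A) + fine (m B).
Proof.
move=> mA mB; rewrite -fineD ?finite_measure_fin//.
apply: fine_le; rewrite ?fin_numD ?finite_measure_fin//; first exact: measurableU.
exact: measureU2.
Qed.

Lemma fine_measureD A B : measurable A -> measurable B -> B `<=` A ->
  fine (m (A `\` B)) = fine (m A) - fine (m B).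
Proof.
move=> mA mB BA; rewrite measureD//; last by rewrite ltey_eq finite_measure_fin.
by rewrite setIidr// fineB ?finite_measure_fin.
Qed.

(** The sets that can be approximated in measure by members of [S] form a sigma-algebra containing
    [S]. *)
Lemma algebra_dense (S : set (set T)) : S `<=` measurable ->
  @measurable d T = <<s S >> -> S set0 ->
  (forall A, S A -> S (~` A)) -> (forall A B, S A -> S B -> S (A `|` B)) ->
  forall A, measurable A -> forall e, 0 < e ->
  exists2 B, S B & fine (m ((A `\` B) `|` (B `\` A))) < e.
Proof.
move=> mS gS S0 SC SU.
pose dist (A B : set T) := (A `\` B) `|` (B `\` A).
have mdist A B : measurable A -> measurable B -> measurable (dist A B).
  by move=> mA mB; apply: measurableU; exact: measurableD.
pose H := [set A | measurable A /\
  forall e, 0 < e -> exists2 B, S B & fine (m (dist A B)) < e].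
suff SH : <<s S >> `<=` H by move=> A; rewrite gS => /SH [].
have HU A B : H A -> H B -> H (A `|` B).
  move=> [mA hA] [mB hB]; split; first exact: measurableU.
  move=> e e0; have e2 : 0 < e / 2 by rewrite divr_gt0.
  have [A' SA' hA'] := hA _ e2; have [B' SB' hB'] := hB _ e2.
  exists (A' `|` B'); first exact: SU.
  have mA' := mS _ SA'; have mB' := mS _ SB'.
  apply: (@le_lt_trans _ _ (fine (m (dist A A' `|` dist B B')))).
    apply: fine_measure_le; first by apply: mdist; exact: measurableU.
      by apply: measurableU; exact: mdist.
    move=> x [[[]h /not_orP[h1 h2]]|[[]h /not_orP[h1 h2]]].
    - by left; left.
    - by right; left.
    - by left; right.
    - by right; right.
  rewrite (le_lt_trans (fine_measureU _ _))//; try exact: mdist.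
  by lra.
apply: smallest_sub; last first.
  move=> A SA; split; first exact: mS.
  by move=> e e0; exists A; rewrite /dist ?setDv ?setU0 ?measure0.
split.
- by split => // e e0; exists set0; rewrite /dist ?setDv ?setU0 ?measure0.
- move=> A [mA hA]; rewrite setTD; split; first exact: measurableC.
  move=> e e0; have [B SB hB] := hA e e0; exists (~` B); first exact: SC.
  suff -> : dist (~` A) (~` B) = dist A B by [].
  rewrite /dist setUC; congr (_ `|` _); rewrite !setDE setCK setIC//.
- move=> A hA; pose U n := \big[setU/set0]_(i < n.+1) A i.
  have HUn n : H (U n).
    rewrite /U; elim: n => [|n IH]; first by rewrite big_ord_recr/= big_ord0 set0U; exact: hA.
    by rewrite big_ord_recr/=; exact: HU (hA _).
  have mU n : measurable (U n) by have [] := HUn n.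
  have mA : measurable (\bigcup_k A k).
    by apply: bigcupT_measurable => k; have [] := hA k.
  have UA : \bigcup_k U k = \bigcup_k A k by exact: bigcup_bigsetU_bigcup.
  split => // e e0; have e2 : 0 < e / 2 by rewrite divr_gt0.
  (* Continuity from below leaves a tail of measure less than e/2, so approximating a finite union
     suffices. *)
  have [n hn] : exists n, fine (m (\bigcup_k A k)) - fine (m (U n)) < e / 2.
    have : m \o U @ \oo --> m (\bigcup_k U k).
      apply: nondecreasing_cvg_mu => //; first by rewrite UA.
      by move=> i j ij; apply/subsetPset/subset_bigsetU.
    rewrite UA -[X in _ --> X]fineK ?finite_measure_fin// => /fine_cvgP[_].
    move=> /cvgrPdist_lt /(_ _ e2)[n _ /(_ n (leqnn n))] /= h; exists n.
    exact: le_lt_trans (ler_norm _) h.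
  have [_ /(_ _ e2)[B SB hB]] := HUn n; exists B => //.
  have mB := mS _ SB.
  have UnA : U n `<=` \bigcup_k A k by rewrite -UA => x Ux; exists n.
  apply: (@le_lt_trans _ _ (fine (m (dist (U n) B `|` (\bigcup_k A k `\` U n))))).
    apply: fine_measure_le; first exact: mdist.
      by apply: measurableU; [exact: mdist | exact: measurableD].
    move=> x [[Ax Bx]|[Bx Ax]].
      by have [Ux|Ux] := pselect (U n x); [left; left | right].
    by left; right; split => // /UnA.
  have mD := measurableD mA (mU n).
  rewrite (le_lt_trans (fine_measureU _ _))//; first exact: mdist.
  rewrite fine_measureD//; lra.
Qed.

End finite_measure_real.

(** This is how countable generation enters: an inequality between finite measures need only be
    tested on one fixed countable algebra. A set [A] is approximated in [m1 + m2], that is for both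
    measures at once. *)
Lemma countable_determining d (T : measurableType d) (R : realType) :
  countably_generated T -> exists B : nat -> set T,
    (forall i, measurable (B i)) /\
    forall (m1 m2 : {measure set T -> \bar R}) (c : R),
      (m1 [set: T] < +oo)%E -> (m2 [set: T] < +oo)%E ->
      (forall i, fine (m1 (B i)) <= fine (m2 (B i)) + c) ->
      forall A, measurable A -> fine (m1 A) <= fine (m2 A) + c.
Proof.
move=> [G [cG gG]]; pose S := boolean_closure G.
have mG : G `<=` measurable by rewrite gG; exact: sub_sigma_algebra.
have mS : S `<=` measurable by exact: boolean_closure_measurable.
have S0 : S set0 by exists 0%N => //; left.
have gS : @measurable d T = <<s S >>.
  apply/seteqP; split; last first.
    by apply: smallest_sub => //; exact: sigma_algebra_measurable.
  rewrite gG; apply: smallest_sub; first exact: smallest_sigma_algebra.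
  by move=> A GA; apply: sub_sigma_algebra; exists 0%N => //; right.
have cS : countable S.
  by apply: bigcup_countable => // n _; exact: boolean_level_countable.
have [B [BS SB]] : exists B : nat -> set T, (forall i, S (B i)) /\
    forall A, S A -> exists i, A = B i.
  have /countable_injP[f finj] := cS.
  (* An enumeration obtained from an injection into the naturals; codes outside its image give
     [set0], which is in [S]. *)
  pose B i := if pselect (exists2 A, S A & f A = i) is left e
              then sval (cid2 e) else set0.
  exists B; split => [i|A SA]; rewrite /B; first by case: pselect => // e; case: cid2.
  exists (f A); case: pselect => [e|[]]; last by exists A.
  by case: cid2 => A' SA' /= h; apply: finj; rewrite ?inE.
exists B; split => [i|m1 m2 c f1 f2 h A mA]; first exact: mS.
rewrite leNgt; apply/negP => hlt.
(* Half of the supposed excess: an error below [e] in [m] already contradicts the inequality at the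
   approximating set. *)
pose e := (fine (m1 A) - (fine (m2 A) + c)) / 2.
have e0 : 0 < e by rewrite divr_gt0// subr_gt0.
pose m := measure_add m1 m2.
have mE X : measurable X -> fine (m X) = fine (m1 X) + fine (m2 X).
  by move=> mX; rewrite /m measure_addE fineD// finite_measure_fin.
have mfin : (m [set: T] < +oo)%E by rewrite /m measure_addE lte_add_pinfty.
have [_ /SB[i ->]] := algebra_dense mfin mS gS S0 (@boolean_closureC _ _ G)
  (@boolean_closureU _ _ G) mA e0.
have mB : measurable (B i) by exact: mS.
set D := (A `\` B i) `|` (B i `\` A).
have mD : measurable D by apply: measurableU; exact: measurableD.
have h1 : fine (m1 A) <= fine (m1 (B i)) + fine (m1 D).
  apply: le_trans (fine_measureU f1 mB mD).
  apply: fine_measure_le => //; first exact: measurableU.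
  by move=> x Ax; have [Bx|Bx] := pselect (B i x); [left | right; left].
have h2 : fine (m2 (B i)) <= fine (m2 A) + fine (m2 D).
  apply: le_trans (fine_measureU f2 mA mD).
  apply: fine_measure_le => //; first exact: measurableU.
  by move=> x Bx; have [Ax|Ax] := pselect (A x); [left | right; right].
rewrite mE// => hD; have := h i; rewrite /e in hD e0 *.
have := fine_ge0 (measure_ge0 m1 D); have := fine_ge0 (measure_ge0 m2 D).
by lra.
Qed.

(** * Bounded convergence and a choice of rate *)

Section bounded_convergence.
Context d (T : measurableType d) (R : realType) (mu : {measure set T -> \bar R}).
Hypothesis muT : (mu [set: T] < +oo)%E.
Implicit Types f g h : bfun T R.

Lemma bint_cvg (F : nat -> bfun T R) f M : (forall n x, `|F n x| <= M) ->
  {ae mu, forall x, (fun n => F n x) @ \oo --> f x} ->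
  (fun n => bint mu (F n)) @ \oo --> bint mu f.
Proof.
move=> FM Ff.
have [] := @dominated_convergence _ _ _ mu _ measurableT
  (fun n => EFin \o F n) (EFin \o f) (cst M%:E).
- by move=> n; apply/measurable_EFinP; exact: bfun_measurable.
- by apply/measurable_EFinP; exact: bfun_measurable.
- by apply: filterS Ff => x h _; apply: cvg_EFin => //; exact: nearW.
- apply/integrableP; split; first exact: measurable_cst.
  by rewrite integral_cst//= lte_mul_pinfty// ?lee_fin.
- by apply: aeW => x n _ /=; rewrite lee_fin.
move=> _ _ h; rewrite /bint.
rewrite [X in X @ _ --> _](_ : _ = fine \o (fun n => \int[mu]_x (F n x)%:E)%E)//.
apply: fine_cvg; rewrite fineK//.
exact: integrable_fin_num (bfun_integrable muT f).
Qed.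

Lemma nrm_mono f g : (forall x, `|f x| <= g x) -> nrm (bip mu) f <= nrm (bip mu) g.
Proof.
move=> fg; apply: ler_wsqrtr; apply: bint_mono => // x; rewrite !bmulE -!expr2.
rewrite -[X in X <= _]real_normK ?num_real// ler_pXn2r ?nnegrE//.
exact: le_trans (fg x).
Qed.

Lemma nrm_cvg0 (F : nat -> bfun T R) M : (forall n x, `|F n x| <= M) ->
  {ae mu, forall x, (fun n => F n x) @ \oo --> 0} ->
  (fun n => nrm (bip mu) (F n)) @ \oo --> 0.
Proof.
move=> FM F0.
have : (fun n => bint mu (bmul (F n) (F n))) @ \oo --> bint mu 0.
  apply: (@bint_cvg _ _ (M * M)) => [n x|].
    by rewrite bmulE normrM ler_pM.
  apply: filterS F0 => x h.
  rewrite [X in X @ _ --> _](_ : _ = (fun n => F n x * F n x)); last first.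
    by apply/funext => n; rewrite bmulE.
  by rewrite bfun0 -[X in _ --> X](mulr0 0); exact: cvgM.
rewrite (blin0 (bint_lin muT)) => /(continuous_cvg _ (@sqrt_continuous R 0)).
by rewrite sqrtr0.
Qed.

End bounded_convergence.

(** Bernoulli's inequality instead of an m-th root: x = (1 - s)/(m + 1) gives (1 - x)^m >= 1 - m x =
    s + x. *)
Lemma exists_root (R : realType) (s : R) m : 0 <= s < 1 -> (0 < m)%N ->
  exists2 r, 0 < r < 1 & s <= r ^+ m.
Proof.
move=> /andP[s0 s1] m0.
have m0' : 0 < m%:R :> R by rewrite ltr0n.
have bernoulli (x : R) n : 0 <= x <= 1 -> 1 - n%:R * x <= (1 - x) ^+ n.
  move=> /andP[x0 x1]; elim: n => [|n IH]; first by rewrite mul0r subr0 expr0.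
  rewrite exprS; apply: (@le_trans _ _ ((1 - x) * (1 - n%:R * x))).
    have h : 0 <= n%:R * x * x by rewrite !mulr_ge0.
    by rewrite -natr1; lra.
  by rewrite ler_wpM2l// subr_ge0.
pose x := (1 - s) / (m%:R + 1).
have x0 : 0 < x by rewrite divr_gt0 ?subr_gt0 ?addr_gt0.
have mx : m%:R * x + x = 1 - s by rewrite /x; field; rewrite gt_eqF// addr_gt0.
have mx0 : 0 < m%:R * x by rewrite mulr_gt0.
exists (1 - x); first by apply/andP; split; lra.
by apply: le_trans (bernoulli x m _); [lra | apply/andP; split; lra].
Qed.

(** * Uniqueness of the invariant measure *)

Section uniqueness.
Context d (T : measurableType d) (R : realType) (P : R.-pker T ~> T).
Variables (pi : probability T R) (hrev : reversible P pi).
Variable psi : {measure set T -> \bar R}.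
Hypothesis psiT : (psi [set: T] != 0)%E.
Hypothesis irr : forall A, measurable A -> (0 < psi A)%E ->
    forall x, \forall n \near \oo, (0 < kernel_iter P n x A)%E.
Local Notation pr A := (fine (pi A)).

(** The set [Nb] of points from which [N0] can be reached is mu-null by invariance, and its
    complement is never left. As mu is nonzero, some point starts outside [Nb], so psi cannot charge
    [Nb]. Thus psi charges the complement, which by symmetry of P almost no point of [Nb] can reach;
    so pi(Nb) = 0. *)
Lemma invariant_null (mu : {measure set T -> \bar R}) N0 :
  (mu [set: T] < +oo)%E -> (mu [set: T] != 0)%E -> invariant_measure P mu ->
  measurable N0 -> mu N0 = 0%E -> pi N0 = 0%E.
Proof.
move=> muT mu0 inv mN0 muN0.
pose W n := iter n (kop P) (bind R N0).
have W0 n x : 0 <= W n x by apply: iter_kop_ge0 => y; exact: bind_ge0.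
have invf f : bint mu (kop P f) = bint mu f.
  move: f; apply: blin_eq.
  - by move=> a f g; rewrite linearP bint_lin.
  - exact: (bint_lin muT).
  - have [C hC] := bint_cont muT; exists C => f M fM; apply: hC; exact: kop_bound.
  - exact: (bint_cont muT).
  - move=> A mA; rewrite bint_ind// -(inv A mA) -[RHS]/(fine _).
    congr fine; apply: eq_integral => x _; rewrite kop_ind// fineK//.
    exact: (finite_kernel_measure P x).
have intW n : bint mu (W n) = 0.
  by elim: n => [|n IH]; rewrite /W/= ?invf// bint_ind// muN0.
pose A n := [set x | 0 < W n x].
have mA n : measurable (A n).
  rewrite -[A n]setTI; have := bfun_measurable (W n) measurableT (measurable_itv `]0, +oo[).
  by rewrite set_itvE.
have posnull (nu : {measure set T -> \bar R}) n : (nu [set: T] < +oo)%E ->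
    bint nu (W n) = 0 -> nu (A n) = 0%E.
  move=> nuT /(bint_eq0 nuT (W0 n)) h; apply/(negligibleP nu (mA n)).
  by apply: negligibleS h => x /= Wx; apply/eqP; rewrite gt_eqF.
pose Nb := \bigcup_n A n.
have mNb : measurable Nb by exact: bigcupT_measurable.
have bigcup0 (nu : {measure set T -> \bar R}) :
    (forall n, nu (A n) = 0%E) -> nu Nb = 0%E.
  move=> h; apply/(negligibleP nu mNb); apply: negligible_bigcup => n.
  by apply/(negligibleP nu (mA n)); exact: h.
have muNb : mu Nb = 0%E by apply: bigcup0 => n; exact: posnull.
(* Outside [Nb] all iterates of the indicator of [N0] vanish, so P^n(x, .) gives no mass to any
   [A k]. *)
have absorb x n : ~ Nb x -> iter n (kop P) (bind R Nb) x = 0.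
  move=> Nx; apply: EFin_inj; rewrite -kernel_iterE//; apply: bigcup0 => k.
  apply: posnull; first by rewrite kernel_iterT ltry.
  rewrite bint_kernel_iter /W -iterD; apply/eqP; rewrite eq_le W0 andbT leNgt.
  by apply/negP => h; apply: Nx; exists (n + k)%N.
have [y Ny] : exists y, ~ Nb y.
  apply: contrapT => h; move/eqP: mu0; apply; rewrite -muNb; congr (mu _).
  by apply/seteqP; split => // x _; apply: contrapT => Nx; apply: h; exists x.
have psiNb : psi Nb = 0%E.
  apply/eqP; apply: contrapT => /negP h.
  have psip : (0 < psi Nb)%E by rewrite lt0e h measure_ge0.
  have [n _ /(_ n (leqnn n))] /= := irr mNb psip y.
  by rewrite kernel_iterE// absorb// ltxx.
have mB := measurableC mNb.
have psiB : (0 < psi (~` Nb))%E.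
  rewrite lt0e measure_ge0 andbT; apply: contra psiT => /eqP p0'.
  have := measureU psi mNb mB (setICr Nb); rewrite setUv => ->.
  by rewrite [X in (X + _)%E]psiNb [X in (_ + X)%E]p0' adde0.
have piNb : pi Nb = 0%E.
  apply: (unreached_null irr mNb mB psiB) => n.
  rewrite iter_kop_sym// bipC /bip.
  have -> : bmul (iter n.*2 (kop P) (bind R Nb)) (bind R (~` Nb)) = 0.
    apply/bfunP => x; rewrite bmulE bfun0.
    have [Nx|Nx] := pselect (Nb x); last by rewrite absorb// mul0r.
    by rewrite [X in _ * X]bind_out ?mulr0//= => /(_ Nx).
  exact: (blin0 (bint_lin (prob_lty pi))).
apply/eqP; rewrite eq_le measure_ge0 andbT -piNb le_measure ?inE//.
move=> x Nx; exists 0%N => //; rewrite /A /W /=.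
by rewrite bind_in.
Qed.

(** The exceptional set of the ergodic bound is mu-null, hence pi-null by [invariant_null].
    Integrating P^n 1_A -> mu(A) against pi, which P preserves, yields mu(A) = pi(A). *)
Lemma geometric_pi : geometrically_ergodic P ->
  exists rho C : T -> R, [/\ forall x, 0 < rho x < 1, forall x, 1 <= C x &
    {ae pi, forall x, forall n A, measurable A ->
      `|iter n (kop P) (bind R A) x - pr A| <= C x * rho x ^+ n}].
Proof.
move=> [mu [muT inv [rho [C [rho01 C1 [N0 [mN0 muN0 hN0]]]]]]].
exists rho, C; split => //.
have tv x n A : ~ N0 x -> measurable A ->
    (`|kernel_iter P n x A - mu A| <= (C x * rho x ^+ n)%:E)%E.
  move=> Nx mA; have : ~ ~ (forall n, tv_dist (kernel_iter P n x) mu <=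
      (C x * rho x ^+ n)%:E)%E by move=> h; apply: Nx; exact: hN0.
  move=> /contrapT /(_ n); apply: le_trans; apply: ereal_sup_ubound.
  by exists A.
have cvg0 x : (fun n => C x * rho x ^+ n) @ \oo --> 0.
  rewrite -[X in _ --> X](mulr0 (C x)); apply: cvgMr; apply: cvg_expr.
  by have /andP[r0 r1] := rho01 x; rewrite ger0_norm// ltW.
have [x Nx] : exists x, ~ N0 x.
  apply: contrapT => h; move/eqP: muT; apply; rewrite -muN0; congr (mu _).
  by apply/seteqP; split => // x _; apply: contrapT => Nx; apply: h; exists x.
(* The bound at time 0 is finite, so mu(A) cannot be infinite. *)
have mufin A : measurable A -> mu A \is a fin_num.
  move=> mA; have := tv x 0%N A Nx mA; rewrite kernel_iterE//.
  by case: (mu A) (measure_ge0 mu A).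
have tvr y n A : ~ N0 y -> measurable A ->
    `|iter n (kop P) (bind R A) y - fine (mu A)| <= C y * rho y ^+ n.
  move=> Ny mA; have := tv y n A Ny mA; rewrite kernel_iterE//.
  by rewrite -(fineK (mufin A mA)).
have muTy : (mu [set: T] < +oo)%E by rewrite ltey_eq mufin.
have piN0 : pi N0 = 0%E by exact: (invariant_null muTy muT inv mN0 muN0).
have aeN0 : {ae pi, forall y, ~ N0 y}.
  by exists N0; split => // y /= /contrapT.
suff muE A : measurable A -> fine (mu A) = pr A.
  by apply: filterS aeN0 => y Ny n A mA; rewrite -muE//; exact: tvr.
move=> mA.
have : (fun n => bint pi (iter n (kop P) (bind R A))) @ \oo -->
    bint pi (bcst T (fine (mu A))).
  apply: (@bint_cvg _ _ _ _ (prob_lty pi) _ _ 1).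
    move=> n y; apply: iter_kop_bound => z.
    by rewrite ger0_norm ?bind_ge0// bind_le1.
  apply: filterS aeN0 => y Ny; rewrite bcstE.
  apply/cvgrPdist_le => e e0.
  have /cvgrPdist_le/(_ e e0) := cvg0 y; apply: filterS => n.
  rewrite sub0r normrN distrC => /(le_trans (ler_norm _)).
  exact: le_trans (tvr _ _ _ Ny mA).
rewrite [X in X @ _ --> _](_ : _ = cst (pr A)); last first.
  by apply/funext => n; rewrite iter_kop_inv// bint_ind.
rewrite pint_cst => /cvg_lim h; rewrite -h//; exact: lim_cst.
Qed.

End uniqueness.

(** * Uniform rates and minorization on a set of positive measure *)

Section gap.
Context d (T : measurableType d) (R : realType) (P : R.-pker T ~> T).
Variables (pi : probability T R) (hrev : reversible P pi).
Local Notation pr A := (fine (pi A)).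
Local Notation I := (bint pi).
Local Notation ip := (bip pi).
Local Notation N := (nrm (bip pi)).
Local Notation V := (bfun T R).

Implicit Types f g h : V.
Let ipDl := bipDl (prob_lty pi).
Let ipZl := bipZl (prob_lty pi).
Let ipC := bipC pi.
Let ip0 := bip_diag_ge0 pi.

Lemma pr_ge0 A : 0 <= pr A. Proof. exact: fine_ge0. Qed.

Lemma pr_le1 A : measurable A -> pr A <= 1.
Proof.
by move=> mA; rewrite -[leRHS]/(fine 1%E) fine_le// ?fin_num_measure// probability_le1.
Qed.

(* C is uniformly recurrent: P^n(x, A) -> pi(A) geometrically fast, uniformly
   in x in C and in A. *)
Definition uniform_on (C : set T) (K r : R) : Prop :=
  forall x, C x -> forall n A, measurable A ->
    `|iter n (kop P) (bind R A) x - pr A| <= K * r ^+ n.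

(** [E k] asks for the constant k + 1 and the rate 1 - 1/(k + 2), only on the countable determining
    family; this makes it measurable without weakening the bound. The [E k] cover the space up to a
    null set, so one of them is charged. *)
Lemma exists_uniform_set (rho C : T -> R) : countably_generated T ->
  (forall x, 0 < rho x < 1) -> (forall x, 1 <= C x) ->
  {ae pi, forall x, forall n A, measurable A ->
      `|iter n (kop P) (bind R A) x - pr A| <= C x * rho x ^+ n} ->
  exists E K r, [/\ measurable E, 0 < pr E, 0 < r < 1, 0 <= K & uniform_on E K r].
Proof.
move=> /(countable_determining R)[B [mB hB]] rho01 C1 [N0 [mN0 piN0 hN0]].
pose K (k : nat) : R := k.+1%:R.
pose r (k : nat) : R := 1 - k.+2%:R^-1.
pose E k := [set x | forall n i,
  `|iter n (kop P) (bind R (B i)) x - pr (B i)| <= K k * r k ^+ n].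
have EE k : E k = \bigcap_n \bigcap_i
    [set x | `|iter n (kop P) (bind R (B i)) x - pr (B i)| <= K k * r k ^+ n].
  by apply/seteqP; split => x /= h n //= => [_ i _|i]; [exact: h|exact: (h n Logic.I i Logic.I)].
have mE k : measurable (E k).
  rewrite EE; apply: bigcapT_measurable => n; apply: bigcapT_measurable => i.
  set f := iter n _ _.
  have mg : measurable_fun [set: T] (fun x => `|f x - pr (B i)|).
    apply: measurableT_comp => //; apply: measurable_funB => //.
    exact: bfun_measurable.
  rewrite -[X in measurable X]setTI.
  by have := mg measurableT _ (measurable_itv `]-oo, K k * r k ^+ n]); rewrite set_itvE.
have Euni k : uniform_on (E k) (K k) (r k).
  move=> x Ex n A mA.
  have kfin : (kernel_iter P n x [set: T] < +oo)%E by rewrite kernel_iterT ltry.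
  have kE i : fine (kernel_iter P n x (B i)) = iter n (kop P) (bind R (B i)) x.
    by rewrite kernel_iterE.
  have -> : iter n (kop P) (bind R A) x = fine (kernel_iter P n x A).
    by rewrite kernel_iterE.
  rewrite ler_distl; apply/andP; split.
    rewrite lerBlDr; apply: (hB pi (kernel_iter P n x)) => // [|i]; first exact: prob_lty.
    by rewrite kE; have := Ex n i; rewrite ler_distl => /andP[]; rewrite lerBlDr.
  apply: (hB (kernel_iter P n x) pi) => // [|i]; first exact: prob_lty.
  by rewrite kE; have := Ex n i; rewrite ler_distl => /andP[].
have r01 k : 0 < r k < 1.
  rewrite /r subr_gt0 invf_lt1// ltr1n/= gtrBl invr_gt0 ltr0n//.
have Ecov x : ~ N0 x -> exists k, E k x.
  move=> Nx; have {}hx := contrapT (fun nx => Nx (hN0 x nx)).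
  have /andP[r0 r1] := rho01 x.
  (* An index k with k + 1 > M dominates both C(x) and 1/(1 - rho(x)), hence also the rate. *)
  pose M := Num.max (C x) (1 - rho x)^-1.
  exists (Num.truncn M).
  have hM : M < (Num.truncn M).+1%:R by exact: truncnS_gt.
  move=> n i; apply: le_trans (hx n (B i) (mB i)) _.
  apply: ler_pM; [by rewrite (le_trans ler01)| by rewrite exprn_ge0// ltW| |].
    by rewrite (le_trans _ (ltW hM))// le_max lexx.
  apply: lerXn2r; rewrite ?nnegrE; [exact: ltW| by have /andP[/ltW] := r01 (Num.truncn M)|].
  rewrite /r lerBrDr -lerBrDl -[leRHS]invrK lef_pV2 ?posrE ?invr_gt0 ?subr_gt0//.
  rewrite (@le_trans _ _ M)// ?le_max ?lexx ?orbT//.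
  by rewrite (le_trans (ltW hM))// ler_nat.
have [k hk] : exists k, pi (E k) != 0%E.
  apply: contrapT => h.
  have h0 k : pi (E k) = 0%E.
    by apply/eqP; apply: contrapT => /negP hk; apply: h; exists k.
  have : pi [set: T] = 0%E.
    apply/(negligibleP pi measurableT).
    have : pi.-negligible (N0 `|` \bigcup_k E k).
      apply: negligibleU; first exact/(negligibleP pi mN0).
      by apply: negligible_bigcup => k; apply/(negligibleP pi (mE k)); exact: h0.
    apply: negligibleS => x _; have [Nx|Nx] := pselect (N0 x); [by left|right].
    by have [k Ek] := Ecov x Nx; exists k.
  by rewrite probability_setT => /eqP; rewrite onee_eq0.
exists (E k), (K k), (r k); split => //.
rewrite fine_gt0// lt0e hk measure_ge0/=.
by rewrite (le_lt_trans (probability_le1 pi (mE k))) ?ltry.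
Qed.

(* The doubling trick: let phi = P^m 1_A for A in C. By reversibility the mass
   of phi is spread like pi up to 1/6, so that phi >= pi(A)/2 off a set of
   measure at most 1/3, which P^m(x, .) charges by at most 1/2 for x in C. *)
Lemma uniform_minorization C K r m : measurable C -> uniform_on C K r ->
  K * r ^+ m <= 6^-1 ->
  forall x A, C x -> measurable A -> A `<=` C ->
    pr A / 4 <= iter (m + m) (kop P) (bind R A) x.
Proof.
move=> mC uC Km x A Cx mA AC.
have it0 n y B : measurable B -> 0 <= iter n (kop P) (bind R B) y.
  by move=> mB; apply: iter_kop_ge0 => z; exact: bind_ge0.
have [A0|A0] := leP (pr A) 0.
  by rewrite (le_trans _ (it0 _ _ _ mA))// pmulr_lle0.
have um y B : C y -> measurable B -> `|iter m (kop P) (bind R B) y - pr B| <= 6^-1.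
  by move=> Cy mB; exact: le_trans (uC y Cy m B mB) Km.
pose phi := iter m (kop P) (bind R A).
pose B := [set y | phi y < pr A / 2].
have mB : measurable B.
  rewrite -[B]setTI; have := bfun_measurable phi measurableT (measurable_itv `]-oo, pr A / 2[).
  by rewrite set_itvE.
have mB' := measurableC mB.
have prC : pr (~` B) = 1 - pr B.
  by rewrite probability_setC// fineB// fin_num_measure.
have bindC y : bind R (~` B) y = 1 - bind R B y.
  have [By|By] := pselect (B y).
    by rewrite (bind_in R mB By) bind_out ?subrr//= => /(_ By).
  by rewrite (bind_out R mB By) subr0 bind_in.
(* pi(A) = <phi, 1> = <phi, 1_B> + <1_A, P^m 1_(~B)> *)
have phiC : ip phi (bind R (~` B)) <= pr A * (pr (~` B) + 6^-1).
  rewrite iter_kop_sym// -(bint_ind pi mA) mulrC -(blinZ _ _ (bint_lin (prob_lty pi))).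
  apply: bint_mono => [|y]; first exact: prob_lty.
  rewrite bmulE bfunE mulrC; have [Ay|Ay] := pselect (A y).
    rewrite bind_in// !mulr1; have := um y _ (AC _ Ay) mB'.
    by rewrite ler_distl => /andP[].
  by rewrite bind_out// !mulr0.
have phiB : ip phi (bind R B) <= pr A / 2 * pr B.
  rewrite -[X in _ * X](bint_ind pi mB) -(blinZ _ _ (bint_lin (prob_lty pi))).
  apply: bint_mono => [|y]; first exact: prob_lty.
  rewrite bmulE bfunE; have [By|By] := pselect (B y).
    by rewrite bind_in// !mulr1 ltW.
  by rewrite bind_out// !mulr0.
have phi1 : ip phi (bind R B) + ip phi (bind R (~` B)) = pr A.
  rewrite !(ipC phi) -ipDl.
  have -> : bind R B + bind R (~` B) = bcst T 1.
    by apply/bfunP => y; rewrite bfunE bindC bcstE addrC subrK.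
  by rewrite ipC bip1 iter_kop_inv// bint_ind.
(* With b = pi(B), dividing by pi(A) gives 1 <= b/2 + (1 - b) + 1/6. *)
have pB : pr B <= 3^-1.
  rewrite -(ler_pM2l A0); rewrite prC in phiC; lra.
have hx : pr (~` B) - 6^-1 <= iter m (kop P) (bind R (~` B)) x.
  by have := um x _ Cx mB'; rewrite ler_distl => /andP[].
(* phi is at least pi(A)/2 off [B], and 1 - 1/3 - 1/6 = 1/2, whence the factor 1/4. *)
rewrite iterD -/phi; apply: le_trans (_ : pr A / 2 * iter m (kop P) (bind R (~` B)) x <= _).
  rewrite prC in hx; nra.
rewrite -bfunZ -iter_kopZ; apply: iter_kop_mono => y; rewrite bfunE.
have [By|By] := pselect (B y).
  by rewrite bind_out ?mulr0 ?it0//= => /(_ By).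
by rewrite bind_in// mulr1 leNgt; apply/negP.
Qed.

Lemma minorization_op C K r m : measurable C -> uniform_on C K r ->
  K * r ^+ m <= 6^-1 -> forall f, (forall x, 0 <= f x) ->
  forall x, C x -> ip f (bind R C) / 4 <= iter (m + m) (kop P) f x.
Proof.
move=> mC uC Km f f0 x Cx; move: f f0; apply: blin_le.
- by move=> a f g; rewrite ipDl ipZl mulrDl mulrA.
- by move=> a f g; rewrite iter_kop_linear !bfunE.
- have [c hc] := bip_cont (prob_lty pi) (bind R C); exists (c / 4) => f M fM.
  by rewrite normrM (@ger0_norm _ 4^-1)// mulrAC ler_pM2r// hc.
- by exists 1 => f M fM; rewrite mul1r; exact: iter_kop_bound.
move=> A mA; have mAC := measurableI _ _ mA mC.
have -> : ip (bind R A) (bind R C) = pr (A `&` C).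
  rewrite -(bint_ind pi mAC); congr bint; apply/bfunP => y.
  by rewrite bmulE !bindE// indicI.
apply: le_trans (uniform_minorization mC uC Km Cx mAC _) _.
  by move=> y [].
apply: iter_kop_mono => y; rewrite !bindE// !indicE ler_nat.
by case: (boolP (y \in A `&` C)) => //; rewrite in_setI => /andP[->].
Qed.

End gap.

(** * Renewal decomposition and contraction of mean zero functions *)

Section gap_from_minorization.
Context d (T : measurableType d) (R : realType) (P : R.-pker T ~> T).
Variables (pi : probability T R) (hrev : reversible P pi).
Local Notation pr A := (fine (pi A)).
Local Notation I := (bint pi).
Local Notation ip := (bip pi).
Local Notation N := (nrm (bip pi)).
Local Notation V := (bfun T R).
Implicit Types f g h : V.

Let ipDl := bipDl (prob_lty pi).
Let ipZl := bipZl (prob_lty pi).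
Let ipC := bipC pi.
Let ip0 := bip_diag_ge0 pi.

(** A named iterate, so that it can carry a linear structure. *)
Definition kop_iter n f : V := iter n (kop P) f.
HB.instance Definition _ n :=
  GRing.isLinear.Build R V V _ (kop_iter n) (iter_kop_linear P n).

Lemma iter_kop_iter n k f : iter k (kop_iter n) f = iter (k * n) (kop P) f.
Proof. by elim: k => // k IH; rewrite iterS IH /kop_iter -iterD mulSn. Qed.

Lemma kop_iter_sym n f g : ip (kop_iter n f) g = ip f (kop_iter n g).
Proof. exact: iter_kop_sym. Qed.

Section minorized.
Variables (C : set T) (K r : R) (m : nat).
Hypothesis mC : measurable C.
Hypothesis C0 : 0 < pr C.
Hypothesis r01 : 0 < r < 1.
Hypothesis m0 : (0 < m)%N.
Hypothesis uC : uniform_on P pi C K r.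
Hypothesis Km : K * r ^+ m <= 6^-1.
Hypothesis reach : {ae pi, forall x, \forall n \near \oo, 0 < iter n (kop P) (bind R C) x}.

Local Notation S := (kop_iter (m + m)).
Variable e : V.
Hypothesis eE : e = 2^-1 *: bind R C.
(** With e = 1_C/2 the subtracted value on C is a quarter of the integral of f over C, exactly what
    [minorization_op] allows; so the residual is positive, and it is symmetric. *)
Definition residual f : V := S f - ip f e *: e.

Lemma residual_linear : linear residual.
Proof.
move=> a f g; rewrite /residual linearP ipDl ipZl scalerDl opprD.
by rewrite scalerBr (scalerA a (ip f e) e) addrACA.
Qed.
HB.instance Definition _ := GRing.isLinear.Build R V V _ residual residual_linear.
Local Notation Q := residual.

Let e_ge0 x : 0 <= e x.
Proof. by rewrite eE bfunE mulr_ge0 ?bind_ge0. Qed.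

Let e_le1 x : e x <= 1.
Proof. by rewrite eE bfunE; have := bind_le1 R x mC; lra. Qed.

Let ex x : e x = 2^-1 * bind R C x.
Proof. by rewrite eE bfunE. Qed.

Let Ie : I e = pr C / 2.
Proof. by rewrite eE (blinZ _ _ (bint_lin (prob_lty pi))) bint_ind// mulrC. Qed.

Let ipe f : ip f e = ip f (bind R C) / 2.
Proof. by rewrite eE ipC ipZl ipC mulrC. Qed.

Lemma residual_ge0 f : (forall x, 0 <= f x) -> forall x, 0 <= Q f x.
Proof.
move=> f0 x; rewrite /residual !bfunE subr_ge0 ipe [e]eE bfunE.
have [Cx|Cx] := pselect (C x).
  rewrite bind_in// mulr1 -mulrA -invfM.
  have := minorization_op hrev mC uC Km f0 Cx.
  by have -> : (2 * 2 = 4 :> R) by ring.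
by rewrite bind_out// !mulr0 iter_kop_ge0.
Qed.

Let Q_mono f g : (forall x, f x <= g x) -> forall x, Q f x <= Q g x.
Proof.
move=> fg x; rewrite -subr_ge0; have := @residual_ge0 (g - f) _ x.
rewrite [residual _]linearB !bfunE; apply=> y.
by rewrite !bfunE subr_ge0.
Qed.

Let iterQ_mono n f g : (forall x, f x <= g x) ->
  forall x, iter n Q f x <= iter n Q g x.
Proof. by move=> fg; elim: n => //= n IH; exact: Q_mono. Qed.

Let iterQ_ge0 n f : (forall x, 0 <= f x) -> forall x, 0 <= iter n Q f x.
Proof. by move=> f0; elim: n => //= n IH; exact: residual_ge0. Qed.

Let iterQN n f : iter n Q (- f) = - iter n Q f.
Proof. by elim: n => //= n ->; rewrite [residual _]linearN. Qed.

Let iterQZ n a f : iter n Q (a *: f) = a *: iter n Q f.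
Proof. by elim: n => //= n ->; rewrite [residual _]linearZ. Qed.

Let iterQ_sum n k (F : 'I_k -> V) : iter n Q (\sum_(i < k) F i) = \sum_(i < k) iter n Q (F i).
Proof. by elim: n => //= n ->; rewrite [residual _]linear_sum. Qed.

Let iterQ_abs n f g : (forall x, `|f x| <= g x) ->
  forall x, `|iter n Q f x| <= iter n Q g x.
Proof.
move=> fg x; rewrite ler_norml lerNl -bfunN -iterQN.
by apply/andP; split; apply: iterQ_mono => y;
  have := fg y; rewrite ler_norml ?bfunE => /andP[]; rewrite 1?lerNl.
Qed.

Lemma residual_sym f g : ip (Q f) g = ip f (Q g).
Proof.
rewrite /residual (ipDr ipC ipDl) ipDl (ipNl ipZl) (ipNr ipC ipZl).
by rewrite (ipZl (ip f e) e g) (ipZr ipC ipZl (ip g e) f e) kop_iter_sym (ipC e g) mulrC.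
Qed.

Let SQ f : S f = Q f + ip f e *: e.
Proof. by rewrite /residual subrK. Qed.

Let u n := ip (iter n S e) e.
Let f_ n := ip (iter n Q e) e.

(** Expansion of (Q + <., e> e)^(n+1) e according to the last application of the rank one term;
    pairing with [e] gives the renewal equation. *)
Let renewal_op n : iter n.+1 S e = iter n.+1 Q e + \sum_(j < n.+1) u j *: iter (n - j) Q e.
Proof.
elim: n => [|n IH]; first by rewrite big_ord1 /= SQ.
rewrite iterS SQ {1}IH linearD /= linear_sum /= -addrA; congr (_ + _).
rewrite [in RHS]big_ord_recr /= subnn; congr (_ + _).
apply: eq_bigr => j _; rewrite [Q _]linearZ /= subSn//.
by rewrite -ltnS.
Qed.

Let renewal n : u n.+1 = f_ n.+1 + \sum_(j < n.+1) f_ (n - j)%N * u j.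
Proof.
rewrite /u renewal_op ipDl; congr (_ + _).
rewrite (blin_sum _ (bip_linl (prob_lty pi) e)); apply: eq_bigr => j _.
by rewrite ipZl mulrC.
Qed.

Let f_ge0 n : 0 <= f_ n.
Proof. by apply: bip_ge0 => // x; exact: iterQ_ge0. Qed.

(** As Q 1 = 1 - I(e) e, the sums telescope: I(e) times the sum of the Q^i e is 1 - Q^(n+1) 1. Pair
    with [e] and use positivity. *)
Let f_sum n : \sum_(i < n.+1) f_ i <= 1.
Proof.
have Q1 : Q (bcst T 1) = bcst T 1 - I e *: e.
  by rewrite /residual /kop_iter iter_kop_cst ipC bip1.
have : \sum_(i < n.+1) I e *: iter i Q e = bcst T 1 - iter n.+1 Q (bcst T 1).
  elim: n => [|n IH]; first by rewrite big_ord1 /= Q1 opprB addrC subrK.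
  rewrite big_ord_recr /= IH.
  have -> : Q (iter n Q e) = iter n.+1 Q e by [].
  have -> : Q (Q (iter n Q (bcst T 1))) = iter n.+1 Q (bcst T 1) - I e *: iter n.+1 Q e.
    have -> : Q (Q (iter n Q (bcst T 1))) = iter n.+1 Q (Q (bcst T 1)).
      by rewrite -iterSr.
    rewrite Q1; elim: n.+1 => //= k ->.
    by rewrite linearB /= linearZ.
  move: (iter n.+1 Q (bcst T 1)) (I e *: iter n.+1 Q e) => a b.
  by rewrite opprB addrA addrAC.
move=> /(congr1 (fun h => ip h e)); rewrite (blin_sum _ (bip_linl (prob_lty pi) e)).
under eq_bigr => i _ do rewrite ipZl.
rewrite -big_distrr /= (blinB _ _ (bip_linl (prob_lty pi) e)) ipC bip1 => h.
have Ie0 : 0 < I e by rewrite Ie divr_gt0.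
rewrite -(ler_pM2l Ie0) mulr1 h gerBl; apply: bip_ge0 => //.
by apply: residual_ge0; apply: iterQ_ge0 => x; rewrite bcstE.
Qed.

(** [e] lives on [C], where P^n 1_C tends to pi(C) uniformly and geometrically. *)
Let u_cvg n : `|u n - I e ^+ 2| <= K * r ^+ n.
Proof.
have /andP[r0 r1] := r01.
have r_mono j k : (j <= k)%N -> r ^+ k <= r ^+ j.
  by move=> jk; rewrite ler_wiXn2l// ltW.
have bnd x : C x -> `|iter n S e x - I e| <= 2^-1 * (K * r ^+ n).
  move=> Cx; rewrite iter_kop_iter eE iter_kopZ bfunE -eE Ie mulrC -mulrBl normrM.
  rewrite (@ger0_norm _ 2^-1)// mulrC ler_pM2l//.
  apply: le_trans (uC Cx _ mC) _.
  have K0 : 0 <= K by have := uC Cx 0%N mC; rewrite expr0 mulr1; exact: le_trans.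
  by rewrite ler_wpM2l// r_mono// leq_pmulr// addn_gt0 m0.
have -> : u n - I e ^+ 2 = ip (iter n S e - bcst T (I e)) e.
  by rewrite (blinB _ _ (bip_linl (prob_lty pi) e)) (ipC (bcst _ _)) pip_cst expr2.
apply: le_trans (bint_abs (prob_lty pi) _) _.
have -> : K * r ^+ n = I (bcst T (K * r ^+ n)) by rewrite pint_cst.
apply: bint_mono; first exact: prob_lty.
move=> x; rewrite babsE bmulE bcstE bfunD bfunN bcstE normrM.
have K0 : 0 <= K.
  have [y Cy] : exists y, C y.
    apply: contrapT => hn; move: C0; rewrite (_ : C = set0) ?measure0 ?ltxx//.
    by apply/seteqP; split => // y Cy; apply: hn; exists y.
  by have := uC Cy 0%N mC; rewrite expr0 mulr1; exact: le_trans.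
have Kr : 0 <= K * r ^+ n by rewrite mulr_ge0// exprn_ge0// ltW.
have [Cx|Cx] := pselect (C x); last first.
  by rewrite ex bind_out// mulr0 normr0 mulr0.
rewrite ex bind_in// mulr1 (@ger0_norm _ 2^-1)//.
by have := bnd x Cx; have := normr_ge0 (iter n S e x - I e); lra.
Qed.

(** By symmetry |Q^n e|^2 = <Q^(2n) e, e>, the term of index 2n of the sequence controlled by
    [renewal_decay]. *)
Lemma residual_decay : exists D q, 0 < q < 1 /\ forall n, N (iter n Q e) <= D * q ^+ n.
Proof.
have Ie0 : 0 < I e ^+ 2 by rewrite exprn_gt0// Ie divr_gt0.
have [D [q [q01 hq]]] := renewal_decay f_ge0 f_sum renewal Ie0 r01 u_cvg.
have /andP[q0 q1] := q01.
exists (Num.sqrt D), q; split => // n.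
have D0 : 0 <= D by have := hq 0%N; rewrite expr0 mulr1; exact: le_trans.
rewrite -[leRHS]ger0_norm ?mulr_ge0 ?sqrtr_ge0 ?exprn_ge0// ?(ltW q0)//.
rewrite -sqrtr_sqr ler_wsqrtr// exprMn sqr_sqrtr// -exprM muln2 -addnn.
have -> : ip (iter n Q e) (iter n Q e) = f_ (n + n).
  by rewrite /f_ iterD -(iter_sym (A := Q) residual_sym).
exact: hq.
Qed.

Let N_SE f : N (Q f) <= 2 * N f.
Proof.
apply: le_trans (nrmB ipC ipDl ipZl ip0 _ _) _.
have Ne : N e <= 1.
  have -> : 1 = N (bcst T 1).
    by rewrite /nrm bip1 pint_cst sqrtr1.
  apply: nrm_mono => [|x]; first exact: prob_lty.
  by rewrite ger0_norm// bcstE.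
rewrite (nrmZ ipC ipZl) mulrDl mul1r lerD ?iter_kop_contraction//.
apply: le_trans (_ : N f * N e * N e <= _).
  by rewrite ler_wpM2r ?nrm_ge0// ip_le_nrm.
have : N e * N e <= 1 by rewrite -[leRHS]mulr1 ler_pM ?nrm_ge0.
by rewrite -mulrA => h; rewrite ler_piMr// nrm_ge0.
Qed.

(* The residual operator is positive, so the decay of Q^n e passes to all
   functions dominated by sums of the Q^j e; these are dense. *)
Lemma residual_norm D q : 0 < q < 1 -> (forall n, N (iter n Q e) <= D * q ^+ n) ->
  forall h, N (Q h) <= q * N h.
Proof.
move=> /andP[q0 q1] hD h.
have D0 : 0 <= D by have := hD 0%N; rewrite expr0 mulr1; apply: le_trans; exact: nrm_ge0.
(* A function dominated by [s k] decays under Q at rate [q], hence contracts by [nrm_rate]; [t k]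
   below is [h] cut off to where this domination holds. *)
pose s k : V := k%:R *: \sum_(j < k) iter j Q e.
have s0 k x : 0 <= s k x.
  by rewrite bfunE mulr_ge0// bfun_sum sumr_ge0// => j _; exact: iterQ_ge0.
pose G k := [set x | `|h x| <= s k x].
have mG k : measurable (G k).
  have mf : measurable_fun [set: T] (fun x => s k x - `|h x|).
    apply: measurable_funB; first exact: bfun_measurable.
    by apply: measurableT_comp => //; exact: bfun_measurable.
  rewrite -[G k]setTI.
  have := mf measurableT _ (measurable_itv `[0, +oo[); rewrite set_itvE.
  by congr (measurable (_ `&` _)); apply/seteqP; split => x /=; rewrite subr_ge0.
pose t k : V := bmul h (bind R (G k)).
have tG k x : `|t k x| <= s k x.
  rewrite bmulE; have [Gx|Gx] := pselect (G k x).
    by rewrite bind_in// mulr1.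
  by rewrite bind_out// mulr0 normr0.
have th k x : `|t k x| <= `|h x|.
  rewrite bmulE normrM ler_piMr// ger0_norm ?bind_ge0// bind_le1//.
have Nt k : N (Q (t k)) <= q * N h.
  apply: (@le_trans _ _ (q * N (t k))).
    apply: (@nrm_rate _ _ _ ipC ipDl ipZl ip0 Q residual_sym (t k)
      (k%:R * \sum_(j < k) D * q ^+ j)); first exact: ltW.
    move=> n; apply: (@le_trans _ _ (N (iter n Q (s k)))).
      by apply: nrm_mono => [|x]; [exact: prob_lty | exact: iterQ_abs].
    rewrite iterQZ (nrmZ ipC ipZl) ger0_norm// -mulrA ler_wpM2l// iterQ_sum.
    apply: le_trans (nrm_sum ipC ipDl ipZl ip0 _) _.
    rewrite big_distrl /=; apply: ler_sum => j _.
    by rewrite -iterD -mulrA -exprD addnC.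
  rewrite ler_pM2l//; have -> : N h = N (babs h).
    by congr (Num.sqrt (bint _ _)); apply/bfunP => x; rewrite !bmulE babsE -!expr2 real_normK// num_real.
  by apply: nrm_mono => [|x]; [exact: prob_lty | rewrite babsE th].
have [M M0 hM] := bfun_bounded h.
have cvg0 : (fun k => N (h - t k)) @ \oo --> 0.
  apply: (@nrm_cvg0 _ _ _ _ (prob_lty pi) _ (M + M)).
    move=> k x; rewrite bfunD bfunN (le_trans (ler_normB _ _))// lerD//.
    exact: le_trans (th k x) (hM x).
  apply: filterS reach => x [n0 _ hn0].
  (* If every Q^j e vanished at [x], [renewal_op] would make S^n e vanish there for all n >= 1,
     against [reach]. *)
  have [j Qj] : exists j, 0 < iter j Q e x.
    apply: contrapT => nj.
    have Q0 j : iter j Q e x = 0.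
      apply/eqP; rewrite eq_le iterQ_ge0// andbT leNgt; apply/negP => ?.
      by apply: nj; exists j.
    have : 0 < iter n0.+1 S e x.
      rewrite iter_kop_iter eE iter_kopZ bfunE mulr_gt0// hn0//=.
      by rewrite (leq_trans (leqnSn _))// leq_pmulr// addn_gt0 m0.
    rewrite renewal_op bfunE bfun_sum Q0 add0r big1 ?ltxx// => i _.
    by rewrite bfunE Q0 mulr0.
  (* The factor [k] in [s k] lifts it above [M] as soon as one Q^j e is positive at [x]. *)
  have hj := truncnS_gt (M / iter j Q e x).
  set k0 := (Num.truncn _).+1 in hj.
  apply: cvg_near_cst; exists (maxn k0 j.+1) => // k hk.
  have /andP[k0k jk] : (k0 <= k)%N && (j.+1 <= k)%N by rewrite -geq_max.
  change ((h - t k) x = 0).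
  suff Gx : G k x by rewrite bfunD bfunN bmulE bind_in// mulr1 subrr.
  change (`|h x| <= s k x); rewrite (le_trans (hM x))// bfunE bfun_sum (bigD1 (Ordinal jk))//=.
  rewrite mulrDr (@le_trans _ _ (k%:R * iter j Q e x))//.
    rewrite -ler_pdivrMr// (le_trans (ltW hj))// ler_nat//.
  by rewrite lerDl mulr_ge0// sumr_ge0// => i _; exact: iterQ_ge0.
have lim : (fun k => q * N h + 2 * N (h - t k)) @ \oo --> q * N h.
  rewrite -[X in _ --> X]addr0 -[X in _ --> _ + X](mulr0 2).
  by apply: cvgD; [exact: cvg_cst | exact: cvgMr].
rewrite -(cvg_lim _ lim)//; apply: limr_ge; first by apply/cvg_ex; exists (q * N h).
apply: nearW => k; rewrite -[X in Q X](subrK (t k)) addrC linearD /=.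
apply: le_trans (nrmD ipC ipDl ipZl ip0 _ _) _.
by rewrite lerD.
Qed.

(** S and Q agree on the orthogonal of [e], and [rank_one_gap] moves the bound to the orthogonal of
    1. As S = P^m P^m, it reads |P^m g|^2 <= q |g|^2, and [nrm_rate] brings it down to P itself. *)
Lemma gap_of_minorization : exists2 q, 0 < q < 1 &
  forall g, I g = 0 -> N (kop P g) <= q * N g.
Proof.
have [D [q [q01 hD]]] := residual_decay.
have hQ := residual_norm q01 hD.
have /andP[q0 q1] := q01.
have Sgap g : I g = 0 -> ip (S g) g <= q * ip g g.
  move=> g0; apply: (@rank_one_gap _ _ _ ipC ipDl ipZl S e (bcst T 1)) => //.
  - by rewrite bip1 pint_cst.
  - by rewrite ipC bip1 gt_eqF// Ie divr_gt0.
  - exact: iter_kop_cst.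
  - exact: ltW.
  - exact: kop_iter_sym.
  - move=> w we; change (ip (S w) w <= q * ip w w); rewrite SQ we scale0r addr0 (le_trans (ler_norm _))//.
    apply: le_trans (ip_le_nrm ipC ipDl ipZl ip0 _ _) _.
    by rewrite -nrm_sq// expr2 mulrA ler_wpM2r ?nrm_ge0.
  - by rewrite bip1.
pose s := Num.sqrt q.
have s0 : 0 <= s by exact: sqrtr_ge0.
have s1 : s < 1 by rewrite -sqrtr1 ltr_sqrt.
have step g : I g = 0 -> N (iter m (kop P) g) <= s * N g.
  move=> g0; rewrite -(@ler_pXn2r _ 2) ?nnegrE ?mulr_ge0 ?nrm_ge0//.
  rewrite exprMn (sqr_sqrtr (ltW q0)) !(nrm_sq ipC ip0) -iter_kop_sym// -iterD.
  exact: Sgap.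
have steps k g : I g = 0 -> N (iter (k * m) (kop P) g) <= s ^+ k * N g.
  elim: k g => [|k IH] g g0; first by rewrite mul1r.
  rewrite mulSn iterD (le_trans (step _ _)) ?iter_kop_inv//.
  by rewrite exprS -mulrA ler_wpM2l// IH.
have [p /andP[p0 p1] sp] : exists2 p, 0 < p < 1 & s <= p ^+ m.
  by apply: exists_root => //; rewrite s0 s1.
exists p; first by rewrite p0 p1.
move=> g g0; apply: (@nrm_rate _ _ _ ipC ipDl ipZl ip0 (kop P) _ g (N g / p ^+ m)).
- exact: kop_sym.
- exact: ltW.
(* Write n = k m + j with j < m; the constant N(g)/p^m pays for the j leftover steps. *)
move=> n; have := divn_eq n m; set k := (n %/ m)%N; set j := (n %% m)%N => nE.
have jm : (j < m)%N by rewrite ltn_mod.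
rewrite {1}nE addnC iterD (le_trans (iter_kop_contraction hrev _ _))//.
rewrite (le_trans (steps _ _ g0))// mulrC -mulrA ler_wpM2l ?nrm_ge0//.
apply: (@le_trans _ _ (p ^+ (k * m))).
  by rewrite mulnC exprM; apply: lerXn2r; rewrite ?nnegrE ?exprn_ge0// ltW.
rewrite ler_pdivlMl ?exprn_gt0// -exprD.
have hn : (n <= m + k * m)%N by rewrite {1}nE addnC leq_add2r ltnW.
by apply: ler_wiXn2l => //; exact: ltW.
Qed.

End minorized.

(* A chain that is geometrically ergodic with rates depending on the starting
   point contracts the mean zero functions of L_2(pi). *)
Lemma geometric_contraction (psi : {measure set T -> \bar R}) :
  countably_generated T -> (psi [set: T] != 0)%E ->
  (forall A, measurable A -> (0 < psi A)%E ->
    forall x, \forall n \near \oo, (0 < kernel_iter P n x A)%E) ->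
  geometrically_ergodic P ->
  exists2 q, 0 < q < 1 & forall g, I g = 0 -> N (kop P g) <= q * N g.
Proof.
move=> hT psiT irr /(geometric_pi hrev psiT irr)[rho [C [rho01 C1 geo]]].
have [E [K [r [mE E0 r01 K0 uE]]]] := exists_uniform_set hT rho01 C1 geo.
have /andP[r0 r1] := r01.
have lim (a s : R) : 0 < s < 1 -> (fun n => a * s ^+ n) @ \oo --> (0 : R).
  move=> /andP[s0 s1]; rewrite -[X in _ --> X](mulr0 a); apply: cvgMr.
  by apply: cvg_expr; rewrite ger0_norm// ltW.
have [m m0 Km] : exists2 m, (0 < m)%N & K * r ^+ m <= 6^-1.
  have /cvgrPdist_le/(_ 6^-1) := lim K r r01.
  rewrite invr_gt0 ltr0n => /(_ isT)[n _ /(_ n.+1 (leqnSn n))] /= h; exists n.+1 => //.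
  by move: h; rewrite sub0r normrN; apply: le_trans; exact: ler_norm.
apply: (gap_of_minorization mE E0 r01 m0 uE Km _ (erefl _)).
apply: filterS geo => x hx.
have /cvgrPdist_lt/(_ _ E0) := lim (C x) (rho x) (rho01 x).
apply: filterS => n; rewrite sub0r normrN => /(le_lt_trans (ler_norm _)).
move=> /(le_lt_trans (hx n E mE)); rewrite ltr_distl => /andP[+ _].
by rewrite subrr.
Qed.

End gap_from_minorization.

(** The series of the F_j / q^j has finite integral, so it is finite almost everywhere; its sum
    serves as [W]. *)
Lemma geometric_ae d (T : measurableType d) (R : realType)
    (mu : {measure set T -> \bar R}) (F : nat -> T -> R) (D p q : R) :
  (forall j, measurable_fun [set: T] (F j)) -> (forall j x, 0 <= F j x) ->
  (forall j, \int[mu]_x (F j x)%:E <= (D * p ^+ j)%:E)%E -> 0 <= p < q ->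
  {ae mu, forall x, exists2 W, 0 <= W & forall j, F j x <= W * q ^+ j}.
Proof.
move=> mF F0 intF /andP[p0 pq].
have q0 : 0 < q by exact: le_lt_trans pq.
have D0 : 0 <= D.
  have := intF 0%N; rewrite expr0 mulr1 -lee_fin; apply: le_trans.
  by apply: integral_ge0 => x _; rewrite lee_fin.
pose g j x := ((F j x) / q ^+ j)%:E.
have g0 j x : (0 <= g j x)%E by rewrite lee_fin divr_ge0// exprn_ge0// ltW.
have mg j : measurable_fun [set: T] (g j).
  apply/measurable_EFinP; apply: measurable_funM => //; exact: mF.
pose G x := (\sum_(j <oo) g j x)%E.
have G0 x : (0 <= G x)%E by apply: nneseries_ge0.
have mG : measurable_fun [set: T] G by exact: ge0_emeasurable_sum.
have pq1 : p / q < 1 by rewrite ltr_pdivrMr// mul1r.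
have pq0 : 0 <= p / q by rewrite divr_ge0// ltW.
have intG : (\int[mu]_x G x <= (D / (1 - p / q))%:E)%E.
  rewrite /G integral_nneseries//; apply: lime_le.
    by apply: is_cvg_nneseries => n _ _; apply: integral_ge0 => x _; exact: g0.
  apply: nearW => k.
  apply: (@le_trans _ _ (\sum_(0 <= j < k) (D * (p / q) ^+ j)%:E)%E).
    apply: lee_sum => j _; rewrite /g.
    under eq_integral do rewrite mulrC EFinM.
    rewrite ge0_integralZl_EFin//; last first.
    - by rewrite invr_ge0 exprn_ge0// ltW.
    - by apply/measurable_EFinP.
    - by move=> x _; rewrite lee_fin.
    rewrite expr_div_n mulrA [in leRHS]mulrC EFinM.
    by apply: lee_wpmul2l => //; rewrite lee_fin invr_ge0 exprn_ge0// ltW.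
  rewrite sumEFin lee_fin -big_distrr /= ler_wpM2l//.
  have := geometric_seriesE 1 (negbT (lt_eqF pq1)).
  move=> /(congr1 (fun u => u k)); rewrite /series/= => E.
  rewrite [leLHS](_ : _ = \sum_(0 <= j < k) geometric 1 (p / q) j); last first.
    by apply: eq_bigr => j _; rewrite /= mul1r.
  rewrite E mul1r ler_pdivrMr ?subr_gt0// mulVf ?gt_eqF ?subr_gt0//.
  by rewrite gerBl exprn_ge0.
have iG : mu.-integrable [set: T] G.
  apply/integrableP; split => //.
  under eq_integral => x _ do rewrite gee0_abs//.
  by rewrite (le_lt_trans intG)// ltry.
apply: filterS (integrable_ae measurableT iG) => x /(_ Logic.I) Gfin.
exists (fine (G x)); first by rewrite fine_ge0.
move=> j; rewrite -ler_pdivrMr ?exprn_gt0// -lee_fin fineK//.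
apply: le_trans (nneseries_lim_ge j.+1 (fun n _ _ => g0 n x)).
rewrite big_nat_recr//= leeDr// sume_ge0// => i _; exact: g0.
Qed.

Lemma geometric_series_cvg (R : realType) (u : nat -> R) (W q : R) :
  0 <= q < 1 -> (forall j, `|u j| <= W * q ^+ j) -> cvgn (series u).
Proof.
move=> /andP[q0 q1] h; apply: normed_cvg.
apply: (@series_le_cvg _ _ (geometric W q)) => //.
- by move=> n; exact: normr_ge0.
- by move=> n; exact: le_trans (normr_ge0 _) (h n).
- by apply: is_cvg_geometric_series; rewrite ger0_norm.
Qed.

(** * From the resolvent to contraction of mean zero functions *)

Section gap_from_resolvent.
Context d (T : measurableType d) (R : realType) (P : R.-pker T ~> T).
Variables (pi : probability T R) (hrev : reversible P pi).
Variable psi : {measure set T -> \bar R}.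
Hypothesis psiT : (psi [set: T] != 0)%E.
Hypothesis irr : forall A, measurable A -> (0 < psi A)%E ->
    forall x, \forall n \near \oo, (0 < kernel_iter P n x A)%E.
Local Notation I := (bint pi).
Local Notation ip := (bip pi).
Local Notation N := (nrm (bip pi)).
Local Notation V := (bfun T R).
Implicit Types f g h : V.

Let ipDl := bipDl (prob_lty pi).
Let ipZl := bipZl (prob_lty pi).
Let ipC := bipC pi.
Let ip0 := bip_diag_ge0 pi.
Let nrmD := nrmD ipC ipDl ipZl ip0.
Let nrmB := nrmB ipC ipDl ipZl ip0.
Let nrm_ge0 := @nrm_ge0 _ _ ip.

Lemma nrm1 : N (bcst T 1) = 1.
Proof. by rewrite /nrm bip1 pint_cst sqrtr1. Qed.

Lemma bint_le_nrm f : `|I f| <= N f.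
Proof.
rewrite -bip1; apply: le_trans (ip_le_nrm ipC ipDl ipZl ip0 _ _) _.
by rewrite nrm1 mulr1.
Qed.

Lemma nrm_babs f : N (babs f) = N f.
Proof.
congr (Num.sqrt (bint _ _)); apply/bfunP => x.
by rewrite !bmulE babsE -!expr2 real_normK// num_real.
Qed.

Lemma bip_nrm0 f g : N f = 0 -> ip f g = 0.
Proof.
move=> f0; apply/eqP; rewrite -normr_le0.
by apply: le_trans (ip_le_nrm ipC ipDl ipZl ip0 _ _) _; rewrite f0 mul0r.
Qed.

Lemma ae_nrm0 f : {ae pi, forall x, f x = 0} -> N f = 0.
Proof.
move=> h; rewrite /nrm (_ : ip f f = 0) ?sqrtr0//.
rewrite -[RHS](blin0 (bint_lin (prob_lty pi))); apply: bint_ae_eq.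
by apply: filterS h => x fx; rewrite bmulE fx mul0r.
Qed.

Lemma nrm_bint_abs0 f : I (babs f) = 0 -> N f = 0.
Proof.
move=> h; apply: ae_nrm0; apply: filterS (bint_eq0 (prob_lty pi) _ h) => [x|x].
  by rewrite babsE => /eqP; rewrite normr_eq0 => /eqP.
by rewrite babsE.
Qed.

(** Passing to the square gives a positive operator, so that one argument treats the spectrum near 1
    and near -1. *)
Definition kop2 f : V := kop P (kop P f).

Lemma kop2_linear : linear kop2.
Proof. by move=> a f g; rewrite /kop2 !linearP. Qed.
HB.instance Definition _ := GRing.isLinear.Build R V V _ kop2 kop2_linear.
Local Notation A := kop2.

Lemma kop2_mono f g : (forall x, f x <= g x) -> forall x, A f x <= A g x.
Proof. by move=> fg x; apply: kop_mono; exact: kop_mono. Qed.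

Let iterA n f : iter n A f = iter n.*2 (kop P) f.
Proof. by elim: n f => [f //|n IH f]; rewrite iterS IH doubleS !iterS /kop2. Qed.

Let Asym f g : ip (A f) g = ip f (A g).
Proof. by rewrite /kop2 !kop_sym. Qed.

Let Apos f : 0 <= ip (A f) f.
Proof. by rewrite /kop2 kop_sym. Qed.

Let Ale f : N (A f) <= N f.
Proof. exact: le_trans (kop_contraction hrev _) (kop_contraction hrev _). Qed.

Let Ainv f : I (A f) = I f.
Proof. by rewrite /kop2 !kop_inv. Qed.

(* |h| is again harmonic, hence so is h^+; then {h > 0} is absorbing up to a
   null set, and irreducibility makes it null or conull. *)
Lemma harmonic_trivial h : N (A h - h) = 0 -> I h = 0 -> N h = 0.
Proof.
move=> Ah0 Ih.
have Aabs : N (A (babs h) - babs h) = 0.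
  (* Jensen: |A h| <= A|h|. Both have the same integral since A h = h almost everywhere, so they
     agree almost everywhere. *)
  have ge x : 0 <= (A (babs h) - babs (A h)) x.
    rewrite bfunB babsE subr_ge0 ler_norml lerNl; apply/andP; split.
      rewrite -bfunN -linearN; apply: kop2_mono => y.
      by rewrite bfunN babsE -normrN ler_norm.
    by apply: kop2_mono => y; rewrite babsE ler_norm.
  have ae1 := nrm_eq0_ae Ah0.
  have Iabs : I (babs (A h)) = I (babs h).
    apply: bint_ae_eq.
    apply: filterS ae1 => x; rewrite bfunB !babsE => /eqP.
    by rewrite subr_eq0 => /eqP ->.
  have I0 : I (A (babs h) - babs (A h)) = 0.
    by rewrite (blinB _ _ (bint_lin (prob_lty pi))) Ainv Iabs subrr.
  have ae2 := bint_eq0 (prob_lty pi) ge I0.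
  apply: ae_nrm0; apply: filterS2 ae1 ae2 => x.
  rewrite !bfunB !babsE => /eqP; rewrite subr_eq0 => /eqP <-.
  by [].
(* Twice the positive part of [h]. *)
pose hp : V := babs h + h.
have hpE x : hp x = `|h x| + h x by rewrite /hp bfunD babsE.
have hpD : hp = babs h + h by [].
have hp0 x : 0 <= hp x.
  by rewrite hpE -lerBlDr sub0r -normrN ler_norm.
clearbody hp.
have Ahp : N (A hp - hp) = 0.
  apply/eqP; rewrite eq_le nrm_ge0 andbT.
  have -> : A hp - hp = (A (babs h) - babs h) + (A h - h).
    by rewrite hpD [A _]linearD opprD addrACA.
  by rewrite (le_trans (nrmD _ _))// Aabs Ah0 addr0.
have ipA g : ip (A hp) g = ip hp g.
  by apply/eqP; rewrite -subr_eq0 -(bipBl (prob_lty pi)) bip_nrm0.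
have ipAhp n g : ip (iter n A hp) g = ip hp g.
  by elim: n g => [//|n IH] g; rewrite iterS Asym IH -Asym ipA.
pose B := [set x | 0 < h x].
have mB : measurable B.
  rewrite -[B]setTI; have := bfun_measurable h measurableT (measurable_itv `]0, +oo[).
  by rewrite set_itvE.
have mB' := measurableC mB.
have ind0 x : 0 <= bind R (~` B) x by exact: bind_ge0.
have hpB' : ip hp (bind R (~` B)) = 0.
  rewrite /bip (_ : bmul _ _ = 0) ?(blin0 (bint_lin (prob_lty pi)))//.
  apply/bfunP => x; rewrite bmulE hpE bfun0.
  have [Bx|Bx] := pselect (B x).
    by rewrite (bind_out R mB') ?mulr0// => /(_ Bx).
  have hx : h x <= 0 by rewrite leNgt; exact/negP.
  by rewrite ler0_norm// addNr mul0r.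
have dich := dichotomy hrev psiT irr mB.
have abs0 : I (babs h) = 0.
  case: dich => [n|piB|piB].
  (* [hp] is positive on [B], so P^(2n) 1_(~B) must vanish almost everywhere there. *)
  - have : ip hp (iter n.*2 (kop P) (bind R (~` B))) = 0.
      by rewrite -iter_kop_sym// -iterA ipAhp hpB'.
    move=> /(bip_nonneg_eq0 hp0 (iter_kop_ge0 P n.*2 ind0)) hae.
    rewrite /bip -[RHS](blin0 (bint_lin (prob_lty pi))); apply: bint_ae_eq.
    apply: filterS hae => x; rewrite !bmulE bfun0 => /eqP.
    rewrite mulf_eq0 => /orP[/eqP hx|/eqP ->]; last by rewrite mul0r.
    rewrite bind_out ?mulr0// => Bx; move: hx; rewrite hpE gtr0_norm//.
    by move=> /eqP; rewrite gt_eqF// addr_gt0.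
  - have -> : I (babs h) = I (- h).
      apply: bint_ae_eq.
      exists B; split => // x /= hx; apply: contrapT => Bx; apply: hx.
      by rewrite babsE ler0_norm// leNgt; exact/negP.
    by rewrite (blinN _ (bint_lin (prob_lty pi))) Ih oppr0.
  - have -> : I (babs h) = I h.
      apply: bint_ae_eq.
      exists (~` B); split => // x /= hx Bx; apply: hx.
      by rewrite babsE gtr0_norm.
    exact: Ih.
exact: nrm_bint_abs0.
Qed.

(** [isolated_gap] makes A^n decay on the range of 1 - A, which contains every f - A^n f. The
    sequence A^n f converges to a harmonic function of mean zero, which [harmonic_trivial] kills; in
    the limit A contracts [f], and then so does P. *)
Lemma resolvent_contraction eps : 0 < eps ->
  (forall t, 1 - eps < t < 1 ->
    (exists2 c, 0 < c & forall f, c * N f <= N (t *: f - kop P f)) /\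
    (exists2 c, 0 < c & forall f, c * N f <= N (t *: f + kop P f))) ->
  exists2 q, 0 < q < 1 & forall f, I f = 0 -> N (kop P f) <= q * N f.
Proof.
move=> eps0 res.
have [k [k0 k1 gap]] : exists k, [/\ 0 < k, k < 1 &
    forall f n, N (iter n A (f - A f)) <= (1 - k) ^+ n * N (f - A f)].
  apply: (@isolated_gap _ _ _ ipC ipDl ipZl ip0 A Asym Apos Ale (Num.min eps 1)).
    by rewrite lt_min eps0 ltr01.
  move=> s /andP[s0 s1].
  have s0' : 0 < s by apply: le_lt_trans s0; rewrite subr_ge0 ge_min lexx orbT.
  have es : 1 - eps < s by apply: le_lt_trans s0; rewrite lerD2l lerN2 ge_min lexx.
  (* s - A = (t - P)(t + P) with t = sqrt s, and t >= s stays in the range of [res]. *)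
  pose t := Num.sqrt s.
  have ts : t ^+ 2 = s by rewrite sqr_sqrtr// ltW.
  have t1 : t < 1 by rewrite -sqrtr1 ltr_sqrt.
  have t0 : 0 < t by rewrite sqrtr_gt0.
  have st : s <= t by rewrite -ts expr2 ger_pMl// ltW.
  have [] := res t; first by rewrite t1 (lt_le_trans es st).
  move=> [c1 c10 h1] [c2 c20 h2]; exists (c1 * c2); first by rewrite mulr_gt0.
  move=> f; have -> : s *: f - A f = t *: (t *: f + kop P f) - kop P (t *: f + kop P f).
    by rewrite [kop P (_ + _)]linearD /= [kop P (_ *: _)]linearZ_LR /= scalerDr scalerA -expr2 ts opprD addrA addrK.
  by rewrite (le_trans _ (h1 _))// -mulrA ler_wpM2l// ltW.
exists (Num.sqrt (1 - k)).
  by rewrite sqrtr_gt0 subr_gt0 k1 -[X in _ < X]sqrtr1 ltr_sqrt// gtrBl.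
move=> f If.
pose y n : V := \sum_(j < n) iter j A f.
have yS n : y n.+1 = y n + iter n A f by rewrite /y big_ord_recr.
have sum_u n : f - iter n A f = y n - A (y n).
  have A0 : A 0 = 0 by exact: linear0.
  elim: n => [|n IH]; first by rewrite /y big_ord0 A0 /= subrr subr0.
  have AD : A (y n + iter n A f) = A (y n) + A (iter n A f) by exact: linearD.
  have alg (W : zmodType) (b a s Aa As : W) : b - a = s - As -> b - Aa = s + a - (As + Aa).
    by move=> E; rewrite opprD addrACA -E addrA subrK.
  by rewrite yS AD iterS; exact: alg.
clearbody y.
have step n : N (A (f - iter n A f)) <= (1 - k) * N (f - iter n A f).
  by rewrite sum_u; move: (gap (y n) 1%N); rewrite expr1 /=.
have [M M0 hM] := bfun_bounded f.
have hMn n x : `|iter n A f x| <= M by rewrite iterA; exact: iter_kop_bound.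
pose u n := iter n A (f - A f).
have uE n : u n = iter n A f - iter n.+1 A f.
  by rewrite /u !iterA iter_kopB -iterSr -iterSr.
have kq : 0 <= 1 - k < 1 - k / 2 by apply/andP; split; lra.
have ae_u : {ae pi, forall x, exists2 W, 0 <= W & forall j, `|u j x| <= W * (1 - k / 2) ^+ j}.
  have := @geometric_ae _ _ _ pi (fun j x => `|u j x|) (N (f - A f)) (1 - k) (1 - k / 2).
  apply => //.
  - by move=> j; apply: measurableT_comp => //; exact: bfun_measurable.
  - move=> j; under eq_integral do rewrite -babsE.
    rewrite -bintE ?prob_lty// lee_fin mulrC (le_trans _ (gap _ _))//.
    by rewrite -(nrm_babs (iter _ _ _)) (le_trans (ler_norm _))// bint_le_nrm.
have [N0 [mN0 N00 hN0]] := ae_u.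
have mN0' := measurableC mN0.
(* The space of bounded functions is not complete in norm, so the limit is built pointwise; cutting
   off the null set [N0] makes it exist everywhere and be bounded and measurable. *)
pose g n : V := bmul (iter n A f) (bind R (~` N0)).
have g_cvg x : cvgn (fun n => g n x).
  have [Nx|Nx] := pselect (N0 x).
    apply/cvg_ex; exists 0; apply: cvg_near_cst; apply: nearW => n.
    by rewrite bmulE bind_out ?mulr0// => /(_ Nx).
  have [W W0 hW] : exists2 W, 0 <= W & forall j, `|u j x| <= W * (1 - k / 2) ^+ j.
    by apply: contrapT => nW; apply: Nx; exact: hN0.
  have q01 : 0 <= 1 - k / 2 < 1 by apply/andP; split; lra.
  have := geometric_series_cvg q01 hW => /cvg_ex[l hl].
  apply/cvg_ex; exists (f x - l).
  rewrite [X in X @ _ --> _](_ : _ = (fun n => f x - series (fun j => u j x) n)).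
    by apply: cvgB => //; exact: cvg_cst.
  apply/funext => n; rewrite bmulE bind_in// mulr1 /series /= big_mkord.
  elim: n => [|n IH]; first by rewrite big_ord0 subr0.
  rewrite big_ord_recr /= opprD addrA -IH uE !bfunE.
  by rewrite opprB addrC subrK.
have gM n x : `|g n x| <= M.
  rewrite bmulE normrM (le_trans _ (hMn n x))// ler_piMr//.
  by rewrite ger0_norm ?bind_ge0// bind_le1.
pose h : V := mkb (fun x => limn (fun n => g n x)).
have hE x : (fun n => g n x) @ \oo --> h x.
  suff -> : h x = limn (fun n => g n x) by exact: g_cvg.
  apply: (@mkbE _ _ _ (fun x => limn (fun n => g n x))).
    apply: (measurable_fun_cvg (h := fun n => g n)).
      by move=> n; exact: bfun_measurable.
    by move=> z _; exact: g_cvg.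
  exists M => z; rewrite ler_norml; apply/andP; split.
    by apply: limr_ge; [exact: g_cvg | apply: nearW => n; have := gM n z; rewrite ler_norml => /andP[]].
  by apply: limr_le; [exact: g_cvg | apply: nearW => n; have := gM n z; rewrite ler_norml => /andP[]].
have hM' x : `|h x| <= M.
  rewrite -(cvg_lim _ (hE x))// ler_norml; apply/andP; split.
    by apply: limr_ge; [exact: g_cvg | apply: nearW => n; have := gM n x; rewrite ler_norml => /andP[]].
  by apply: limr_le; [exact: g_cvg | apply: nearW => n; have := gM n x; rewrite ler_norml => /andP[]].
have ae_cvg : {ae pi, forall x, (fun n => iter n A f x) @ \oo --> h x}.
  exists N0; split => // x /= hx; apply: contrapT => Nx; apply: hx.
  rewrite [X in X @ _ --> _](_ : _ = (fun n => g n x)); first exact: hE.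
  by apply/funext => n; rewrite bmulE bind_in// mulr1.
have Ncvg : (fun n => N (iter n A f - h)) @ \oo --> 0.
  apply: (@nrm_cvg0 _ _ _ _ (prob_lty pi) _ (M + M)).
    by move=> n x; rewrite bfunB (le_trans (ler_normB _ _))// lerD.
  apply: filterS ae_cvg => x hx.
  rewrite [X in X @ _ --> _](_ : _ = (fun n => iter n A f x - h x)); last first.
    by apply/funext => n; rewrite bfunB.
  by rewrite -(subrr (h x)); apply: cvgB => //; exact: cvg_cst.
have le_cvg (a : R) (v : nat -> R) l : v @ \oo --> l -> (forall n, a <= v n) -> a <= l.
  move=> vl av; rewrite -(cvg_lim _ vl)//; apply: limr_ge.
    by apply/cvg_ex; exists l.
  exact: nearW.
pose a n := N (iter n A f - h).
have a0 : a @ \oo --> 0 by exact: Ncvg.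
have a1 : (fun n => a n.+1) @ \oo --> 0 by rewrite (cvg_shiftS a).
have Ah : N (A h - h) = 0.
  apply/eqP; rewrite eq_le nrm_ge0 andbT -[leRHS](addr0 0).
  apply: (le_cvg _ _ _ (cvgD a0 a1)) => n.
  have alg (W : zmodType) (u0 v Au Av : W) : Au - u0 = (Au - Av) + (Av - u0).
    by rewrite addrA subrK.
  rewrite (alg _ h (iter n A f) (A h) (A (iter n A f))).
  apply: le_trans (nrmD _ _) _; apply: lerD; last by [].
  have <- : A (h - iter n A f) = A h - A (iter n A f) by exact: linearB.
  apply: le_trans (Ale _) _.
  by have := nrmN ipC ipZl (iter n A f - h); rewrite opprB => ->.
have Ih : I h = 0.
  apply/eqP; rewrite -normr_le0; apply: (le_cvg _ _ _ Ncvg) => n.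
  apply: le_trans (bint_le_nrm _); rewrite (blinB _ _ (bint_lin (prob_lty pi))).
  by rewrite iterA iter_kop_inv// If sub0r normrN.
have h0 := harmonic_trivial Ah Ih.
have leb n : N (iter n A f) <= a n.
  by have := nrmD (iter n A f - h) h; rewrite subrK h0 addr0.
pose b n := N (iter n A f).
have b0 : b @ \oo --> 0.
  apply: (@squeeze_cvgr _ _ _ _ (fun=> 0) a); [|exact: cvg_cst|exact: a0].
  by apply: nearW => n; rewrite /b nrm_ge0 leb.
(* A f = A(f - A^n f) + A(A^n f): the first term contracts by 1 - k, the second tends to 0. *)
have Af : N (A f) <= (1 - k) * N f.
  have c2 : (fun n => (1 - k) * N f + ((1 - k) * b n + b n)) @ \oo -->
      (1 - k) * N f + ((1 - k) * 0 + 0).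
    apply: cvgD; first exact: cvg_cst.
    by apply: cvgD; [apply: cvgMr; exact: b0 | exact: b0].
  rewrite mulr0 !addr0 in c2; apply: (le_cvg _ _ _ c2) => n.
  have E : A (f - iter n A f) = A f - A (iter n A f) by exact: linearB.
  have := nrmD (A (f - iter n A f)) (A (iter n A f)).
  rewrite {1}E subrK => /le_trans; apply.
  rewrite addrA; apply: lerD; last exact: Ale.
  apply: le_trans (step n) _; rewrite -mulrDr; apply: ler_wpM2l.
    by rewrite subr_ge0 ltW.
  exact: nrmB.
have k1' : 0 <= 1 - k by rewrite subr_ge0 ltW.
(* |P f|^2 = <f, A f>, so P contracts by the square root of the factor of A. *)
have h1 : N (kop P f) ^+ 2 <= N f * N (A f).
  rewrite (nrm_sq ipC ip0) kop_sym//.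
  exact: le_trans (ler_norm _) (ip_le_nrm ipC ipDl ipZl ip0 _ _).
rewrite -(@ler_pXn2r _ 2) ?nnegrE ?mulr_ge0 ?sqrtr_ge0 ?nrm_ge0//.
rewrite exprMn (sqr_sqrtr k1'); apply: le_trans h1 _.
rewrite expr2 mulrCA; apply: ler_wpM2l; [exact: nrm_ge0 | exact: Af].
Qed.

End gap_from_resolvent.

(** * Measures on the product built from pi and a kernel *)

Section semidirect_product.
Context d (T : measurableType d) (R : realType) (pi : probability T R).

Section measure.
Variable k : R.-fker T ~> T.

(* pi(dx) k(x, dy) *)
Definition semidirect (D : set (T * T)) : \bar R :=
  (\int[pi]_x k x (xsection D x))%E.

Let semidirect0 : semidirect set0 = 0%E.
Proof. by rewrite /semidirect integral0_eq// => x _; rewrite xsection0 measure0. Qed.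

Let semidirect_ge0 D : (0 <= semidirect D)%E.
Proof. by apply: integral_ge0 => x _; exact: measure_ge0. Qed.

Let semidirect_sigma_additive : semi_sigma_additive semidirect.
Proof.
move=> F mF tF mUF.
rewrite [X in _ --> X](_ : _ = \sum_(n <oo) (semidirect (F n)))%E.
  by apply/cvg_closeP; split; [exact: is_cvg_nneseries|rewrite closeE].
rewrite -integral_nneseries//; last first.
  by move=> n; apply: measurable_fun_xsection_finite_kernel; rewrite inE.
apply: eq_integral => x _; apply/esym/cvg_lim => //=; rewrite xsection_bigcup.
apply: (measure_sigma_additive _ (trivIset_xsection tF)) => ?.
exact: measurable_xsection.
Qed.

HB.instance Definition _ := isMeasure.Build _ _ _ semidirect
  semidirect0 semidirect_ge0 semidirect_sigma_additive.

Let semidirect_fin : fin_num_fun semidirect.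
Proof.
move=> D mD; rewrite ge0_fin_numE//.
have [r hr] := measure_uub k.
apply: (@le_lt_trans _ _ (\int[pi]_x `|r|%:E)%E); last first.
  by rewrite integral_cst// lte_mul_pinfty// ?lee_fin// prob_lty.
apply: ge0_le_integral => //.
- by apply: measurable_fun_xsection_finite_kernel; rewrite inE.
- move=> x _; apply: (@le_trans _ _ (k x [set: T])).
    by apply: le_measure; rewrite ?inE//; exact: measurable_xsection.
  by rewrite (le_trans (ltW (hr x)))// lee_fin ler_norm.
Qed.

HB.instance Definition _ := @Measure_isFinite.Build _ _ _ semidirect semidirect_fin.

Lemma semidirectX A B : measurable A -> measurable B ->
  semidirect (B `*` A) = (bip pi (kop k (bind R A)) (bind R B))%:E.
Proof.
move=> mA mB; rewrite bintE ?prob_lty//; apply: eq_integral => x _.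
rewrite bmulE kop_ind//; have [xB|xB] := boolP (x \in B).
  rewrite in_xsectionX// bind_in ?mulr1 ?fineK//; last exact/set_mem.
  exact: (finite_kernel_measure k x).
by rewrite notin_xsectionX// measure0 bind_out ?mulr0// => /mem_set; exact/negP.
Qed.

End measure.

(** The kernel with density 1_G against pi; with [G] the whole product, its [semidirect] is pi x
    pi. *)
Definition restr_kernel (G : set (T * T)) (mG : measurable G) (x : T) :
  {measure set T -> \bar R} := mrestr pi (measurable_xsection x mG).

Section restr.
Variables (G : set (T * T)) (mG : measurable G).

Let restr_measurable U : measurable U ->
  measurable_fun [set: T] (restr_kernel mG ^~ U).
Proof.
move=> mU.
have mGU : measurable (G `&` ([set: T] `*` U)).
  by apply: measurableI => //; exact: measurableX.
rewrite [X in measurable_fun _ X](_ : _ = pi \o xsection (G `&` ([set: T] `*` U))).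
  exact: measurable_fun_xsection.
apply/funext => x; rewrite /restr_kernel /= /mrestr xsectionI in_xsectionX ?inE//.
by rewrite setIC.
Qed.

HB.instance Definition _ := isKernel.Build _ _ T T R (restr_kernel mG) restr_measurable.

Let restr_uub : measure_fam_uub (restr_kernel mG).
Proof.
exists 2%R => x; apply: (@le_lt_trans _ _ 1%E); last by rewrite lte_fin ltr1n.
apply: probability_le1; apply: measurableI => //; exact: measurable_xsection.
Qed.

HB.instance Definition _ := Kernel_isFinite.Build _ _ T T R (restr_kernel mG) restr_uub.

End restr.

Lemma semidirect_restr (G : set (T * T)) (mG : measurable G) D : measurable D ->
  semidirect (restr_kernel mG) D = semidirect (restr_kernel (@measurableT _ (T * T)%type)) (D `&` G).
Proof.
move=> mD; apply: eq_integral => x _; rewrite /restr_kernel /= /mrestr.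
rewrite xsectionI; congr (pi _).
by apply/seteqP; split => [y [h1 h2]|y [[h1 h2] _]] //; split => //; exact/xsectionP.
Qed.

End semidirect_product.

(** * An absolutely continuous component of the iterates *)

Section convergence.
Context d (T : measurableType d) (R : realType) (P : R.-pker T ~> T).
Variables (pi : probability T R) (hrev : reversible P pi).
Variable psi : {measure set T -> \bar R}.
Hypothesis psiT : (psi [set: T] != 0)%E.
Hypothesis irr : forall A, measurable A -> (0 < psi A)%E ->
    forall x, \forall n \near \oo, (0 < kernel_iter P n x A)%E.
Local Notation pr A := (fine (pi A)).
Local Notation I := (bint pi).
Local Notation ip := (bip pi).
Local Notation N := (nrm (bip pi)).
Local Notation V := (bfun T R).
Implicit Types f g h : V.
Let mTT : measurable [set: T * T] := measurableT.
Local Notation J n := (semidirect pi (kernel_iter P n)).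
Local Notation PP := (semidirect pi (restr_kernel pi mTT)).

Let ipDl := bipDl (prob_lty pi).
Let ipZl := bipZl (prob_lty pi).
Let ipC := bipC pi.
Let ip0 := bip_diag_ge0 pi.

(** By invariance a pi-null set is almost never visited, which irreducibility forbids for sets
    charged by psi. *)
Lemma psi_dominates B : measurable B -> pi B = 0%E -> psi B = 0%E.
Proof.
move=> mB piB; apply/eqP; apply: contrapT => /negP h.
have psiB : (0 < psi B)%E by rewrite lt0e h measure_ge0.
have : pi [set: T] = 0%E.
  apply: (unreached_null irr measurableT mB psiB) => n.
  have -> : bind R [set: T] = bcst T 1.
    by apply/bfunP => x; rewrite bind_in// bcstE.
  by rewrite bip1 iter_kop_inv// bint_ind// [X in fine X]piB.
by rewrite probability_setT => /eqP; rewrite onee_eq0.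
Qed.

(* Otherwise all the measures pi(dx)P^n(x, dy) would be carried by a common
   pi x pi-null set, and the complement of its section at almost every x would
   be a set of full measure never visited from x. *)
Lemma exists_density : exists n k (G : set (T * T)), [/\ measurable G, (0 < PP G)%E &
  forall D, measurable D -> D `<=` G -> ((k.+1%:R^-1)%:E * PP D <= J n.+1 D)%E].
Proof.
apply: contrapT => hno.
(* On the positive Hahn set of J - PP/(k + 1) the wanted domination holds, so by [hno] that set must
   be null for pi x pi. *)
pose nu (n k : nat) : {charge set (T * T)%type -> \bar R} :=
  cadd (charge_of_finite_measure (J n.+1))
       (cscale (- (k.+1%:R^-1)) (charge_of_finite_measure PP)).
have nuE n k D : nu n k D = (J n.+1 D + (- (k.+1%:R^-1))%:E * PP D)%E by [].
have fin m D : measurable D -> J m D \is a fin_num by move=> mD; exact: fin_num_measure.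
have PPfin D : measurable D -> PP D \is a fin_num by move=> mD; exact: fin_num_measure.
have [Q hQ] : exists Q : nat -> nat -> set (T * T), forall n k,
    [/\ measurable (Q n k), PP (Q n k) = 0%E & forall D, measurable D -> D `<=` ~` Q n k ->
      (J n.+1 D <= (k.+1%:R^-1)%:E * PP D)%E].
  suff h n k : exists Q : set (T * T),
    [/\ measurable Q, PP Q = 0%E & forall D, measurable D -> D `<=` ~` Q ->
      (J n.+1 D <= (k.+1%:R^-1)%:E * PP D)%E].
    by exists (fun n k => sval (cid (h n k))) => n k; case: (cid _).
  have [Q [N' [[mQ posQ] [mN negN] QN QN0]]] := Hahn_decomposition (nu n k).
  exists Q; split => //.
    apply/eqP; apply: contrapT => /negP PPQ; apply: hno; exists n, k, Q.
    split => //; first by rewrite lt0e PPQ/=; exact: measure_ge0.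
    move=> D mD DQ; have := posQ D mD DQ; rewrite nuE -(fineK (fin _ _ mD)) -(fineK (PPfin _ mD)).
    by rewrite -!EFinM -EFinD !lee_fin mulNr subr_ge0.
  move=> D mD DQ.
  have DN : D `<=` N'.
    move=> x Dx; have : (Q `|` N') x by rewrite QN.
    by case=> // /(DQ x Dx).
  have := negN D mD DN; rewrite nuE -(fineK (fin _ _ mD)) -(fineK (PPfin _ mD)).
  by rewrite -!EFinM -EFinD !lee_fin mulNr subr_le0.
pose G := \bigcup_n \bigcup_k Q n k.
have mQ n k : measurable (Q n k) by have [] := hQ n k.
have mG : measurable G by apply: bigcupT_measurable => n; exact: bigcupT_measurable.
have mG' := measurableC mG.
have PPG : PP G = 0%E.
  apply/(negligibleP _ mG); apply: negligible_bigcup => n; apply: negligible_bigcup => k.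
  by apply/(negligibleP _ (mQ n k)); have [] := hQ n k.
(* Off [G] the measure is at most PP/(k + 1) for every k. *)
have JG n : J n.+1 (~` G) = 0%E.
  have PPG' := PPfin _ mG'.
  have h k : (J n.+1 (~` G) <= (k.+1%:R^-1)%:E * PP (~` G))%E.
    have [_ _] := hQ n k; apply => // x Gx Qx; apply: Gx; exists n => //; exists k => //.
  apply/eqP; rewrite eq_le measure_ge0 andbT -(fineK (fin _ _ mG')) lee_fin.
  have {}h k : fine (J n.+1 (~` G)) <= k.+1%:R^-1 * fine (PP (~` G)).
    by rewrite -lee_fin fineK ?fin// EFinM fineK.
  rewrite leNgt; apply/negP => J0.
  have := truncnS_gt (fine (PP (~` G)) / fine (J n.+1 (~` G))).
  set k := Num.truncn _; rewrite ltr_pdivrMr// => hk.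
  have := h k; rewrite mulrC ler_pdivlMr// leNgt mulrC hk//.
have ae0 : {ae pi, forall x, pi (xsection G x) = 0%E}.
  have : ae_eq pi [set: T] (pi \o xsection G) (cst 0%E).
    apply/(ae_eq_integral_abs pi measurableT); first exact: measurable_fun_xsection.
    rewrite -[RHS]PPG; apply: eq_integral => x _; rewrite gee0_abs//=.
    congr (pi _); apply/seteqP; split => [y ?|y []//]; split => //.
    by apply/xsectionP.
  by apply: filterS => x /(_ Logic.I).
have aen : {ae pi, forall x, forall n, kernel_iter P n.+1 x (~` (xsection G x)) = 0%E}.
  apply: ae_foralln => n.
  have : ae_eq pi [set: T] (fun x => kernel_iter P n.+1 x (xsection (~` G) x)) (cst 0%E).
    apply/(ae_eq_integral_abs pi measurableT).
      by apply: measurable_fun_xsection_finite_kernel; rewrite inE.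
    by rewrite -[RHS](JG n); apply: eq_integral => x _; rewrite gee0_abs.
  apply: filterS => x /(_ Logic.I) /= <-; congr (kcomp_noparam _ _ _ _).
  by apply/seteqP; split => y; [move=> Gy; apply/xsectionP => ?; apply: Gy; apply/xsectionP
    | move=> /xsectionP Gy /xsectionP].
have [x [x0 xn]] : exists x, pi (xsection G x) = 0%E /\
    forall n, kernel_iter P n.+1 x (~` (xsection G x)) = 0%E.
  apply: contrapT => nx.
  have : {ae pi, forall x, ~ [set: T] x}.
    apply: filterS2 ae0 aen => x h1 h2 _; apply: nx; exists x; split => //.
  move=> /(ae_notin_null measurableT); rewrite probability_setT => /eqP.
  by rewrite onee_eq0.
have mGx : measurable (xsection G x) by exact: measurable_xsection.
have psiG := psi_dominates mGx x0.
have psiG' : (0 < psi (~` xsection G x))%E.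
  rewrite lt0e measure_ge0 andbT; apply: contra psiT => /eqP p0'.
  have := measureU psi mGx (measurableC mGx) (setICr _); rewrite setUv => ->.
  by rewrite [X in (X + _)%E]psiG [X in (_ + X)%E]p0' adde0.
have [n _ /(_ n.+1 (leqnSn n))] /= := irr (measurableC mGx) psiG' x.
by rewrite [X in (_ < X)%E]xn ltxx.
Qed.

End convergence.

Section small_kernel.
Context d (T : measurableType d) (R : realType) (P : R.-pker T ~> T).
Variables (pi : probability T R) (hrev : reversible P pi).
Variable psi : {measure set T -> \bar R}.
Hypothesis psiT : (psi [set: T] != 0)%E.
Hypothesis irr : forall A, measurable A -> (0 < psi A)%E ->
    forall x, \forall n \near \oo, (0 < kernel_iter P n x A)%E.
Local Notation ip := (bip pi).
Local Notation V := (bfun T R).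
Implicit Types f g h : V.
Let mTT : measurable [set: T * T] := measurableT.
Local Notation J n := (semidirect pi (kernel_iter P n)).
Local Notation PP := (semidirect pi (restr_kernel pi mTT)).

Lemma bip_le_ae f g :
  (forall E, measurable E -> ip f (bind R E) <= ip g (bind R E)) ->
  exists N0, [/\ measurable N0, pi N0 = 0%E & forall x, ~ N0 x -> f x <= g x].
Proof.
move=> fg; pose N0 := [set x | g x < f x].
have mN0 : measurable N0.
  rewrite -[N0]setTI; apply: measurable_fun_ltr => //; exact: bfun_measurable.
exists N0; split => // [|x]; last by rewrite /N0 /= => /negP; rewrite -leNgt.
have ge0 x : 0 <= bmul (f - g) (bind R N0) x.
  rewrite bmulE; have [/= h|h] := pselect (N0 x).
    by rewrite bind_in// mulr1 -[X in 0 <= X]/(f x - g x) subr_ge0 ltW.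
  by rewrite bind_out// mulr0.
have i0 : bint pi (bmul (f - g) (bind R N0)) = 0.
  apply/eqP; rewrite eq_le (bint_ge0 pi ge0) andbT.
  by rewrite -/(bip pi (f - g) (bind R N0)) bipBl ?prob_lty// subr_le0 fg.
apply: ae_notin_null => //; apply: filterS (bint_eq0 (prob_lty pi) ge0 i0) => x.
rewrite bmulE => h /= Nx; move: h; rewrite bind_in// mulr1 -[X in X = 0]/(f x - g x) => /eqP.
by rewrite subr_eq0 => /eqP h; move: Nx; rewrite /N0 /= h ltxx.
Qed.

(** The domination between measures on the product disintegrates, for each set of the determining
    family, into an inequality at almost every x. Countably many exceptional sets are discarded, and
    [countable_determining] recovers all measurable sets. *)
Lemma exists_small_kernel : countably_generated T ->
  exists n c (G : set (T * T)) (mG : measurable G), [/\ 0 < c, (0 < PP G)%E &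
    forall x A, measurable A ->
      c * fine (restr_kernel pi mG x A) <= fine (kernel_iter P n.+1 x A)].
Proof.
move=> /(countable_determining R) [B [mB hB]].
have [n [k [G [mG PG hG]]]] := exists_density hrev psiT irr.
set c := k.+1%:R^-1 in hG; have c0 : 0 < c by rewrite invr_gt0 ltr0n.
have [E hE] : exists E : nat -> set T, forall i, [/\ measurable (E i), pi (E i) = 0%E &
    forall x, ~ E i x ->
      (c *: kop (restr_kernel pi mG) (bind R (B i))) x <= kop (kernel_iter P n.+1) (bind R (B i)) x].
  suff h i : exists E : set T, [/\ measurable E, pi E = 0%E &
    forall x, ~ E x ->
      (c *: kop (restr_kernel pi mG) (bind R (B i))) x <= kop (kernel_iter P n.+1) (bind R (B i)) x].
    by exists (fun i => sval (cid (h i))) => i; case: (cid _).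
  apply: bip_le_ae => E mE.
  rewrite bipZl ?prob_lty// -lee_fin EFinM -!semidirectX// semidirect_restr; last exact: measurableX.
  apply: le_trans (hG _ _ _) _ => //; first by apply: measurableI => //; exact: measurableX.
  by apply: le_measure; rewrite ?inE//; [apply: measurableI => //|]; exact: measurableX.
have mE i : measurable (E i) by have [] := hE i.
pose N0 := \bigcup_i E i.
have mN0 : measurable N0 by exact: bigcupT_measurable.
have pN0 : pi N0 = 0%E.
  apply/(negligibleP _ mN0); apply: negligible_bigcup => i.
  by apply/(negligibleP _ (mE i)); have [] := hE i.
have mN0T : measurable (~` N0 `*` [set: T]) by apply: measurableX => //; exact: measurableC.
have mG' : measurable (G `&` (~` N0 `*` [set: T])) by exact: measurableI.
(* Removing the base points in [N0] makes the kernel zero there, so the bound holds at every x. *)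
exists n, c, _, mG'; split => //.
  apply: (lt_le_trans PG).
  have mNT : measurable (N0 `*` [set: T]) by exact: measurableX.
  have PN : PP (N0 `*` [set: T]) = 0%E.
    rewrite /semidirect (_ : (fun=> _) = (fun x => (\1_N0 x)%:E)); last first.
      apply/funext => x; rewrite /restr_kernel /= /mrestr [X in _ `&` X](_ : _ = [set: T]); last first.
        by apply/seteqP; split=> // y _; exact/xsectionP.
      rewrite setIT indicE.
      have [xN|xN] := boolP (x \in N0).
        by rewrite in_xsectionX// probability_setT.
      by rewrite notin_xsectionX// measure0.
    by rewrite integral_indic// setIT.
  have := measureU2 PP mG' mNT; rewrite [X in (_ <= _ + X)%E]PN adde0.
  apply: le_trans; apply: le_measure; rewrite ?inE//; first exact: measurableU.
  move=> [x y] Gxy; have [h|h] := pselect (N0 x); first by right.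
  by left.
move=> x A mA; have [Nx|Nx] := pselect (N0 x).
  rewrite [X in fine X](_ : _ = 0%E); first by rewrite mulr0 fine_ge0.
  rewrite /restr_kernel /= /mrestr (_ : A `&` _ = set0) ?measure0//.
  apply/seteqP; split => // y [_ /xsectionP [_ [/=]]]; exact.
have fin : (pi [set: T] < +oo)%E := prob_lty pi.
have c0' : 0 <= c by exact: ltW.
have := hB (mscale (NngNum c0') (restr_kernel pi mG x)) (kernel_iter P n.+1 x) 0 _ _ _ A mA.
have sc U : measurable U -> fine (mscale (NngNum c0') (restr_kernel pi mG x) U) =
    c * fine (restr_kernel pi mG x U).
  by move=> mU; rewrite /mscale /= fineM//; exact: (finite_kernel_measure (restr_kernel pi mG) x).
rewrite sc// addr0 => h; apply: le_trans (h _ _ _).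
- rewrite ler_pM2l//; apply: fine_le.
  + exact: (finite_kernel_measure (restr_kernel pi mG') x).
  + exact: (finite_kernel_measure (restr_kernel pi mG) x).
  + rewrite /restr_kernel /= /mrestr; apply: le_measure; rewrite ?inE.
    * apply: measurableI => //; exact: measurable_xsection.
    * apply: measurableI => //; exact: measurable_xsection.
    * by move=> y [Ay /xsectionP [Gy _]]; split => //; apply/xsectionP.
- rewrite ltey_eq; apply/orP; left; rewrite /mscale /=; apply: fin_numM => //.
  exact: (finite_kernel_measure (restr_kernel pi mG) x).
- by rewrite kernel_iterT ltry.
- move=> i; rewrite sc// addr0.
  have [_ _ /(_ x)] := hE i; rewrite bfunZ !kop_ind//; apply => Eix; apply: Nx; exists i => //.
Qed.

End small_kernel.

(** * The positive remainder as a strict contraction *)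

Section remainder.
Context d (T : measurableType d) (R : realType) (P : R.-pker T ~> T).
Variables (pi : probability T R) (hrev : reversible P pi).
Local Notation I := (bint pi).
Local Notation ip := (bip pi).
Local Notation N := (nrm (bip pi)).
Local Notation V := (bfun T R).
Implicit Types f g h : V.
Let mTT : measurable [set: T * T] := measurableT.
Local Notation PP := (semidirect pi (restr_kernel pi mTT)).
Let ipDl := bipDl (prob_lty pi).
Let ipZl := bipZl (prob_lty pi).
Let ipC := bipC pi.
Let ip0 := bip_diag_ge0 pi.
Let nrmD := nrmD ipC ipDl ipZl ip0.
Let nrmZ := nrmZ ipC ipZl.
Let nrm_ge0 := @nrm_ge0 _ _ ip.
Let Ilin := bint_lin (prob_lty pi).

Variables (n : nat) (c : R) (G : set (T * T)) (mG : measurable G).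
Hypothesis c0 : 0 < c.
Hypothesis PG : (0 < PP G)%E.
Hypothesis small : forall x A, measurable A ->
  c * fine (restr_kernel pi mG x A) <= fine (kernel_iter P n.+1 x A).
Variable r : R.
Hypothesis r01 : 0 < r < 1.
Hypothesis gap : forall f, I f = 0 -> N (kop P f) <= r * N f.
Local Notation K := (kop (restr_kernel pi mG)).
Local Notation S := (kop_iter P n.+1).

Definition remainder f : V := S f - c *: K f.

Lemma remainder_linear : linear remainder.
Proof.
move=> a f g; rewrite /remainder.
have -> : S (a *: f + g) = a *: S f + S g by exact: linearP.
have -> : K (a *: f + g) = a *: K f + K g by exact: linearP.
move: (S f) (S g) (K f) (K g) => u v w z.
by rewrite scalerDr opprD scalerBr !scalerA (mulrC c a) addrACA.
Qed.
HB.instance Definition _ := GRing.isLinear.Build R V V _ remainder remainder_linear.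
Local Notation Q := remainder.

Lemma remainder_ge0 f : (forall x, 0 <= f x) -> forall x, 0 <= Q f x.
Proof.
move=> f0 x; rewrite /remainder bfunB bfunZ subr_ge0 kopE /kop_iter -bint_kernel_iter.
move: f f0; apply: blin_le.
- by move=> a f g; rewrite bint_lin ?fker_lty//; ring.
- by apply: bint_lin; rewrite kernel_iterT ltry.
- have [C hC] := bint_cont (fker_lty (restr_kernel pi mG) x).
  by exists (c * C) => f M /hC h; rewrite normrM gtr0_norm// -mulrA ler_pM2l.
- by apply: bint_cont; rewrite kernel_iterT ltry.
- by move=> A mA; rewrite !bint_ind//; exact: small.
Qed.

Lemma remainder_le f : (forall x, 0 <= f x) -> forall x, Q f x <= S f x.
Proof.
move=> f0 x; rewrite /remainder bfunB bfunZ gerBl mulr_ge0 ?(ltW c0)//.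
exact: kop_ge0.
Qed.

Lemma remainder_mono f g : (forall x, f x <= g x) -> forall x, Q f x <= Q g x.
Proof.
move=> fg x; rewrite -subr_ge0; have := @remainder_ge0 (g - f) _ x.
rewrite [remainder _]linearB bfunB; apply=> y.
by rewrite bfunB subr_ge0.
Qed.

Lemma remainder_abs f g : (forall x, `|f x| <= g x) -> forall x, `|Q f x| <= Q g x.
Proof.
move=> fg x; rewrite ler_norml lerNl; apply/andP; split.
  have := @remainder_mono (- f) g _ x; rewrite [remainder _]linearN; apply => y.
  by rewrite bfunN (le_trans _ (fg y))// -normrN ler_norm.
by apply: remainder_mono => y; rewrite (le_trans _ (fg y))// ler_norm.
Qed.

Lemma iter_remainder_abs j f g : (forall x, `|f x| <= g x) ->
  forall x, `|iter j Q f x| <= iter j Q g x.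
Proof. by move=> fg; elim: j => //= j IH; exact: remainder_abs. Qed.

(** The integral is c (pi x pi)(G), the mass lost by the remainder. *)
Let K1 : 0 < I (c *: K (bcst T 1)).
Proof.
rewrite (blinZ _ _ Ilin) mulr_gt0//.
have := semidirectX pi (restr_kernel pi mG) measurableT measurableT.
have -> : bind R [set: T] = bcst T 1.
  by apply/bfunP => x; rewrite bind_in// bcstE.
rewrite bip1 semidirect_restr; last exact: measurableX.
move=> h; rewrite -lte_fin -h.
by rewrite (_ : [set: T] `*` [set: T] = setT) ?setTI//; apply/seteqP; split => // -[].
Qed.

(** The kernel has density at most 1 against pi, so the value at any point is at most the L_1 norm,
    hence the L_2 norm. This turns norm decay into uniform decay. *)
Lemma K_bound f x : `|(c *: K f) x| <= c * N f.
Proof.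
rewrite bfunZ normrM gtr0_norm// ler_pM2l// kopE.
apply: le_trans (bint_abs (fker_lty _ x) _) _.
apply: (@le_trans _ _ (I (babs f))); last first.
  by rewrite -(nrm_babs pi f); apply: le_trans (ler_norm _) (bint_le_nrm _ _).
have : forall y, 0 <= babs f y by move=> y; rewrite babsE.
move: (babs f); apply: blin_le.
- by apply: bint_lin; exact: fker_lty.
- exact: Ilin.
- by apply: bint_cont; exact: fker_lty.
- by apply: bint_cont; exact: prob_lty.
- move=> A mA; rewrite !bint_ind//; apply: fine_le.
  + exact: (finite_kernel_measure (restr_kernel pi mG) x).
  + exact: fin_num_measure.
  + rewrite /restr_kernel /= /mrestr; apply: le_measure; rewrite ?inE//.
    by apply: measurableI => //; exact: measurable_xsection.
Qed.

Lemma gap_iter k f : I f = 0 -> N (iter k (kop P) f) <= r ^+ k * N f.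
Proof.
move=> If; elim: k => [|k IH]; first by rewrite expr0 mul1r.
rewrite iterS exprS -mulrA; apply: le_trans (gap _) _; first by rewrite iter_kop_inv.
by rewrite ler_wpM2l// ltW//; case/andP: r01.
Qed.

(* Write f = a + g with g of mean zero. If g carries a fixed proportion of the
   norm, the gap makes P^(n+1) contract; otherwise f is close to the constant
   a, whose image has smaller norm because the remainder has lost mass. *)
Lemma remainder_contraction : exists2 q, 0 < q < 1 & forall f, N (Q f) <= q * N f.
Proof.
have /andP[r0 r1] := r01.
set dl := I (c *: K (bcst T 1)); have dl0 : 0 < dl := K1.
pose s : R := Num.sqrt (1 - dl).
have one_le x : S (bcst T 1) x = 1 by rewrite /kop_iter iter_kop_cst bcstE.
have Q1 x : 0 <= Q (bcst T 1) x <= 1.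
  rewrite remainder_ge0 ?andTb => [|y]; last by rewrite bcstE.
  by rewrite -[leRHS](one_le x) remainder_le// => y; rewrite bcstE.
have IQ1 : I (Q (bcst T 1)) = 1 - dl.
  by rewrite /remainder (blinB _ _ Ilin) /kop_iter iter_kop_cst pint_cst.
have s1 : s < 1.
  by rewrite /s -[ltRHS]sqrtr1 ltr_sqrt// gtrBl.
have s0 : 0 <= s by exact: sqrtr_ge0.
(* Q 1 lies between 0 and 1, so its square integrates to at most I(Q 1) = 1 - dl. *)
have NQ1 : N (Q (bcst T 1)) <= s.
  apply: ler_wsqrtr; rewrite -IQ1; apply: (bint_mono (prob_lty pi)) => x.
  by have /andP[h0 h1] := Q1 x; rewrite bmulE ler_piMl.
(* The threshold for |g|/|f|: below it |Q f| <= (s + e)|f| with s + e < 1; above it |P^(n+1) f|^2 <=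
   b |f|^2. *)
pose e := (1 - s) / 2.
have e0 : 0 < e by rewrite divr_gt0// subr_gt0.
have e1 : e < 1 by rewrite /e; lra.
pose b := 1 - (1 - r ^+ 2) * e ^+ 2.
have r21 : r ^+ 2 < 1 by rewrite expr_lt1// ltW.
have e21 : e ^+ 2 < 1 by rewrite expr_lt1// ltW.
have b1 : b < 1 by rewrite gtrBl mulr_gt0 ?exprn_gt0// subr_gt0.
have b0 : 0 < b.
  rewrite subr_gt0; apply: le_lt_trans (_ : _ <= e ^+ 2) e21.
  by rewrite ler_piMl ?sqr_ge0// gerBl sqr_ge0.
have sb1 : Num.sqrt b < 1 by rewrite -[ltRHS]sqrtr1 ltr_sqrt.
pose q := Num.max (s + e) (Num.sqrt b).
have pos f : (forall x, 0 <= f x) -> N (Q f) <= q * N f.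
  move=> f0; pose a := I f; pose g := f - bcst T a.
  have a0 : 0 <= a by exact: bint_ge0.
  have Ig : I g = 0 by rewrite (blinB _ _ Ilin) pint_cst subrr.
  have fE : f = a *: bcst T 1 + g.
    by apply/bfunP => x; rewrite bfunD bfunZ bfunB !bcstE mulr1 addrC subrK.
  have balance (X Y Z A rr ee : R) : X = A + Y -> Z <= rr * Y ->
      (1 - rr) * (ee * X) <= (1 - rr) * Y -> A + Z <= (1 - (1 - rr) * ee) * X.
    by move=> -> hZ; rewrite mulrA mulrBl mul1r => h; lra.
  have pyth (u : V) : I u = 0 -> ip (a *: bcst T 1 + u) (a *: bcst T 1 + u) = a ^+ 2 + N u ^+ 2.
    move=> u0; rewrite ipDl ipZl !(ipC _ (_ + _)) !ipDl !ipZl nrm_sq//.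
    have h : ip u (bcst T 1) = 0 by rewrite bip1.
    rewrite (ipC (bcst T 1) u) h bip1 pint_cst; ring.
  have Nf2 : N f ^+ 2 = a ^+ 2 + N g ^+ 2 by rewrite nrm_sq// [in LHS]fE pyth.
  have af : a <= N f.
    rewrite -(@ler_pXn2r _ 2) ?nnegrE ?nrm_ge0// Nf2 lerDl sqr_ge0//.
  have le_q (x : R) : 0 <= x -> x <= s + e \/ x <= Num.sqrt b -> x * N f <= q * N f.
    by move=> x0 hx; rewrite ler_wpM2r ?nrm_ge0// le_max; apply/orP.
  have Sle (u v : V) : (forall x, `|u x| <= v x) -> N (Q u) <= N (S v).
    move=> uv; apply: nrm_mono; first exact: prob_lty.
    move=> x; apply: le_trans (remainder_abs uv x) _; apply: remainder_le => y.
    exact: le_trans (uv y).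
  have Ng : N (Q g) <= N g.
    rewrite -[leRHS]nrm_babs; apply: le_trans (Sle _ (babs g) _) _ => [x|].
      by rewrite babsE.
    exact: iter_kop_contraction.
  have [ge|ge] := leP (N g) (e * N f).
    apply: (@le_trans _ _ ((s + e) * N f)).
      2: by apply: le_q; [rewrite addr_ge0// ltW|left].
    rewrite fE [remainder _]linearD /= [remainder (_ *: _)]linearZ /= -fE.
    apply: le_trans (nrmD _ _) _; rewrite mulrDl lerD//; last exact: le_trans ge.
    by rewrite nrmZ ger0_norm// mulrC ler_pM// nrm_ge0.
  apply: (@le_trans _ _ (Num.sqrt b * N f)).
    2: by apply: le_q; [exact: sqrtr_ge0|right].
  rewrite -(@ler_pXn2r _ 2) ?nnegrE ?mulr_ge0 ?nrm_ge0 ?sqrtr_ge0//.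
  rewrite exprMn (sqr_sqrtr (ltW b0)).
  have h1 : N (Q f) ^+ 2 <= N (S f) ^+ 2.
    rewrite ler_pXn2r ?nnegrE ?nrm_ge0// Sle// => x.
    by rewrite ger0_norm.
  apply: (le_trans h1).
  have Sg : N (S g) <= r * N g.
    apply: le_trans (gap_iter n.+1 Ig) _; rewrite ler_wpM2r ?nrm_ge0// exprS.
    by rewrite ler_piMr ?(ltW r0)// exprn_ile1// ltW.
  have -> : N (S f) ^+ 2 = a ^+ 2 + N (S g) ^+ 2.
    have -> : S f = a *: bcst T 1 + S g.
      have h : S (a *: bcst T 1 + g) = a *: S (bcst T 1) + S g by exact: linearP.
      have S1 : S (bcst T 1) = bcst T 1 by exact: iter_kop_cst.
      by rewrite -fE S1 in h.
    by rewrite nrm_sq// pyth// /kop_iter iter_kop_inv.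
  have h2 : N (S g) ^+ 2 <= r ^+ 2 * N g ^+ 2.
    by rewrite -exprMn ler_pXn2r ?nnegrE ?mulr_ge0 ?nrm_ge0// ltW.
  have h3 : e ^+ 2 * N f ^+ 2 <= N g ^+ 2.
    rewrite -exprMn; apply: lerXn2r; rewrite ?nnegrE; last exact: ltW.
      by rewrite mulr_ge0 ?(ltW e0)// nrm_ge0.
    exact: nrm_ge0.
  have h4 : (1 - r ^+ 2) * (e ^+ 2 * N f ^+ 2) <= (1 - r ^+ 2) * N g ^+ 2.
    by rewrite ler_wpM2l// subr_ge0 ltW.
  exact: balance Nf2 h2 h4.
exists q.
  apply/andP; split; first by rewrite lt_max sqrtr_gt0 b0 orbT.
  by rewrite gt_max sb1 andbT /e; lra.
move=> f; rewrite -[in leRHS](nrm_babs pi f); apply: le_trans (pos (babs f) _).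
  by apply: nrm_mono; [exact: prob_lty|apply: remainder_abs => x; rewrite babsE].
by move=> x; rewrite babsE.
Qed.

End remainder.

(** * Pointwise geometric rates *)

Section rate.
Context d (T : measurableType d) (R : realType) (P : R.-pker T ~> T).
Variables (pi : probability T R) (hrev : reversible P pi).
Local Notation I := (bint pi).
Local Notation ip := (bip pi).
Local Notation N := (nrm (bip pi)).
Local Notation V := (bfun T R).
Implicit Types f g h : V.
Let mTT : measurable [set: T * T] := measurableT.
Local Notation PP := (semidirect pi (restr_kernel pi mTT)).
Let nrm_ge0 := @nrm_ge0 _ _ ip.

Section remainder_expansion.
Variables (n : nat) (c : R) (G : set (T * T)) (mG : measurable G).
Hypothesis c0 : 0 < c.
Hypothesis PG : (0 < PP G)%E.
Hypothesis small : forall x A, measurable A ->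
  c * fine (restr_kernel pi mG x A) <= fine (kernel_iter P n.+1 x A).
Variable r : R.
Hypothesis r01 : 0 < r < 1.
Hypothesis gap : forall f, I f = 0 -> N (kop P f) <= r * N f.
Local Notation K := (kop (restr_kernel pi mG)).
Local Notation S := (kop_iter P n.+1).
Local Notation Q := (remainder P pi n c mG).

(** A Duhamel formula for powers of S = Q + c K. *)
Lemma remainder_expansion k f :
  iter k S f = iter k Q f + \sum_(j < k) iter j Q (c *: K (iter (k - j.+1) S f)).
Proof.
elim: k f => [|k IH] f; first by rewrite big_ord0 addr0.
have iterQD i u v : iter i Q (u + v) = iter i Q u + iter i Q v.
  by elim: i => //= i ->; rewrite [remainder _ _ _ _ _ _]linearD.
have E : iter k Q (S f) = iter k.+1 Q f + iter k Q (c *: K f).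
  by rewrite iterSr -iterQD /remainder subrK.
have swap (u v w : V) : u + v + w = u + (w + v) by rewrite -addrA (addrC v).
rewrite iterSr IH E big_ord_recr subnn swap; congr (_ + (_ + _)).
by apply: eq_bigr => j _; rewrite -iterSr -subSn.
Qed.

(** In each term [gap] makes the inner power decay in norm, [K_bound] turns this into a uniform
    bound, and Q^j of a constant is at most a multiple of W q^j at [x]. Nothing depends on [h], so
    one null set will serve all events. *)
Lemma remainder_bound q x W : r < q -> 0 <= W ->
  (forall j, iter j Q (bcst T 1) x <= W * q ^+ j) ->
  forall k h, (forall y, `|h y| <= 1) -> I h = 0 ->
  `|iter k S h x| <= W * (1 + c / (q - r)) * q ^+ k.
Proof.
move=> rq W0 hW k h h1 Ih; have /andP[r0 r1] := r01.
have qr0 : 0 < q - r by rewrite subr_gt0.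
have Q0 j : 0 <= iter j Q (bcst T 1) x.
  have /(iter_remainder_abs c0 small j)/(_ x) : forall y, `|bcst T 1 y| <= bcst T (1 : R) y.
    by move=> y; rewrite bcstE normr1.
  exact: le_trans.
have Nh : N h <= 1.
  rewrite -(nrm1 pi); apply: nrm_mono; first exact: prob_lty.
  by move=> y; rewrite bcstE.
rewrite remainder_expansion bfunD bfun_sum.
apply: le_trans (ler_normD _ _) _.
rewrite mulrDr mulr1 mulrDl lerD//.
  apply: le_trans (hW k); apply: (iter_remainder_abs c0 small) => y.
  by rewrite bcstE.
have term (j : 'I_k) : `|iter j Q (c *: K (iter (k - j.+1) S h)) x| <=
    W * c * (r ^+ (k - j.+1) * q ^+ j).
  set u := c *: K _; pose b := c * r ^+ (k - j.+1).
  have b0 : 0 <= b by rewrite mulr_ge0 ?exprn_ge0// ltW.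
  have ub y : `|u y| <= (b *: bcst T 1) y.
    rewrite (bfunZ b) bcstE mulr1; apply: le_trans (K_bound pi mG c0 _ y) _.
    rewrite ler_pM2l// iter_kop_iter; apply: le_trans (gap_iter hrev r01 gap _ Ih) _.
    apply: (@le_trans _ _ (r ^+ ((k - j.+1) * n.+1))).
      by rewrite ler_piMr// exprn_ge0// ltW.
    by apply: ler_wiXn2l; rewrite ?ltW// leq_pmulr.
  apply: le_trans (iter_remainder_abs c0 small j ub x) _.
  have -> : iter j Q (b *: bcst T 1) = b *: iter j Q (bcst T 1).
    by elim: (nat_of_ord j) => //= i ->; rewrite [remainder _ _ _ _ _ _]linearZ.
  rewrite bfunZ; apply: le_trans (ler_wpM2l b0 (hW j)) _.
  by rewrite /b le_eqVlt; apply/orP; left; apply/eqP; ring.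
apply: le_trans (ler_norm_sum _ _ _) _.
apply: le_trans (ler_sum _ (fun j _ => term j)) _.
rewrite -mulr_sumr.
(* The sum is (q^k - r^k)/(q - r). *)
have : (q - r) * \sum_(i < k) r ^+ (k - i.+1) * q ^+ i <= q ^+ k.
  rewrite (_ : (q - r) * _ = q ^+ k - r ^+ k).
    by rewrite gerBl exprn_ge0// ltW.
  rewrite -[RHS]opprB subrXX -mulNr opprB; congr (_ * _); apply: eq_bigr => i _.
  by rewrite subnS -subn1 subnAC subn1.
rewrite mulrC -ler_pdivlMr// => h2.
rewrite [leRHS](_ : _ = W * c * (q ^+ k / (q - r))); last by field; rewrite gt_eqF.
by rewrite ler_wpM2l// mulr_ge0// ltW.
Qed.

End remainder_expansion.

Variable psi : {measure set T -> \bar R}.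
Hypothesis psiT : (psi [set: T] != 0)%E.
Hypothesis irr : forall A, measurable A -> (0 < psi A)%E ->
    forall x, \forall n \near \oo, (0 < kernel_iter P n x A)%E.

(** [geometric_ae] applied to the iterates of the remainder on 1 supplies the weight [W];
    [exists_root] then converts the rate for P^(n+1) into a rate for P. *)
Lemma gap_pointwise r : countably_generated T -> 0 < r < 1 ->
  (forall f, I f = 0 -> N (kop P f) <= r * N f) ->
  exists2 q, 0 < q < 1 & {ae pi, forall x, exists2 W, 0 <= W &
    forall n h, (forall y, `|h y| <= 1) -> I h = 0 ->
      `|iter n (kop P) h x| <= W * q ^+ n}.
Proof.
move=> hT r01 gap; have /andP[r0 r1] := r01.
have [n [c [G [mG [c0 PG small]]]]] := exists_small_kernel hrev psiT irr hT.
have [t /andP[t0 t1] ht] := remainder_contraction hrev c0 PG small r01 gap.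
pose Q := remainder P pi n c mG.
(* [p] bounds both contraction rates; [q] is strictly between [p] and 1, as [geometric_ae] loses a
   little. *)
pose p := Num.max r t; pose q := (1 + p) / 2.
have p1 : p < 1 by rewrite /p gt_max r1.
have p0 : 0 < p by rewrite /p lt_max r0.
have pq : p < q by rewrite /q; lra.
have q1 : q < 1 by rewrite /q; lra.
have q0 : 0 < q by exact: lt_trans pq.
have rq : r < q by apply: le_lt_trans pq; rewrite /p le_max lexx.
have Q0 j x : 0 <= iter j Q (bcst T 1) x.
  have /(iter_remainder_abs c0 small j)/(_ x) : forall y, `|bcst T 1 y| <= bcst T (1 : R) y.
    by move=> y; rewrite bcstE normr1.
  exact: le_trans.
have [s /andP[s0 s1] qs] := @exists_root _ q n.+1 (introT andP (conj (ltW q0) q1)) (ltn0Sn n).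
exists s; first by rewrite s0.
have hae := @geometric_ae _ _ _ pi (fun j => iter j Q (bcst T 1) : T -> R) 1 p q.
have {}hae : {ae pi, forall x, exists2 W, 0 <= W &
    forall j, iter j Q (bcst T 1) x <= W * q ^+ j}.
  apply: hae => //.
  - by move=> j; exact: bfun_measurable.
  - move=> j; rewrite -bintE ?prob_lty// lee_fin mul1r; apply: le_trans (ler_norm _) _.
    apply: le_trans (bint_le_nrm _ _) _.
    elim: j => [|j IH]; first by rewrite expr0 /= nrm1.
    rewrite iterS exprS; apply: le_trans (ht _) _.
    apply: ler_pM; [exact: ltW|exact: nrm_ge0| |exact: IH].
    by rewrite /p le_max lexx orbT.
  - by rewrite ltW.
apply: filterS hae => x [W W0 hW].
pose W' := W * (1 + c / (q - r)).
have W'0 : 0 <= W' by rewrite mulr_ge0// addr_ge0// divr_ge0 ?subr_ge0 ?(ltW c0) ?(ltW rq).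
exists (W' / s ^+ n.+1); first by rewrite divr_ge0// exprn_ge0// ltW.
move=> k h h1 Ih.
have -> : iter k (kop P) h =
    iter (k %/ n.+1) (kop_iter P n.+1) (iter (k %% n.+1) (kop P) h).
  by rewrite iter_kop_iter -iterD -divn_eq.
apply: le_trans (remainder_bound c0 small r01 gap rq W0 hW _ _ _) _.
- by move=> y; exact: iter_kop_bound.
- by rewrite iter_kop_inv.
rewrite -/W' -[leRHS]mulrA ler_wpM2l// mulrC ler_pdivlMr ?exprn_gt0//.
apply: (@le_trans _ _ ((s ^+ n.+1) ^+ (k %/ n.+1) * s ^+ n.+1)).
  rewrite ler_wpM2r ?exprn_ge0 ?(ltW s0)//; apply: lerXn2r => //; rewrite nnegrE ltW//.
  exact: exprn_gt0.
rewrite -exprM -exprD; apply: ler_wiXn2l; rewrite ?ltW//.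
by rewrite [X in (X <= _)%N](divn_eq k n.+1) mulnC leq_add2l ltnW// ltn_pmod.
Qed.

(** The total variation bound is [gap_pointwise] for the functions 1_A - pi(A). *)
Lemma gap_geometrically_ergodic r : countably_generated T -> 0 < r < 1 ->
  (forall f, I f = 0 -> N (kop P f) <= r * N f) -> geometrically_ergodic P.
Proof.
move=> hT r01 gap; have [q q01 hq] := gap_pointwise hT r01 gap.
have /andP[q0 q1] := q01.
exists (pi : {measure set T -> \bar R}); split.
- by rewrite [X in X != _]probability_setT onee_eq0.
- move=> A mA; rewrite -[RHS]fineK; last exact: fin_num_measure.
  rewrite -bint_ind// -(kop_inv hrev) bintE ?prob_lty//.
  apply: eq_integral => x _; rewrite kop_ind// fineK//.
  exact: (finite_kernel_measure P x).
pose D x := exists2 W, 0 <= W & forall n h, (forall y, `|h y| <= 1) -> I h = 0 ->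
      `|iter n (kop P) h x| <= W * q ^+ n.
have [C hC] : exists C : T -> R, forall x, 1 <= C x /\ (D x ->
    forall n h, (forall y, `|h y| <= 1) -> I h = 0 -> `|iter n (kop P) h x| <= C x * q ^+ n).
  suff h x : exists C, 1 <= C /\ (D x -> forall n h, (forall y, `|h y| <= 1) -> I h = 0 ->
      `|iter n (kop P) h x| <= C * q ^+ n).
    by exists (fun x => sval (cid (h x))) => x; case: (cid _).
  (* Outside the set of full measure the constant is irrelevant and is set to 1. *)
  have [[W W0 hW]|nD] := pselect (D x); last by exists 1.
  exists (1 + W); split; first by rewrite lerDl.
  move=> _ n h h1 Ih; apply: le_trans (hW n h h1 Ih) _.
  by rewrite ler_wpM2r ?exprn_ge0 ?(ltW q0)// lerDr.
exists (fun=> q), C; split => // [x|]; first by have [] := hC x.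
apply: filterS hq => x Dx n; apply: ub_ereal_sup => _ [A mA <-].
pose h := bind R A - bcst T (fine (pi A)).
have Ih : I h = 0 by rewrite (blinB _ _ (bint_lin (prob_lty pi))) pint_cst bint_ind// subrr.
have h1 y : `|h y| <= 1.
  rewrite bfunB bcstE; have := bind_ge0 R y mA; have := bind_le1 R y mA.
  have := pr_le1 pi mA; have := pr_ge0 pi A.
  by rewrite ler_norml => *; apply/andP; split; lra.
have [_ /(_ Dx n h h1 Ih)] := hC x.
rewrite /h iter_kopB iter_kop_cst bfunB bcstE => hh.
rewrite kernel_iterE// [X in (_ - X)%E](_ : _ = (fine (pi A))%:E); last first.
  by rewrite fineK//; exact: fin_num_measure.
rewrite -EFinB abse_EFin lee_fin.
exact: hh.
Qed.

End rate.

Lemma le_geometric_le0 (R : realType) (x D q : R) :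
  0 <= q < 1 -> (forall k, x <= D * q ^+ k) -> x <= 0.
Proof.
move=> /andP[q0 q1] h; rewrite leNgt; apply/negP => x0.
have := @cvg_geometric R D q; rewrite ger0_norm// => /(_ q1)/cvgr_lt/(_ _ x0)[k _ /(_ k (leqnn k))].
by rewrite /= ltNge h.
Qed.

(** * Resolvent of an operator contracting the mean zero vectors *)

Section resolvent.
Variables (R : realType) (W : lmodType R[i]) (n : W -> R).
Hypothesis nZ : forall a u, n (a *: u) = normc a * n u.
Hypothesis nD : forall u v, n (u + v) <= n u + n v.

Lemma seminorm0 : n 0 = 0.
Proof. by rewrite -(scale0r (0 : W)) nZ normc0 mul0r. Qed.

Lemma seminormN u : n (- u) = n u.
Proof. by rewrite -scaleN1r nZ normcN normc1 mul1r. Qed.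

Lemma seminorm_ge0 u : 0 <= n u.
Proof.
have := nD u (- u); rewrite subrr seminorm0 seminormN -mulr2n pmulrn_lge0//.
Qed.

Lemma seminormB u v : n (u - v) <= n u + n v.
Proof. by rewrite -(seminormN v). Qed.

Lemma seminorm_dist u v w : n (u - w) <= n (u - v) + n (v - w).
Proof. by apply: le_trans (nD _ _); rewrite addrA subrK. Qed.

Lemma seminorm_null u v : n v = 0 -> n (u + v) = n u.
Proof.
move=> v0; apply/eqP; rewrite eq_le; apply/andP; split.
  by apply: le_trans (nD _ _) _; rewrite v0 addr0.
by rewrite -{1}(addrK v u) (le_trans (seminormB _ _))// v0 addr0.
Qed.

Lemma seminorm_eq u v : n (u - v) = 0 -> n u = n v.
Proof. by move=> h; rewrite -{1}(subrK v u) addrC seminorm_null. Qed.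

Lemma seminorm_sum k (F : 'I_k -> W) : n (\sum_(i < k) F i) <= \sum_(i < k) n (F i).
Proof.
elim/big_ind2: _ => [|x1 x2 y1 y2 h1 h2|//]; first by rewrite seminorm0.
by rewrite (le_trans (nD _ _))// lerD.
Qed.

Variable P : W -> W.
Hypothesis Plin : forall a u v, n (P (a *: u + v) - (a *: P u + P v)) = 0.
Hypothesis Ple : forall u, n (P u) <= n u.
Hypothesis complete : forall (u : nat -> W) D q, 0 <= q < 1 ->
  (forall k, n (u k.+1 - u k) <= D * q ^+ k) ->
  exists w D', forall k, n (w - u k) <= D' * q ^+ k.
Variables (m : W -> R[i]) (e : W) (r : R).
Hypothesis mlin : forall a u v, m (a *: u + v) = a * m u + m v.
Hypothesis mle : forall u, normc (m u) <= n u.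
Hypothesis mP : forall u, m (P u) = m u.
Hypothesis me : m e = 1.
Hypothesis ne : n e = 1.
Hypothesis Pe : n (P e - e) = 0.
Hypothesis r01 : 0 < r < 1.
Hypothesis gap : forall u, m u = 0 -> n (P u) <= r * n u.

Let r0 : 0 < r. Proof. by case/andP: r01. Qed.
Let r1 : r < 1. Proof. by case/andP: r01. Qed.

Let m0 : m 0 = 0.
Proof. by have := mlin (-1) 0 0; rewrite scaler0 addr0 mulN1r addNr. Qed.
Let mZ a u : m (a *: u) = a * m u.
Proof. by rewrite -[_ *: _]addr0 mlin m0 addr0. Qed.
Let mD u v : m (u + v) = m u + m v.
Proof. by rewrite -[u]scale1r mlin mul1r scale1r. Qed.
Let mB u v : m (u - v) = m u - m v.
Proof. by rewrite mD -scaleN1r mZ mulN1r. Qed.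


Local Notation "u =~ v" := (n (u - v) = 0) (at level 70).

Let eqvC u v : u =~ v -> v =~ u.
Proof. by rewrite -opprB seminormN. Qed.

Let eqv_trans v u w : u =~ v -> v =~ w -> u =~ w.
Proof.
move=> h1 h2; apply/eqP; rewrite eq_le seminorm_ge0 andbT.
by apply: le_trans (seminorm_dist _ v _) _; rewrite h1 h2 addr0.
Qed.

Let eqvD u v u' v' : u =~ u' -> v =~ v' -> u + v =~ u' + v'.
Proof. by move=> h1 h2; rewrite opprD addrACA seminorm_null. Qed.

Let eqvZ a u v : u =~ v -> a *: u =~ a *: v.
Proof. by move=> h; rewrite -scalerBr nZ h mulr0. Qed.

Let eqvB u v u' v' : u =~ u' -> v =~ v' -> u - v =~ u' - v'.
Proof. by move=> h1 h2; apply: eqvD => //; rewrite -opprD seminormN. Qed.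

Let PB u v : P (u - v) =~ P u - P v.
Proof.
have := Plin (-1) v u; rewrite !scaleN1r => h.
by rewrite (addrC u) (addrC (P u)).
Qed.

Let PZ a u : P (a *: u) =~ a *: P u.
Proof.
have P0 : n (P 0) = 0.
  by apply/eqP; rewrite eq_le seminorm_ge0 andbT (le_trans (Ple _))// seminorm0.
have := Plin a u 0; rewrite addr0 => h; apply: eqv_trans h _.
by rewrite addrAC subrr add0r.
Qed.

Let subACA (x y z t : W) : x - y - (z - t) = x - z - (y - t).
Proof. by rewrite !opprB (addrC t) addrACA (addrC (- y)). Qed.

(** Identities for it hold up to vectors of seminorm zero, because an integral kernel acts linearly
    only up to null sets. *)
Definition pencil z u : W := z *: u - P u.

Lemma pencilB z u v : pencil z (u - v) =~ pencil z u - pencil z v.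
Proof.
rewrite /pencil scalerBr [X in n (_ - X)]subACA.
by apply: eqvB; [rewrite subrr seminorm0|exact: PB].
Qed.

Lemma pencilZ z a u : pencil z (a *: u) =~ a *: pencil z u.
Proof.
rewrite /pencil scalerBr !scalerA mulrC.
by apply: eqvB; [rewrite subrr seminorm0|exact: PZ].
Qed.

Lemma pencilD z u v : pencil z (u + v) =~ pencil z u + pencil z v.
Proof.
rewrite -{1}[v]opprK; apply: eqv_trans (pencilB z u (- v)) _.
rewrite -[pencil z v]opprK; apply: eqvB; first by rewrite subrr seminorm0.
by rewrite -scaleN1r -(scaleN1r (pencil z v)); exact: pencilZ.
Qed.

Lemma pencil_le z u : n (pencil z u) <= (normc z + 1) * n u.
Proof.
apply: le_trans (seminormB _ _) _; rewrite nZ mulrDl mul1r lerD2l; exact: Ple.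
Qed.

Lemma mean_pencil z u : m (pencil z u) = (z - 1) * m u.
Proof. by rewrite /pencil mB mZ mP mulrBl mul1r. Qed.

Lemma pencil_lower0 z g : m g = 0 -> (normc z - r) * n g <= n (pencil z g).
Proof.
move=> mg; rewrite mulrBl lerBlDr -nZ -[z *: g](subrK (P g)).
by apply: le_trans (nD _ _) _; rewrite lerD2l gap.
Qed.

Lemma iter_mean0 k w : m w = 0 -> m (iter k P w) = 0.
Proof. by move=> mw; elim: k => //= k IH; rewrite mP. Qed.

Lemma iter_gap k w : m w = 0 -> n (iter k P w) <= r ^+ k * n w.
Proof.
move=> mw; elim: k => [|k IH]; first by rewrite expr0 mul1r.
rewrite iterS exprS -mulrA; apply: le_trans (gap _) _; first exact: iter_mean0.
by rewrite ler_wpM2l// ltW.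
Qed.

(** Neumann series: the sum of z^(-j-1) P^j w converges at rate r/|z|. *)
Lemma pencil_surj0 z w : r < normc z -> m w = 0 -> exists2 g, m g = 0 & pencil z g =~ w.
Proof.
move=> rz mw; have z0 : 0 < normc z by exact: lt_trans rz.
have zN0 : z != 0 by apply: contraTneq z0 => ->; rewrite normc0 ltxx.
pose q := r / normc z.
have q01 : 0 <= q < 1.
  by rewrite divr_ge0 ?ltW// ltr_pdivrMr// mul1r.
pose u k := \sum_(j < k) z ^- j.+1 *: iter j P w.
have nX k : normc (z ^- k) = (normc z) ^- k.
  rewrite normcV; congr (_^-1); elim: k => [|k IH]; first by rewrite !expr0 normc1.
  by rewrite !exprS normcM IH.
have uS k : u k.+1 = u k + z ^- k.+1 *: iter k P w by rewrite /u big_ord_recr.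
have mu k : m (u k) = 0.
  by elim: k => [|k IH]; rewrite ?uS ?mD ?IH ?mZ ?iter_mean0 ?mulr0 ?addr0// /u big_ord0.
have step k : n (z ^- k *: iter k P w) <= n w * q ^+ k.
  rewrite nZ nX /q expr_div_n mulrA [leRHS]mulrC [n w * _]mulrC.
  by rewrite ler_wpM2l ?invr_ge0 ?exprn_ge0 ?(ltW z0)// iter_gap.
have [k|g [D hD]] := complete (u := u) (D := (normc z)^-1 * n w) q01.
  rewrite uS addrAC subrr add0r exprS invfM -scalerA nZ normcV -mulrA.
  by rewrite ler_wpM2l ?invr_ge0 ?(ltW z0).
have pu k : pencil z (u k) =~ w - z ^- k *: iter k P w.
  elim: k => [|k IH].
    rewrite expr0 invr1 scale1r subrr subr0 /u big_ord0.
    by apply/eqP; rewrite eq_le seminorm_ge0 andbT (le_trans (pencil_le _ _))// seminorm0 mulr0.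
  rewrite uS; apply: eqv_trans (pencilD _ _ _) _.
  apply: eqv_trans (eqvD IH (pencilZ _ _ _)) _.
  rewrite /pencil scalerBr scalerA exprS invfM -mulrA mulrCA mulVf// mulr1.
  by rewrite addrA subrK subrr seminorm0.
have mg : m g = 0.
  apply: (@eq0_normc R); apply/eqP; rewrite eq_le; apply/andP; split.
    apply: (@le_geometric_le0 _ _ D q) => // k; apply: le_trans (hD k).
    by rewrite -[m g]subr0 -(mu k) -mB.
  by case: (m g) => a b; exact: sqrtr_ge0.
exists g => //; apply/eqP; rewrite eq_le seminorm_ge0 andbT.
apply: (@le_geometric_le0 _ _ ((normc z + 1) * D + n w) q) => // k.
apply: le_trans (seminorm_dist _ (pencil z (u k)) _) _; rewrite mulrDl lerD//.
  rewrite -(seminorm_eq (pencilB _ _ _)); apply: le_trans (pencil_le _ _) _.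
  rewrite -mulrA ler_wpM2l// addr_ge0// ltW//.
rewrite (_ : n _ = n (z ^- k *: iter k P w)) //.
rewrite -(seminormN (z ^- k *: _)); apply: seminorm_eq.
by rewrite opprK -addrA [- w + _]addrC -opprB.
Qed.

Lemma pencil_unit z : pencil z e =~ (z - 1) *: e.
Proof.
rewrite scalerBl scale1r; apply: eqvB => //.
by rewrite subrr seminorm0.
Qed.

Lemma pencil_surj z w : r < normc z -> z != 1 -> exists g, pencil z g =~ w.
Proof.
move=> rz z1; have mw : m (w - m w *: e) = 0 by rewrite mB mZ me mulr1 subrr.
have [g mg hg] := pencil_surj0 rz mw.
exists (g + (m w / (z - 1)) *: e); apply: eqv_trans (pencilD _ _ _) _.
rewrite -[w in _ - w](subrK (m w *: e)); apply: eqvD => //.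
apply: eqv_trans (pencilZ _ _ _) _.
apply: eqv_trans (eqvZ _ (pencil_unit z)) _.
by rewrite scalerA divfK ?subr_eq0// subrr seminorm0.
Qed.

(** The mean of [g] is controlled through [mean_pencil], the mean zero part through
    [pencil_lower0]. *)
Lemma pencil_lower z : r < normc z -> z != 1 ->
  exists M, forall g, n g <= M * n (pencil z g).
Proof.
move=> rz z1; have zr0 : 0 < normc z - r by rewrite subr_gt0.
exists ((normc z - r)^-1 * 2 + normc (z - 1)^-1) => g.
set a := m g; set h := g - a *: e.
have mpg : normc ((z - 1) * a) <= n (pencil z g) by rewrite -mean_pencil.
have mh : m h = 0 by rewrite mB mZ me mulr1 subrr.
have -> : g = h + a *: e by rewrite subrK.
apply: le_trans (nD _ _) _; rewrite subrK mulrDl; apply: lerD; last first.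
  rewrite nZ ne mulr1 -[a in leLHS](mulKf (_ : z - 1 != 0)) ?subr_eq0// normcM.
  by rewrite ler_wpM2l//; case: ((z - 1)^-1) => x y; exact: sqrtr_ge0.
rewrite -mulrA ler_pdivlMl//; apply: le_trans (pencil_lower0 _ mh) _.
rewrite (seminorm_eq (pencilB _ _ _)); apply: le_trans (seminormB _ _) _.
rewrite mulr_natl mulr2n lerD2l (seminorm_eq (pencilZ _ _ _)) nZ.
by rewrite (seminorm_eq (pencil_unit _)) nZ ne mulr1 -normcM mulrC.
Qed.

(* (z - P) s_K = F - (1 - z)^K t_K for the partial sum s_K below *)
Lemma pencil_expansion z (t : nat -> W) F g K :
  normc (1 - z) <= (1 - r) / 2 -> m F = 0 -> t 0%N = F ->
  (forall k, m (t k) = 0) -> (forall k, pencil 1 (t k.+1) =~ t k) ->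
  m g = 0 -> pencil z g =~ F ->
  n (g - \sum_(k < K) (1 - z) ^+ k *: t k.+1) <= 2 / (1 - r) * n F * 2^-1 ^+ K.
Proof.
move=> hz mF t0 mt ht mg hg.
have r1' : 0 < 1 - r by rewrite subr_gt0.
have tn k : n (t k) <= n F / (1 - r) ^+ k.
  elim: k => [|k IH]; first by rewrite t0 expr0 divr1.
  rewrite exprS invfM mulrCA ler_pdivlMl//; apply: le_trans IH.
  rewrite -(seminorm_eq (ht k)); apply: le_trans (pencil_lower0 _ (mt _)).
  by rewrite normc1.
set s := fun K => \sum_(k < K) (1 - z) ^+ k *: t k.+1.
have ms k : m (s k) = 0.
  by elim: k => [|k IH]; rewrite /s ?big_ord0// big_ord_recr mD IH mZ mt mulr0 addr0.
have ps k : pencil z (s k) =~ F - (1 - z) ^+ k *: t k.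
  elim: k => [|k IH].
    rewrite expr0 scale1r t0 subrr subr0 /s big_ord0.
    by apply/eqP; rewrite eq_le seminorm_ge0 andbT (le_trans (pencil_le _ _))// seminorm0 mulr0.
  rewrite /s big_ord_recr; apply: eqv_trans (pencilD _ _ _) _.
  apply: eqv_trans (eqvD IH (pencilZ _ _ _)) _.
  have h : pencil z (t k.+1) =~ t k - (1 - z) *: t k.+1.
    have -> : pencil z (t k.+1) = pencil 1 (t k.+1) - (1 - z) *: t k.+1.
      by rewrite /pencil scalerBl !scale1r subACA subrr add0r opprB.
    by apply: eqvB => //; rewrite subrr seminorm0.
  apply: eqv_trans (eqvD (_ : _ =~ F - (1 - z) ^+ k *: t k) (eqvZ _ h)) _.
    by rewrite subrr seminorm0.
  by rewrite scalerBr addrA subrK scalerA exprSr subrr seminorm0.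
(* On the disc |z - 1| <= (1 - r)/2 the pencil is uniformly bounded below on mean zero vectors; with
   the growth of [tn] this leaves the ratio 1/2. *)
have zr : (1 - r) / 2 <= normc z - r.
  have := le_normcD z (1 - z); rewrite addrC subrK normc1; lra.
have zr0 : 0 < normc z - r by apply: lt_le_trans zr; rewrite divr_gt0.
have := @pencil_lower0 z (g - s K); rewrite mB mg ms subr0 => /(_ erefl).
rewrite (seminorm_eq (pencilB _ _ _)) (seminorm_eq (eqvB hg (ps K))).
rewrite subKr nZ => h.
have nX : normc ((1 - z) ^+ K) <= ((1 - r) / 2) ^+ K.
  elim: (K) => [|k IH]; first by rewrite !expr0 normc1.
  rewrite !exprS normcM ler_pM//.
    by case: (1 - z) => x y; exact: sqrtr_ge0.
  by case: ((1 - z) ^+ k) => x y; exact: sqrtr_ge0.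
have h2 : n (g - s K) * ((1 - r) / 2) <= ((1 - r) / 2) ^+ K * (n F / (1 - r) ^+ K).
  apply: le_trans (_ : _ <= (normc z - r) * n (g - s K)) _.
    by rewrite mulrC ler_wpM2r// seminorm_ge0.
  apply: le_trans h _; apply: ler_pM; [|exact: seminorm_ge0|exact: nX|exact: tn].
  by case: ((1 - z) ^+ K) => x y; exact: sqrtr_ge0.
rewrite -ler_pdivlMr ?divr_gt0// in h2.
apply: le_trans h2 _; rewrite expr_div_n le_eqVlt; apply/orP; left; apply/eqP.
rewrite exprVn; field.
by rewrite !expf_neq0 ?gt_eqF.
Qed.

(** Boundedness below makes any pointwise choice of preimages unique up to null vectors, hence
    linear and bounded. *)
Lemma pencil_inverse z M (t : W -> W) :
  (forall u, n u <= M * n (pencil z u)) -> (forall w, pencil z (t w) =~ w) ->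
  [/\ forall a u v, t (a *: u + v) =~ a *: t u + t v, forall w, n (t w) <= M * n w &
      forall u v, pencil z u =~ v -> t v =~ u].
Proof.
move=> low ht.
have tp u v : pencil z u =~ v -> t v =~ u.
  move=> h; apply/eqP; rewrite eq_le seminorm_ge0 andbT; apply: le_trans (low _) _.
  rewrite (seminorm_eq (pencilB _ _ _)) (_ : n _ = 0) ?mulr0//.
  exact: eqv_trans (ht v) (eqvC h).
split => // [a u v|w]; last by apply: le_trans (low _) _; rewrite (seminorm_eq (ht w)).
apply: tp; apply: eqv_trans (pencilD _ _ _) _.
by apply: eqvD => //; apply: eqv_trans (pencilZ _ _ _) (eqvZ _ _).
Qed.

(** t_k is (1 - P)^(-k) applied to the mean zero part of [u]: up to sign, the Taylor coefficients of
    the regular part of the resolvent at 1. *)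
Lemma neumann_sequence u : exists t : nat -> W,
  [/\ t 0%N = u - m u *: e, forall k, m (t k) = 0 & forall k, pencil 1 (t k.+1) =~ t k].
Proof.
have /choice[tau htau] : forall w, exists g, m w = 0 -> m g = 0 /\ pencil 1 g =~ w.
  move=> w; have [mw|mw] := pselect (m w = 0); last by exists 0.
  have r1' : r < normc (1 : R[i]) by rewrite normc1.
  by have [g mg hg] := pencil_surj0 r1' mw; exists g.
have mt k : m (iter k tau (u - m u *: e)) = 0.
  by elim: k => [|k IH] /=; [rewrite mB mZ me mulr1 subrr|have [] := htau _ IH].
by exists (fun k => iter k tau (u - m u *: e)); split => // k; have [] := htau _ (mt k).
Qed.

(** The mean part of [s] is the simple pole m(u)/(z - 1), the mean zero part is expanded by
    [pencil_expansion]. A functional [ell] is applied because the contour integral is taken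
    weakly. *)
Lemma pencil_laurent z u s (t : nat -> W) (ell : W -> R[i]) C K :
  (forall a u v, ell (a *: u + v) = a * ell u + ell v) -> 0 <= C ->
  (forall u, normc (ell u) <= C * n u) ->
  normc (1 - z) <= (1 - r) / 2 -> z != 1 ->
  t 0%N = u - m u *: e -> (forall k, m (t k) = 0) -> (forall k, pencil 1 (t k.+1) =~ t k) ->
  pencil z s =~ u ->
  normc (ell s - (m u * ell e / (z - 1) +
      \sum_(k < K) (-1) ^+ k * ell (t k.+1) * (z - 1) ^+ k)) <=
    C * (2 / (1 - r) * n (u - m u *: e)) * 2^-1 ^+ K.
Proof.
move=> elin C0 ele hz z1 t0 mt pt hs.
have e0 : ell 0 = 0 by have := elin (-1) 0 0; rewrite scaler0 addr0 mulN1r addNr.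
have eZ a w : ell (a *: w) = a * ell w by rewrite -[_ *: _]addr0 elin e0 addr0.
have eD w v : ell (w + v) = ell w + ell v by rewrite -[w]scale1r elin mul1r scale1r.
have eB w v : ell (w - v) = ell w - ell v by rewrite eD -scaleN1r eZ mulN1r.
have esum (F : 'I_K -> W) : ell (\sum_(k < K) F k) = \sum_(k < K) ell (F k).
  by elim/big_rec2: _ => [//|i y w _ <-]; rewrite eD.
have ms : m s = m u / (z - 1).
  have : m (pencil z s - u) = 0.
    apply: (@eq0_normc R); apply/eqP; rewrite eq_le -{1}hs mle /=.
    by case: (m _) => a b; exact: sqrtr_ge0.
  rewrite mB mean_pencil => /eqP; rewrite subr_eq0 => /eqP <-.
  by rewrite mulrC mulKf// subr_eq0.
pose g := s - m s *: e.
have mg : m g = 0 by rewrite mB mZ me mulr1 subrr.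
have mF : m (u - m u *: e) = 0 by rewrite mB mZ me mulr1 subrr.
have hg : pencil z g =~ u - m u *: e.
  apply: eqv_trans (pencilB _ _ _) _; apply: eqvB => //.
  apply: eqv_trans (pencilZ _ _ _) _; apply: eqv_trans (eqvZ _ (pencil_unit z)) _.
  by rewrite scalerA ms divfK ?subr_eq0// subrr seminorm0.
have := pencil_expansion K hz mF t0 mt pt mg hg => h.
rewrite (_ : _ - _ = ell (g - \sum_(k < K) (1 - z) ^+ k *: t k.+1)); last first.
  rewrite eB /g eB eZ esum ms opprD addrA mulrAC; congr (_ - _).
  by apply: eq_bigr => k _; rewrite eZ mulrAC -exprMn mulN1r opprB.
by apply: le_trans (ele _) _; rewrite -[leRHS]mulrA ler_wpM2l.
Qed.

End resolvent.

(** * Trigonometric means and contour integrals *)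

Section trigonometric_mean.
Variable R : realType.
Local Notation mu := (@lebesgue_measure R).
Local Notation L := `[0, 2 * pi]%classic.
Implicit Types f g : R -> R.

(** Continuity is included so that integrability accompanies every linear combination. *)
Definition has_mean (a : R) g : Prop :=
  continuous g /\ \int[mu]_(t in L) g t = 2 * pi * a.

Lemma continuous_integrable g : continuous g -> mu.-integrable L (EFin \o g).
Proof.
move=> cg; apply: continuous_compact_integrable; first exact: segment_compact.
exact: continuous_subspaceT.
Qed.

Lemma has_mean_cst a : has_mean a (cst a).
Proof.
split; first by move=> x; exact: cvg_cst.
have p0 : 0 <= 2 * pi :> R by rewrite mulr_ge0// pi_ge0.
rewrite Rintegral_cst// mulrC; congr (_ * _).
have := @lebesgue_measure_itv R `[0, 2 * pi]; rewrite /= lte_fin lt_neqAle p0 andbT => ->.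
by case: eqVneq => [<-|_] //=; rewrite ?subr0.
Qed.

Lemma has_meanD a b f g : has_mean a f -> has_mean b g -> has_mean (a + b) (fun t => f t + g t).
Proof.
move=> [cf If] [cg Ig]; split; first by move=> x; apply: cvgD; [exact: cf|exact: cg].
have i1 := continuous_integrable cf; have i2 := continuous_integrable cg.
by rewrite RintegralD; [rewrite If Ig; ring|exact: measurable_itv|exact: i1|exact: i2].
Qed.

Lemma has_meanZ a b f : has_mean a f -> has_mean (b * a) (fun t => b * f t).
Proof.
move=> [cf If]; split; first by move=> x; apply: cvgMr; exact: cf.
have i1 := continuous_integrable cf.
by rewrite RintegralZl; [rewrite If; ring|exact: measurable_itv|exact: i1].
Qed.

Lemma has_mean_deriv (F f : R -> R) : (forall x : R, is_derive x (1 : R) F (f x)) -> continuous f ->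
  F (2 * pi) = F 0 -> has_mean 0 f.
Proof.
move=> dF cf F2; split => //.
have cF : continuous F.
  move=> x; apply/differentiable_continuous/derivable1_diffP.
  exact: @ex_derive _ _ _ _ _ _ _ (dF x).
have p0 : 0 < 2 * pi :> R by rewrite mulr_gt0// pi_gt0.
rewrite /Rintegral (@continuous_FTC2 _ f F)//.
- by rewrite F2 subee// mulr0.
- exact: continuous_subspaceT.
- split.
  + by move=> x _; exact: @ex_derive _ _ _ _ _ _ _ (dF x).
  + by apply: cvg_at_right_filter; exact: cF.
  + by apply: cvg_at_left_filter; exact: cF.
- by move=> x _; rewrite derive1E; exact: @derive_val _ _ _ _ _ _ _ (dF x).
Qed.

Lemma sin_2pin j : sin (j%:R * (2 * pi)) = 0 :> R /\ cos (j%:R * (2 * pi)) = 1 :> R.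
Proof.
elim: j => [|j [IHs IHc]]; first by rewrite mul0r sin0 cos0.
rewrite -natr1 mulrDl mul1r sinD cosD IHs IHc [2 * pi]mulr_natl sin2pi cos2pi.
by rewrite !(mul0r, mulr0, mulr1, addr0, subr0).
Qed.

Lemma has_mean_cos j : has_mean 0 (fun t => cos (j.+1%:R * t)).
Proof.
apply: (@has_mean_deriv (fun t => j.+1%:R^-1 * sin (j.+1%:R * t))).
- move=> x; have -> : cos (j.+1%:R * x) = j.+1%:R^-1 *: (cos (j.+1%:R * x) * (j.+1%:R *: 1)).
    by rewrite /GRing.scale /= mulr1 mulrCA mulVf ?mulr1// pnatr_eq0.
  have h1 := @is_deriveZ R R R (@id R) j.+1%:R x 1 1 (is_derive_id x 1).
  have h2 := is_derive1_comp (is_derive_sin (j.+1%:R * x)) h1.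
  exact: (is_deriveZ (j.+1%:R^-1) h2).
- move=> x; apply: continuous_comp; last exact: continuous_cos.
  by apply: cvgMr; exact: cvg_id.
- by rewrite (sin_2pin _).1 !mulr0 sin0 mulr0.
Qed.

Lemma has_mean_sin j : has_mean 0 (fun t => sin (j.+1%:R * t)).
Proof.
apply: (@has_mean_deriv (fun t => - j.+1%:R^-1 * cos (j.+1%:R * t))).
- move=> x; have -> : sin (j.+1%:R * x) = - j.+1%:R^-1 *: (- sin (j.+1%:R * x) * (j.+1%:R *: 1)).
    by rewrite /GRing.scale /= mulr1 !mulNr mulrN opprK mulrCA mulVf ?mulr1// pnatr_eq0.
  have h1 := @is_deriveZ R R R (@id R) j.+1%:R x 1 1 (is_derive_id x 1).
  have h2 := is_derive1_comp (is_derive_cos (j.+1%:R * x)) h1.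
  exact: (is_deriveZ (- j.+1%:R^-1) h2).
- move=> x; apply: continuous_comp; last exact: continuous_sin.
  by apply: cvgMr; exact: cvg_id.
- by rewrite (sin_2pin _).2 mulr0 cos0.
Qed.

(** Uniform approximants sharing one mean pass it to the limit. *)
Lemma uniform_mean g (p : nat -> R -> R) a D q : 0 <= q < 1 ->
  (forall K, has_mean a (p K)) -> (forall K t, `|g t - p K t| <= D * q ^+ K) ->
  \int[mu]_(t in L) g t = 2 * pi * a.
Proof.
move=> /andP[q0 q1] hp hg.
have lim0 : (fun K => D * q ^+ K) @ \oo --> (0 : R).
  by have := @cvg_geometric R D q; rewrite ger0_norm//; exact.
have mp K : measurable_fun [set: R] (p K).
  by apply: continuous_measurable_fun; have [] := hp K.
have cg t : (fun K => p K t) @ \oo --> g t.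
  apply/subr_cvg0; apply/norm_cvg0P.
  apply: (@squeeze_cvgr _ _ _ _ (cst 0) (fun K => D * q ^+ K)) => //; last exact: cvg_cst.
  by near=> K; rewrite normr_ge0 distrC hg.
have mg : measurable_fun [set: R] g.
  apply/measurable_EFinP; apply: (@emeasurable_fun_cvg _ _ _ _ (fun K t => (p K t)%:E)).
    by move=> K; apply/measurable_EFinP.
  by move=> t _; apply: cvg_EFin; [exact: nearW|exact: cg].
have ip K : mu.-integrable L (EFin \o p K).
  by apply: continuous_integrable; have [] := hp K.
have ig : mu.-integrable L (EFin \o g).
  rewrite (_ : EFin \o g = (EFin \o p 0%N) \+ (EFin \o (fun t => g t - p 0%N t))).
    apply: integrableD => //; apply: measurable_bounded_integrable => //.
    - have := @lebesgue_measure_itv R `[0, 2 * pi]; rewrite /= => ->.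
      by case: ifP => _ /=; [exact: ltry|exact: lt0y].
    - apply: (@measurable_funS _ _ _ _ setT) => //.
      by apply: measurable_funB => //; exact: mp.
    - exists D; split; first exact: num_real.
      by move=> y Dy t _; apply: le_trans (hg 0%N t) _; rewrite expr0 mulr1 ltW.
  by apply/funext => t /=; rewrite -EFinD addrC subrK.
have p0 : 0 <= 2 * pi :> R by rewrite mulr_ge0// pi_ge0.
apply/eqP; rewrite -subr_eq0 -normr_le0; apply/ler_addgt0Pl => e e0; rewrite addr0.
suff h K : `|\int[mu]_(t in L) g t - 2 * pi * a| <= 2 * pi * (D * q ^+ K).
  have : (fun K => 2 * pi * (D * q ^+ K)) @ \oo --> 2 * pi * (0 : R) by apply: cvgMr.
  rewrite mulr0 => /cvgr_lt/(_ _ e0)[K _ /(_ K (leqnn K))] /=.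
  by move=> /ltW; apply: le_trans.
have [_ <-] := hp K; rewrite -RintegralB//.
have iB : mu.-integrable L (EFin \o (fun t => g t - p K t)).
  rewrite (_ : _ \o _ = ((EFin \o g) \- (EFin \o p K))%E); last by apply/funext => t /=; rewrite EFinB.
  exact: integrableB.
apply: le_trans (le_normr_Rintegral _ iB) _ => //.
have [_ <-] := has_mean_cst (D * q ^+ K).
apply: le_Rintegral => //.
- exact: integrable_norm.
- by apply: continuous_integrable => x; exact: cvg_cst.
Unshelve. all: by end_near.
Qed.

Lemma normc_cexpi t : normc (cexpi t : R[i]) = 1.
Proof. by rewrite /cexpi /= cos2Dsin2 sqrtr1. Qed.

Lemma cexpi_exp t k : (cexpi t : R[i]) ^+ k = cexpi (k%:R * t).
Proof.
elim: k => [|k IH]; first by rewrite expr0 mul0r /cexpi cos0 sin0.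
rewrite exprS IH -natr1 mulrDl mul1r [_ + t]addrC /cexpi cosD sinD.
by apply/eqP; rewrite eq_complex /= eqxx/=; apply/eqP; ring.
Qed.

Definition has_cmean (a : R[i]) (g : R -> R[i]) : Prop :=
  has_mean (complex.Re a) (fun t => complex.Re (g t)) /\ has_mean (complex.Im a) (fun t => complex.Im (g t)).

Lemma has_cmean_cst a : has_cmean a (cst a).
Proof. by split; exact: has_mean_cst. Qed.

Lemma has_cmeanD a b (f g : R -> R[i]) : has_cmean a f -> has_cmean b g ->
  has_cmean (a + b) (fun t => f t + g t).
Proof.
have ReD (x y : R[i]) : complex.Re (x + y) = complex.Re x + complex.Re y by case: x => ? ?; case: y.
have ImD (x y : R[i]) : complex.Im (x + y) = complex.Im x + complex.Im y by case: x => ? ?; case: y.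
move=> [fr fi] [gr gi]; split.
  rewrite ReD (_ : (fun t => _) = (fun t => complex.Re (f t) + complex.Re (g t))); first exact: has_meanD.
  by apply/funext => t.
rewrite ImD (_ : (fun t => _) = (fun t => complex.Im (f t) + complex.Im (g t))); first exact: has_meanD.
by apply/funext => t.
Qed.

Lemma has_cmean_exp a k : has_cmean 0 (fun t => a * cexpi t ^+ k.+1).
Proof.
have [c s] := (has_mean_cos k, has_mean_sin k).
split.
  have := has_meanD (has_meanZ (complex.Re a) c) (has_meanZ (- complex.Im a) s).
  rewrite !mulr0 addr0; congr (has_mean _ _); apply/funext => t.
  by rewrite cexpi_exp; case: (a) => x y /=; rewrite mulNr.
have := has_meanD (has_meanZ (complex.Re a) s) (has_meanZ (complex.Im a) c).
rewrite !mulr0 addr0; congr (has_mean _ _); apply/funext => t.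
by rewrite cexpi_exp; case: (a) => x y /=.
Qed.

Lemma Re_le_normc (z : R[i]) : `|complex.Re z| <= normc z.
Proof. by case: z => x y /=; rewrite -sqrtr_sqr ler_wsqrtr// lerDl sqr_ge0. Qed.

Lemma Im_le_normc (z : R[i]) : `|complex.Im z| <= normc z.
Proof. by case: z => x y /=; rewrite -sqrtr_sqr ler_wsqrtr// lerDr sqr_ge0. Qed.

(** After the change of variable the pole contributes the constant i A and each power of z - c a
    harmonic e^(i(k+1)t), whose mean is zero. *)
Lemma circle_integral_pole (phi : R[i] -> R[i]) (c A : R[i]) (a : nat -> R[i]) (rho D q : R) :
  0 < rho -> 0 <= q < 1 ->
  (forall z K, normc (z - c) = rho ->
    normc (phi z - (A / (z - c) + \sum_(k < K) a k * (z - c) ^+ k)) <= D * q ^+ K) ->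
  circle_integral phi c rho = 2 * 'i * pi%:C * A.
Proof.
move=> rho0 q01 h.
pose p K t : R[i] := 'i * A + \sum_(k < K) ('i * a k * rho%:C ^+ k.+1) * cexpi t ^+ k.+1.
have hp K : has_cmean ('i * A) (p K).
  elim: K => [|K IH].
    rewrite (_ : p 0%N = cst ('i * A)); first exact: has_cmean_cst.
    by apply/funext => t; rewrite /p big_ord0 addr0.
  have := has_cmeanD IH (has_cmean_exp ('i * a K * rho%:C ^+ K.+1) K).
  rewrite addr0; congr (has_cmean _ _); apply/funext => t.
  by rewrite /p big_ord_recr addrA.
have rhoC : rho%:C != 0 :> R[i] by rewrite (inj_eq (@complexI R)) gt_eqF.
have hz t : normc (c + rho%:C * cexpi t - c) = rho.
  by rewrite addrC addKr normcM normc_cexpi mulr1 /= expr0n addr0 sqrtr_sqr gtr0_norm.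
have e0 t : cexpi t != 0 :> R[i].
  by apply/eqP => e; have := normc_cexpi t; rewrite e normc0 => /eqP; rewrite eq_sym oner_eq0.
pose g t := phi (c + rho%:C * cexpi t) * ('i * rho%:C * cexpi t).
have hg K t : normc (g t - p K t) <= D * rho * q ^+ K.
  have -> : g t - p K t = (phi (c + rho%:C * cexpi t) - (A / (c + rho%:C * cexpi t - c) +
      \sum_(k < K) a k * (c + rho%:C * cexpi t - c) ^+ k)) * ('i * rho%:C * cexpi t).
    rewrite [RHS]mulrBl /g; congr (_ - _).
    have -> : c + rho%:C * cexpi t - c = rho%:C * cexpi t by rewrite addrC addKr.
    rewrite mulrDl /p; congr (_ + _); first by field; rewrite rhoC e0.
    rewrite mulr_suml; apply: eq_bigr => k _.
    by rewrite exprMn !exprSr; ring.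
  rewrite !normcM normc_cexpi mulr1 [normc 'i]/= expr0n add0r expr1n sqrtr1 mul1r.
  rewrite [normc rho%:C]/= expr0n addr0 sqrtr_sqr gtr0_norm//.
  by rewrite mulrAC ler_wpM2r ?(ltW rho0)// h.
rewrite /circle_integral /cintegral.
rewrite (@uniform_mean _ (fun K t => complex.Re (p K t)) (complex.Re ('i * A)) (D * rho) q)//; last 2 first.
- by move=> K; have [] := hp K.
- move=> K t; apply: le_trans (hg K t); apply: le_trans (Re_le_normc _).
  by rewrite /g; case: (_ * _) => ? ?; case: (p K t).
rewrite (@uniform_mean _ (fun K t => complex.Im (p K t)) (complex.Im ('i * A)) (D * rho) q)//; last 2 first.
- by move=> K; have [] := hp K.
- move=> K t; apply: le_trans (hg K t); apply: le_trans (Im_le_normc _).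
  by rewrite /g; case: (_ * _) => ? ?; case: (p K t).
have -> : 2 * 'i * pi%:C * A = (2 * pi)%:C * ('i * A).
  by rewrite rmorphM rmorph_nat; ring.
by case: ('i * A) => x y; apply/eqP; rewrite eq_complex /= !mul0r subr0 addr0 !eqxx.
Qed.

End trigonometric_mean.

(** * The complex space of square-integrable functions *)

Section square_integrable.
Context d (T : measurableType d) (R : realType).
Local Notation Re := complex.Re.
Local Notation Im := complex.Im.
Implicit Types F G : T -> R[i].

Lemma normc_ge0 (z : R[i]) : 0 <= normc z.
Proof. by case: z => x y; exact: sqrtr_ge0. Qed.

Lemma normc_sq (z : R[i]) : normc z ^+ 2 = Re z ^+ 2 + Im z ^+ 2.
Proof. by case: z => x y; rewrite sqr_sqrtr// addr_ge0// sqr_ge0. Qed.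

Lemma cmodE F x : cmod F x ^+ 2 = Re (F x) ^+ 2 + Im (F x) ^+ 2.
Proof. exact: normc_sq. Qed.

Lemma cmeasurable_lin (a : R[i]) F G : cmeasurable F -> cmeasurable G ->
  cmeasurable (fun x => a * F x + G x).
Proof.
move=> [Fr Fi] [Gr Gi]; split.
  rewrite (_ : (fun x => _) = (fun x => Re a * Re (F x) - Im a * Im (F x) + Re (G x))).
    by apply: measurable_funD => //; apply: measurable_funB; exact: measurable_funM.
  by apply/funext => x; case: a (F x) (G x) => [a b] [c e] [f g].
rewrite (_ : (fun x => _) = (fun x => Re a * Im (F x) + Im a * Re (F x) + Im (G x))).
  by apply: measurable_funD => //; apply: measurable_funD; exact: measurable_funM.
by apply/funext => x; case: a (F x) (G x) => [a b] [c e] [f g].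
Qed.

Lemma cmeasurable_cst (a : R[i]) : cmeasurable (fun _ : T => a).
Proof. by split; exact: measurable_cst. Qed.

Lemma measurable_cmod F : cmeasurable F -> measurable_fun [set: T] (cmod F).
Proof.
move=> [Fr Fi].
rewrite (_ : cmod F = Num.sqrt \o (fun x => Re (F x) ^+ 2 + Im (F x) ^+ 2)).
  apply: measurableT_comp; first by apply: continuous_measurable_fun; exact: sqrt_continuous.
  by apply: measurable_funD; exact: measurable_funX.
by apply/funext => x; rewrite /= -cmodE sqrtr_sqr ger0_norm// normc_ge0.
Qed.

Section norm.
Variable mu : {measure set T -> \bar R}.
Local Notation sq F := (\int[mu]_x (cmod F x ^+ 2)%:E)%E.

Lemma sq_ge0 F : (0 <= sq F)%E.
Proof. by apply: integral_ge0 => x _; rewrite lee_fin sqr_ge0. Qed.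

Lemma sqrte_le (x y : \bar R) : (0 <= x)%E -> (x <= y)%E -> (sqrte x <= sqrte y)%E.
Proof.
by case: x y => [x||] [y||] //= x0 xy; rewrite ?leey// lee_fin ler_wsqrtr.
Qed.

Lemma Lnorm2E (g : T -> R) :
  ('N[mu]_(2%:E) [EFin \o g] = sqrte (\int[mu]_x (g x ^+ 2)%:E))%E.
Proof.
rewrite unlock -poweR12_sqrt; last by apply: integral_ge0 => x _; rewrite lee_fin sqr_ge0.
congr (_ `^ _)%E; apply: eq_integral => x _ /=.
by rewrite (powR_mulrn 2)// real_normK// num_real.
Qed.

Lemma L2normE F : L2norm mu F = sqrte (sq F).
Proof. exact: Lnorm2E. Qed.

Lemma L2_sq F : L2 mu F <-> cmeasurable F /\ (sq F < +oo)%E.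
Proof.
rewrite /L2 /finite_norm /= Lnorm2E.
split=> -[mF h]; split => //; move: h; have := sq_ge0 F;
  by case: (sq F)%E => [r||] //= _; rewrite ?ltry.
Qed.

Lemma L2norm_fine F : L2 mu F -> L2norm mu F = (fine (L2norm mu F))%:E.
Proof.
by move=> [_ h]; rewrite fineK// ge0_fin_numE// /L2norm Lnorm_ge0.
Qed.

Definition l2norm F : R := fine (L2norm mu F).

Lemma l2norm_ge0 F : 0 <= l2norm F.
Proof. by rewrite fine_ge0// Lnorm_ge0. Qed.

Lemma l2norm_sq F : L2 mu F -> ((l2norm F ^+ 2)%:E = sq F)%E.
Proof.
move=> LF; have /L2_sq[_ h] := LF; rewrite /l2norm L2normE; move: h (sq_ge0 F).
by case: (sq F)%E => [r||] //= _ r0; rewrite sqr_sqrtr.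
Qed.

Lemma L2_le F (g : T -> R) M : cmeasurable F -> measurable_fun [set: T] g ->
  (forall x, cmod F x <= g x) -> ('N[mu]_(2%:E) [EFin \o g] <= M%:E)%E ->
  L2 mu F /\ l2norm F <= M.
Proof.
move=> mF mg Fg gM.
have h : (L2norm mu F <= M%:E)%E.
  apply: le_trans gM; rewrite L2normE Lnorm2E; apply: sqrte_le; first exact: sq_ge0.
  apply: ge0_le_integral => //.
  - by move=> x _; rewrite lee_fin sqr_ge0.
  - by apply/measurable_EFinP; apply: measurable_funX; exact: measurable_cmod.
  - by apply/measurable_EFinP; exact: measurable_funX.
  - move=> x _; rewrite lee_fin ler_sqr ?nnegrE ?normc_ge0//.
    exact: le_trans (normc_ge0 _) (Fg x).
have LF : L2 mu F by split => //; rewrite /finite_norm; apply: le_lt_trans h _; exact: ltry.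
by split => //; rewrite -lee_fin /l2norm -L2norm_fine.
Qed.

Lemma L2_scale a F : L2 mu F ->
  L2 mu (fun x => a * F x) /\ l2norm (fun x => a * F x) = normc a * l2norm F.
Proof.
move=> LF; have /L2_sq[mF sF] := LF.
have mZ : cmeasurable (fun x => a * F x).
  have := cmeasurable_lin a mF (cmeasurable_cst 0); congr cmeasurable.
  by apply/funext => x; rewrite addr0.
have E : (sq (fun x => a * F x) = (normc a ^+ 2)%:E * sq F)%E.
  rewrite -ge0_integralZl//.
  - by apply: eq_integral => x _; rewrite /cmod normcM exprMn EFinM.
  - by apply/measurable_EFinP; apply: measurable_funX; exact: measurable_cmod.
  - by move=> x _; rewrite lee_fin sqr_ge0.
  - by rewrite lee_fin sqr_ge0.
have LZ : L2 mu (fun x => a * F x).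
  apply/L2_sq; split => //; rewrite E -l2norm_sq// -EFinM; exact: ltry.
split => //; apply/eqP; rewrite -(@eqrXn2 _ 2) ?mulr_ge0 ?l2norm_ge0 ?normc_ge0//.
by rewrite exprMn -eqe l2norm_sq// E -l2norm_sq// EFinM.
Qed.

Lemma L2_add F G : L2 mu F -> L2 mu G ->
  L2 mu (fun x => F x + G x) /\ l2norm (fun x => F x + G x) <= l2norm F + l2norm G.
Proof.
move=> LF LG; have [mF _] := LF; have [mG _] := LG.
have mFG : cmeasurable (fun x => F x + G x).
  have := cmeasurable_lin 1 mF mG; congr cmeasurable.
  by apply/funext => x; rewrite mul1r.
apply: (@L2_le _ (cmod F \+ cmod G)) => //.
- by apply: measurable_funD; exact: measurable_cmod.
- by move=> x; exact: le_normcD.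
- have -> : ((l2norm F + l2norm G)%:E = L2norm mu F + L2norm mu G)%E.
    by rewrite (L2norm_fine LF) (L2norm_fine LG).
  by apply: minkowski_EFin; rewrite ?ler1n//; exact: measurable_cmod.
Qed.

Lemma l2norm_ae F G : L2 mu F -> L2 mu G ->
  F = G %[ae mu] <-> l2norm (fun x => F x - G x) = 0.
Proof.
move=> LF LG; have [LN _] := L2_scale (-1) LG; have [LB _] := L2_add LF LN.
have BE : (fun x => F x + -1 * G x) = (fun x => F x - G x).
  by apply/funext => x; rewrite mulN1r.
rewrite BE in LB; have [mB _] := LB.
have mE : measurable_fun [set: T] (EFin \o cmod (fun x => F x - G x)).
  by apply/measurable_EFinP; exact: measurable_cmod.
split => [h|h].
  rewrite /l2norm /L2norm Lnorm2E (_ : (\int[mu]_x _)%E = 0%E); first by rewrite /= sqrtr0.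
  have : ae_eq mu [set: T] (fun x => (cmod (fun x => F x - G x) x ^+ 2)%:E) (cst 0%E).
    by apply: filterS h => x /= /(_ Logic.I) e _; rewrite /cmod e subrr normc0 expr0n.
  move=> /(ae_eq_integral _ _ _) -> //.
  - by rewrite integral0.
  - by apply/measurable_EFinP; apply: measurable_funX; exact: measurable_cmod.
have : L2norm mu (fun x => F x - G x) = 0%E by rewrite L2norm_fine// -/(l2norm _) h.
move=> /(Lnorm_eq0_eq0 mE); rewrite lte_fin ltr0n => /(_ isT).
apply: filterS => x /= /(_ Logic.I) [] /eq0_normc /eqP; rewrite subr_eq0 => /eqP //.
Qed.

End norm.

Section space.
Variable mu : {measure set T -> \bar R}.

Lemma L2_0 : L2 mu (fun=> 0).
Proof.
apply/L2_sq; split; first exact: cmeasurable_cst.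
by rewrite integral0_eq// => x _; rewrite /cmod normc0 expr0n.
Qed.

Definition L2_pred : {pred T -> R[i]} := mem (L2 mu).
(** A space of functions with a seminorm, not of classes; equality almost everywhere is expressed by
    [l2_aeP]. *)
Structure l2 := MkL2 { l2_val :> T -> R[i] ; _ : l2_val \in L2_pred }.
HB.instance Definition _ := [isSub for l2_val].
HB.instance Definition _ := [Choice of l2 by <:].

Lemma L2_zmod_closed : zmod_closed L2_pred.
Proof.
split; first by rewrite inE; exact: L2_0.
move=> F G; rewrite !inE => LF LG.
have [LN _] := L2_scale (-1) LG; have [+ _] := L2_add LF LN.
by congr (L2 _ _); apply/funext => x; rewrite mulN1r.
Qed.

HB.instance Definition _ := GRing.isZmodClosed.Build _ L2_pred L2_zmod_closed.
HB.instance Definition _ := [SubChoice_isSubZmodule of l2 by <:].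

Lemma l2P (F : l2) : L2 mu F.
Proof. by case: F => F /=; rewrite inE. Qed.

Lemma l2_ext (F G : l2) : (forall x, F x = G x) -> F = G.
Proof. by move=> h; apply/val_inj/funext. Qed.

Definition mkl2 (F : T -> R[i]) : l2 := insubd 0 F.

Lemma mkl2E F : L2 mu F -> mkl2 F = F :> (T -> R[i]).
Proof. by move=> h; rewrite /mkl2 insubdK// inE. Qed.

Definition l2_scale a (F : l2) : l2 := mkl2 (fun x => a * F x).

Lemma l2_scaleE a (F : l2) x : l2_scale a F x = a * F x.
Proof. by rewrite /l2_scale mkl2E//; exact: (L2_scale a (l2P F)).1. Qed.

Lemma l2_scaleA a b (F : l2) : l2_scale a (l2_scale b F) = l2_scale (a * b) F.
Proof. by apply: l2_ext => x; rewrite !l2_scaleE mulrA. Qed.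
Lemma l2_scale1 : left_id 1 l2_scale.
Proof. by move=> F; apply: l2_ext => x; rewrite l2_scaleE mul1r. Qed.
Lemma l2_scaleDr : right_distributive l2_scale +%R.
Proof. by move=> a F G; apply: l2_ext => x; rewrite l2_scaleE /= mulrDr -!l2_scaleE. Qed.
Lemma l2_scaleDl (F : l2) : {morph l2_scale^~ F : a b / a + b}.
Proof. by move=> a b; apply: l2_ext => x; rewrite l2_scaleE /= mulrDl -!l2_scaleE. Qed.

HB.instance Definition _ := GRing.Zmodule_isLmodule.Build R[i] l2
  l2_scaleA l2_scale1 l2_scaleDr l2_scaleDl.

Lemma l2_linE a (F G : l2) x : (a *: F + G) x = a * F x + G x.
Proof. by rewrite -l2_scaleE. Qed.
Lemma l2_ZE a (F : l2) x : (a *: F) x = a * F x.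
Proof. exact: l2_scaleE. Qed.
Lemma l2_BE (F G : l2) x : (F - G) x = F x - G x. Proof. by []. Qed.

Local Notation n := (fun F : l2 => l2norm mu F).

Lemma l2normZ a (F : l2) : n (a *: F) = normc a * n F.
Proof.
have [_ <-] := L2_scale a (l2P F); congr l2norm; apply/funext => x; exact: l2_ZE.
Qed.

Lemma l2normD (F G : l2) : n (F + G) <= n F + n G.
Proof. exact: (L2_add (l2P F) (l2P G)).2. Qed.

Lemma l2_aeP (F G : l2) : (F : T -> R[i]) = G %[ae mu] <-> n (F - G) = 0.
Proof. exact: l2norm_ae (l2P F) (l2P G). Qed.

End space.
End square_integrable.

Section jensen.
Context d (T : measurableType d) (R : realType) (m : {measure set T -> \bar R}).
Hypothesis mT : m [set: T] = 1%E.
Local Notation Re := complex.Re.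
Local Notation Im := complex.Im.
Implicit Types (f : T -> R) (F G : T -> R[i]).

Lemma cst_integrable (a : R) : m.-integrable [set: T] (EFin \o cst a).
Proof.
apply: measurable_bounded_integrable => //; first by rewrite [X in (X < _)%E]mT ltry.
exists `|a|; split; first exact: num_real.
by move=> y ay x _ /=; exact: ltW.
Qed.

Lemma sq_integrable f : measurable_fun [set: T] f ->
  (\int[m]_x (f x ^+ 2)%:E < +oo)%E ->
  m.-integrable [set: T] (EFin \o (fun x => f x ^+ 2)) /\ m.-integrable [set: T] (EFin \o f).
Proof.
move=> mf h.
have i2 : m.-integrable [set: T] (EFin \o (fun x => f x ^+ 2)).
  apply/integrableP; split; first by apply/measurable_EFinP; exact: measurable_funX.
  under eq_integral do rewrite /= ger0_norm ?sqr_ge0//.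
  exact: h.
split => //; apply: (le_integrable _ _ _ (integrableD _ (cst_integrable 1) i2)) => //.
  exact/measurable_EFinP.
move=> x _ /=; rewrite lee_fin [leRHS]ger0_norm ?addr_ge0 ?sqr_ge0//.
have [h1|h1] := leP `|f x| 1; first by rewrite (le_trans h1)// lerDl sqr_ge0.
rewrite -(real_normK (num_real (f x))) (@le_trans _ _ (`|f x| ^+ 2))// ?lerDr//.
by rewrite expr2 ler_peMl// ltW.
Qed.

(** The variance of f under [m] is nonnegative. *)
Lemma sqr_Rintegral_le f : measurable_fun [set: T] f ->
  (\int[m]_x (f x ^+ 2)%:E < +oo)%E ->
  (\int[m]_x f x) ^+ 2 <= \int[m]_x (f x ^+ 2).
Proof.
move=> mf h; have [i2 i1] := sq_integrable mf h.
set A := \int[m]_x f x.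
have i3 : m.-integrable [set: T] (EFin \o (fun x => - (A + A) * f x)).
  rewrite (_ : _ \o _ = (fun x => (- (A + A))%:E * (EFin \o f) x)%E).
    exact: integrableZl.
  by apply/funext => x.
have i4 : m.-integrable [set: T] (EFin \o (fun x => f x ^+ 2 + (- (A + A) * f x))).
  exact: (integrableD _ i2 i3).
have : 0 <= \int[m]_x (f x ^+ 2 + (- (A + A) * f x) + cst (A ^+ 2) x).
  apply: Rintegral_ge0 => x _.
  by rewrite /= (_ : _ + _ = (f x - A) ^+ 2) ?sqr_ge0//; ring.
rewrite RintegralD//; last exact: cst_integrable.
rewrite RintegralD// RintegralZl// Rintegral_cst// [X in fine X]mT mulr1 -/A => h0.
rewrite -subr_ge0; move: h0; congr (0 <= _); ring.
Qed.

Section complex_jensen.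
Variable F : T -> R[i].
Hypothesis mF : cmeasurable F.
Hypothesis sqF : (\int[m]_x (cmod F x ^+ 2)%:E < +oo)%E.

Let part_lty (f : T -> R) : measurable_fun [set: T] f ->
  (forall x, f x ^+ 2 <= cmod F x ^+ 2) -> (\int[m]_x (f x ^+ 2)%:E < +oo)%E.
Proof.
move=> mf h; apply: le_lt_trans sqF; apply: ge0_le_integral => //.
- by move=> x _; rewrite lee_fin sqr_ge0.
- by apply/measurable_EFinP; exact: measurable_funX.
- by apply/measurable_EFinP; apply: measurable_funX; exact: measurable_cmod.
- by move=> x _; rewrite lee_fin.
Qed.

Let reF : (\int[m]_x (Re (F x) ^+ 2)%:E < +oo)%E.
Proof. by apply: part_lty; [case: mF|move=> x; rewrite cmodE lerDl sqr_ge0]. Qed.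

Let imF : (\int[m]_x (Im (F x) ^+ 2)%:E < +oo)%E.
Proof. by apply: part_lty; [case: mF|move=> x; rewrite cmodE lerDr sqr_ge0]. Qed.

Lemma L2_integrable : m.-integrable [set: T] (EFin \o (fun x => Re (F x))) /\
  m.-integrable [set: T] (EFin \o (fun x => Im (F x))).
Proof.
by case: mF => mr mi; split; [have [] := sq_integrable mr reF|have [] := sq_integrable mi imF].
Qed.

Lemma normc_cintegral_sq :
  normc (cintegral m [set: T] F) ^+ 2 <= \int[m]_x (cmod F x ^+ 2).
Proof.
rewrite normc_sq /=; case: mF => mr mi.
have [ir _] := sq_integrable mr reF; have [ii _] := sq_integrable mi imF.
rewrite (_ : \int[m]_x (cmod F x ^+ 2) = \int[m]_x (Re (F x) ^+ 2 + Im (F x) ^+ 2)); last first.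
  by apply: eq_Rintegral => x _; rewrite cmodE.
by rewrite RintegralD// lerD// sqr_Rintegral_le.
Qed.
End complex_jensen.

Lemma cintegral_lin (a : R[i]) F G :
  m.-integrable [set: T] (EFin \o (fun x => Re (F x))) ->
  m.-integrable [set: T] (EFin \o (fun x => Im (F x))) ->
  m.-integrable [set: T] (EFin \o (fun x => Re (G x))) ->
  m.-integrable [set: T] (EFin \o (fun x => Im (G x))) ->
  cintegral m [set: T] (fun x => a * F x + G x) =
  a * cintegral m [set: T] F + cintegral m [set: T] G.
Proof.
move=> fr fi gr gi.
have iZ b (f : T -> R) : m.-integrable [set: T] (EFin \o f) ->
    m.-integrable [set: T] (EFin \o (fun x => b * f x)).
  move=> fi'; rewrite (_ : _ \o _ = (fun x => b%:E * (EFin \o f) x)%E).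
    exact: integrableZl.
  by apply/funext => x.
have iD (f g : T -> R) : m.-integrable [set: T] (EFin \o f) ->
    m.-integrable [set: T] (EFin \o g) -> m.-integrable [set: T] (EFin \o (fun x => f x + g x)).
  by move=> h1 h2; exact: (integrableD _ h1 h2).
case: a => a b; rewrite /cintegral; apply/eqP; rewrite eq_complex /=; apply/andP; split; apply/eqP.
  rewrite (_ : \int[m]_x _ = \int[m]_x (a * Re (F x) + - b * Im (F x) + Re (G x))).
    by rewrite !RintegralD ?RintegralZl ?mulNr//; do ?[exact: iZ|apply: iD].
  by apply: eq_Rintegral => x _; case: (F x) (G x) => [c e] [f g] /=; rewrite mulNr.
rewrite (_ : \int[m]_x _ = \int[m]_x (a * Im (F x) + b * Re (F x) + Im (G x))).
  by rewrite !RintegralD ?RintegralZl//; do ?[exact: iZ|apply: iD].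
by apply: eq_Rintegral => x _; case: (F x) (G x) => [c e] [f g] /=.
Qed.

End jensen.

(** * The kernel as an operator on L_2 *)

Section kernel_L2.
Context d (T : measurableType d) (R : realType) (P : R.-pker T ~> T).
Variables (pi : probability T R) (hrev : reversible P pi).
Local Notation Re := complex.Re.
Local Notation Im := complex.Im.
Implicit Types (f : T -> R) (F G : T -> R[i]) (u v w : l2 pi).
Local Notation I := (bint pi).
Local Notation N := (nrm (bip pi)).

Let piT : (pi : {measure set T -> \bar R}) [set: T] = 1%E.
Proof. exact: probability_setT. Qed.

Lemma measurable_kernel_int (g : T -> \bar R) : measurable_fun [set: T] g ->
  (forall y, 0 <= g y)%E -> measurable_fun [set: T] (fun x => \int[P x]_y g y)%E.
Proof.
move=> mg g0; apply: measurable_fun_integral_kernel => // U mU.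
exact: measurable_kernel.
Qed.

(* By monotone convergence from the bounded truncations of g. *)
Lemma kernel_int_inv f : measurable_fun [set: T] f -> (forall x, 0 <= f x) ->
  (\int[pi]_x \int[P x]_y (f y)%:E = \int[pi]_x (f x)%:E)%E.
Proof.
move=> mf f0; pose g n : bfun T R := mkb (fun x => Num.min (f x) n%:R).
have gE n x : g n x = Num.min (f x) n%:R.
  apply: (@mkbE _ _ _ (fun x => Num.min (f x) n%:R)).
    by apply: measurable_minr => //; exact: measurable_cst.
  by exists n%:R => y; rewrite ger0_norm ?ge_min ?lexx ?orbT// le_min f0 ler0n.
have g0 n x : 0 <= g n x by rewrite gE le_min f0 ler0n.
have gm x i j : (i <= j)%N -> g i x <= g j x.
  by move=> ij; rewrite !gE le_min !ge_min lexx ler_nat ij !orbT.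
have gf x : (fun n => (g n x)%:E) @ \oo --> (f x)%:E.
  apply: cvg_near_cst; exists (Num.truncn (f x)).+1 => // k /= hk.
  rewrite gE min_l// ltW// (lt_le_trans (truncnS_gt _))// ler_nat.
  exact: hk.
have mg n : measurable_fun [set: T] (fun x => (g n x)%:E).
  by apply/measurable_EFinP; exact: bfun_measurable.
have mono (m : {measure set T -> \bar R}) :
    ((fun n => \int[m]_x (g n x)%:E) @ \oo --> \int[m]_x (f x)%:E)%E.
  have := @cvg_monotone_convergence _ _ _ m _ measurableT (fun n x => (g n x)%:E).
  have -> : (fun x => limn (fun n => (g n x)%:E)) = (fun x => (f x)%:E).
    by apply/funext => x; apply/cvg_lim => //; exact: gf.
  apply => //.
  - by move=> n x _; rewrite lee_fin.
  - by move=> x _ i j ij; rewrite lee_fin gm.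
have L : (fun n => \int[pi]_x \int[P x]_y (g n y)%:E)%E @ \oo -->
    (\int[pi]_x \int[P x]_y (f y)%:E)%E.
  have := @cvg_monotone_convergence _ _ _ pi _ measurableT (fun n x => \int[P x]_y (g n y)%:E)%E.
  have -> : (fun x => limn (fun n => \int[P x]_y (g n y)%:E))%E = (fun x => \int[P x]_y (f y)%:E)%E.
    by apply/funext => x; apply/cvg_lim => //; exact: (mono (P x)).
  apply => //.
  - by move=> n; apply: measurable_kernel_int => // y; rewrite lee_fin.
  - by move=> n x _; apply: integral_ge0 => y _; rewrite lee_fin.
  - move=> x _ i j ij; apply: ge0_le_integral => // y _; by rewrite lee_fin// gm.
have E n : (\int[pi]_x \int[P x]_y (g n y)%:E = \int[pi]_x (g n x)%:E)%E.
  rewrite -[RHS]bintE ?prob_lty// -(kop_inv hrev) bintE ?prob_lty//.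
  by apply: eq_integral => x _; rewrite kopE bintE// fker_lty.
have := mono pi; rewrite -(funext E) => L'.
by rewrite -(cvg_lim (@ereal_hausdorff R) L) -(cvg_lim (@ereal_hausdorff R) L').
Qed.

Lemma kernel_op_measurable F : cmeasurable F -> cmeasurable (kernel_op P F).
Proof.
have part (f : T -> R) : measurable_fun [set: T] f ->
    measurable_fun [set: T] (fun x => \int[P x]_y f y).
  move=> mf; rewrite /Rintegral; apply: measurableT_comp => //.
  under eq_fun do rewrite integralE.
  have mf' : measurable_fun [set: T] (EFin \o f) by exact/measurable_EFinP.
  by apply: emeasurable_funB; apply: measurable_kernel_int => //;
    [exact: measurable_funepos|exact: measurable_funeneg].
by move=> [mr mi]; split; exact: part.
Qed.

Let PT x : (P x : {measure set T -> \bar R}) [set: T] = 1%E.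
Proof. exact: prob_kernel. Qed.

Lemma kernel_op_sq F x : cmeasurable F ->
  ((cmod (kernel_op P F) x ^+ 2)%:E <= \int[P x]_y (cmod F y ^+ 2)%:E)%E.
Proof.
move=> mF; have [h|h] := ltP (\int[P x]_y (cmod F y ^+ 2)%:E)%E +oo%E; last first.
  by rewrite (le_trans _ h)// leey.
have := normc_cintegral_sq (PT x) mF h.
rewrite -lee_fin /Rintegral fineK// ge0_fin_numE//.
by apply: integral_ge0 => y _; rewrite lee_fin sqr_ge0.
Qed.

Lemma kernel_sq_inv F : cmeasurable F ->
  (\int[pi]_x \int[P x]_y (cmod F y ^+ 2)%:E = \int[pi]_x (cmod F x ^+ 2)%:E)%E.
Proof.
move=> mF; apply: kernel_int_inv => [|x]; last exact: sqr_ge0.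
by apply: measurable_funX; exact: measurable_cmod.
Qed.

(** Jensen under each P(x, .), then invariance of pi. *)
Lemma kernel_op_L2 F : L2 pi F -> L2 pi (kernel_op P F) /\ l2norm pi (kernel_op P F) <= l2norm pi F.
Proof.
move=> LF; have /L2_sq[mF sF] := LF; have mPF := kernel_op_measurable mF.
have le : (\int[pi]_x (cmod (kernel_op P F) x ^+ 2)%:E <= \int[pi]_x (cmod F x ^+ 2)%:E)%E.
  rewrite -(kernel_sq_inv mF); apply: ge0_le_integral => //.
  - by move=> x _; rewrite lee_fin sqr_ge0.
  - by apply/measurable_EFinP; apply: measurable_funX; exact: measurable_cmod.
  - apply: measurable_kernel_int => [|y]; last by rewrite lee_fin sqr_ge0.
    by apply/measurable_EFinP; apply: measurable_funX; exact: measurable_cmod.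
  - by move=> x _; exact: kernel_op_sq.
have LP : L2 pi (kernel_op P F) by apply/L2_sq; split => //; exact: le_lt_trans sF.
split => //; rewrite -(@ler_pXn2r _ 2) ?nnegrE ?l2norm_ge0//.
by rewrite -lee_fin !l2norm_sq.
Qed.

(** By invariance P|F|^2 has finite integral, so F is integrable under P(x, .) for almost every x;
    elsewhere the integral takes default values and linearity may fail. *)
Lemma kernel_op_lin_ae (a : R[i]) F G : L2 pi F -> L2 pi G ->
  kernel_op P (fun x => a * F x + G x) =
    (fun x => a * kernel_op P F x + kernel_op P G x) %[ae pi].
Proof.
have fin H : L2 pi H -> {ae pi, forall x, \int[P x]_y (cmod H y ^+ 2)%:E < +oo}%E.
  move=> /L2_sq[mH sH].
  have : pi.-integrable [set: T] (fun x => \int[P x]_y (cmod H y ^+ 2)%:E)%E.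
    apply/integrableP; split.
      apply: measurable_kernel_int => [|y]; last by rewrite lee_fin sqr_ge0.
      by apply/measurable_EFinP; apply: measurable_funX; exact: measurable_cmod.
    under eq_integral do rewrite gee0_abs ?sq_ge0//.
    by rewrite kernel_sq_inv.
  move=> /(integrable_ae measurableT); apply: filterS => x /(_ Logic.I).
  by rewrite ge0_fin_numE// sq_ge0.
move=> LF LG; have [mF _] := LF; have [mG _] := LG.
apply: filterS2 (fin F LF) (fin G LG) => x hF hG _.
have [fr fi] := L2_integrable (PT x) mF hF; have [gr gi] := L2_integrable (PT x) mG hG.
exact: cintegral_lin.
Qed.

Definition l2op u : l2 pi := mkl2 pi (kernel_op P u).

Lemma l2opE u : l2op u = kernel_op P u :> (T -> R[i]).
Proof. by apply: mkl2E; exact: (kernel_op_L2 (l2P u)).1. Qed.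

Lemma l2op_lin (a : R[i]) u v : l2norm pi (l2op (a *: u + v) - (a *: l2op u + l2op v)) = 0.
Proof.
apply/l2_aeP; rewrite l2opE.
have -> : (a *: u + v : T -> R[i]) = (fun x => a * u x + v x).
  by apply/funext => x; exact: l2_linE.
apply: filterS (kernel_op_lin_ae a (l2P u) (l2P v)) => x h _.
by rewrite l2_linE !l2opE; exact: h.
Qed.

Lemma l2op_le u : l2norm pi (l2op u) <= l2norm pi u.
Proof. by rewrite l2opE; exact: (kernel_op_L2 (l2P u)).2. Qed.

Definition l2mean u : R[i] := cintegral pi [set: T] u.

Lemma l2mean_lin (a : R[i]) u v : l2mean (a *: u + v) = a * l2mean u + l2mean v.
Proof.
have /L2_sq[mu su] := l2P u; have /L2_sq[mv sv] := l2P v.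
have [fr fi] := L2_integrable piT mu su; have [gr gi] := L2_integrable piT mv sv.
rewrite /l2mean -cintegral_lin//; congr cintegral; apply/funext => x; exact: l2_linE.
Qed.

Lemma l2mean_le u : normc (l2mean u) <= l2norm pi u.
Proof.
have /L2_sq[mu su] := l2P u.
rewrite -(@ler_pXn2r _ 2) ?nnegrE ?l2norm_ge0 ?normc_ge0//.
apply: le_trans (normc_cintegral_sq piT mu su) _.
rewrite -lee_fin l2norm_sq; last exact: l2P.
by rewrite /Rintegral fineK// ge0_fin_numE// sq_ge0.
Qed.

End kernel_L2.

Lemma fatou_bound d (T : measurableType d) (R : realType)
    (mu : {measure set T -> \bar R}) (D : set T) (f : nat -> T -> \bar R) (g : T -> \bar R) (M : \bar R) :
  measurable D -> (forall n, measurable_fun D (f n)) -> (forall n x, D x -> 0 <= f n x)%E ->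
  (forall x, D x -> f ^~ x @ \oo --> g x) -> (forall n, \int[mu]_(x in D) f n x <= M)%E ->
  (\int[mu]_(x in D) g x <= M)%E.
Proof.
move=> mD mf f0 fg fM.
rewrite (_ : \int[mu]_(x in D) g x = \int[mu]_(x in D) limn_einf (f ^~ x))%E; last first.
  by apply: eq_integral => x /set_mem Dx; rewrite (cvg_limn_einf_sup (fg x Dx)).1.
apply: le_trans (fatou mu mD mf f0) _; rewrite limn_einf_lim.
apply: lime_le; first exact: is_cvg_einfs.
apply: nearW => n; apply: le_trans (fM n).
by apply: ereal_inf_lbound; exists n => /=.
Qed.

(** * Density of bounded functions and completeness *)

Section l2_space.
Context d (T : measurableType d) (R : realType) (pi : probability T R).
Local Notation Re := (@complex.Re R).
Local Notation Im := (@complex.Im R).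
Implicit Types (u v w : l2 pi) (f g : bfun T R).
Local Notation I := (bint pi).
Local Notation N := (nrm (bip pi)).
Local Notation n := (l2norm pi).

Let piT : (pi : {measure set T -> \bar R}) [set: T] = 1%E.
Proof. exact: probability_setT. Qed.

Lemma emb_sq f g :
  (\int[pi]_x (cmod (fun x => f x +i* g x) x ^+ 2)%:E = (N f ^+ 2 + N g ^+ 2)%:E)%E.
Proof.
rewrite !(nrm_sq (bipC pi) (bip_diag_ge0 pi)).
rewrite /bip -(blinD _ _ (bint_lin (prob_lty pi))) bintE ?prob_lty//.
by apply: eq_integral => x _; rewrite bfunD !bmulE cmodE /= !expr2.
Qed.

Lemma emb_L2 f g : L2 pi (fun x => f x +i* g x).
Proof.
apply/L2_sq; split; last by rewrite emb_sq ltry.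
by split; exact: bfun_measurable.
Qed.

Definition emb f g : l2 pi := mkl2 pi (fun x => f x +i* g x).
Lemma embE f g x : emb f g x = f x +i* g x.
Proof. by rewrite /emb mkl2E//; exact: emb_L2. Qed.

Lemma emb_norm f g : n (emb f g) ^+ 2 = N f ^+ 2 + N g ^+ 2.
Proof.
apply/eqP; rewrite -eqe l2norm_sq; last exact: l2P.
by rewrite -emb_sq; apply/eqP; apply: eq_integral => x _; rewrite /cmod embE.
Qed.

Lemma emb_mean f g : l2mean (emb f g) = I f +i* I g.
Proof.
by rewrite /l2mean /cintegral; congr (_ +i* _); apply: eq_Rintegral => x _; rewrite embE.
Qed.

(** Truncate to the set where |u| <= k; dominated convergence does the rest. *)
Lemma emb_dense u (e : R) : 0 < e -> exists f g, n (u - emb f g) < e.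
Proof.
move=> e0; have /L2_sq[mu su] := l2P u; have [mr mi] := mu.
have mc := measurable_cmod mu.
pose A (k : nat) := [set x | cmod u x <= k%:R].
have mA k : measurable (A k).
  by rewrite -[A k]setTI; apply: measurable_fun_le => //; exact: measurable_cst.
pose h (p : T -> R) k : bfun T R := mkb (fun x => p x * \1_(A k) x).
have hE (p : T -> R) k x : measurable_fun [set: T] p -> (forall x, `|p x| <= cmod u x) ->
    h p k x = p x * \1_(A k) x.
  move=> mp hp; apply: (@mkbE _ _ _ (fun x => p x * \1_(A k) x)).
    by apply: measurable_funM => //; exact: measurable_indic.
  exists k%:R => y; rewrite indicE normrM; have [/set_mem Ay|_] := boolP (y \in A k).
    by rewrite normr1 mulr1 (le_trans (hp y)).
  by rewrite normr0 mulr0.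
pose F k := emb (h (fun x => Re (u x)) k) (h (fun x => Im (u x)) k).
have FE k x : (u - F k) x = u x * (1 - \1_(A k) x)%:C.
  rewrite l2_BE embE !hE//; try by move=> y; rewrite /cmod ?Re_le_normc ?Im_le_normc.
  case: (u x) => a b; apply/eqP; rewrite eq_complex /=.
  by apply/andP; split; apply/eqP; ring.
pose phi k x := ((cmod (u - F k) x ^+ 2)%:E : \bar R).
have mphi k : measurable_fun [set: T] (phi k).
  have [m1 _] := l2P (u - F k).
  by apply/measurable_EFinP; apply: measurable_funX; exact: measurable_cmod.
have phi0 x : phi ^~ x @ \oo --> 0%E.
  apply: cvg_near_cst; exists (Num.truncn (cmod u x)).+1 => // k /= hk.
  rewrite /phi /cmod FE indicE mem_set ?subrr ?mulr0 ?normc0 ?expr0n//.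
  by rewrite /A /= ltW// (lt_le_trans (truncnS_gt _))// ler_nat.
have phi_le k x : (`|phi k x| <= (cmod u x ^+ 2)%:E)%E.
  rewrite gee0_abs ?lee_fin ?sqr_ge0// ler_sqr ?nnegrE ?normc_ge0//.
  rewrite /cmod FE normcM ler_piMr ?normc_ge0// /= expr0n addr0 sqrtr_sqr.
  by rewrite indicE; case: (_ \in _); rewrite ?subrr ?subr0 ?normr0 ?normr1.
have [] := @dominated_convergence _ _ _ pi _ measurableT phi (cst 0%E)
   (fun x => (cmod u x ^+ 2)%:E).
- exact: mphi.
- exact: measurable_cst.
- by apply: nearW => x _; exact: phi0.
- apply/integrableP; split.
    by apply/measurable_EFinP; exact: measurable_funX.
  by under eq_integral do rewrite gee0_abs ?lee_fin ?sqr_ge0//.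
- by apply: nearW => x k _; exact: phi_le.
move=> _ _; rewrite integral0 => /= lim0.
have e2 : 0 < e ^+ 2 by rewrite exprn_gt0.
have [k _ /(_ k (leqnn k))/=] := cvgr_lt _ (fine_cvg lim0) _ e2.
have -> : (\int[pi]_x phi k x = (n (u - F k) ^+ 2)%:E)%E by rewrite l2norm_sq//; exact: l2P.
rewrite /= ltr_sqr ?nnegrE ?l2norm_ge0 ?(ltW e0)// => hk.
by exists (h (fun x => Re (u x)) k), (h (fun x => Im (u x)) k).
Qed.

Lemma int_cmod_le u : (\int[pi]_x (cmod u x)%:E <= (n u)%:E)%E.
Proof.
have /L2_sq[mu su] := l2P u; have mc := measurable_cmod mu.
have [_ i1] := sq_integrable piT mc su.
rewrite -(fineK (integrable_fin_num measurableT i1)) lee_fin.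
apply: le_trans (ler_norm _) _.
rewrite -(@ler_pXn2r _ 2) ?nnegrE ?l2norm_ge0// real_normK ?num_real//.
apply: le_trans (sqr_Rintegral_le piT mc su) _.
rewrite -lee_fin l2norm_sq; last exact: l2P.
by rewrite /Rintegral fineK// ge0_fin_numE// sq_ge0.
Qed.

(** Riesz-Fischer for geometric increments: [geometric_ae] gives convergence almost everywhere, and
    Fatou carries the Cauchy bound to the limit. *)
Lemma l2_complete (u : nat -> l2 pi) D q : 0 <= q < 1 ->
  (forall k, n (u k.+1 - u k) <= D * q ^+ k) ->
  exists w D', forall k, n (w - u k) <= D' * q ^+ k.
Proof.
move=> /andP[q0 q1] hu; pose B := D / (1 - q).
have q1' : 0 < 1 - q by rewrite subr_gt0.
have D0 : 0 <= D by have := hu 0%N; rewrite expr0 mulr1; apply: le_trans; exact: l2norm_ge0.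
have B0 : 0 <= B by rewrite divr_ge0// ltW.
have Bq0 k : 0 <= B * q ^+ k := mulr_ge0 B0 (exprn_ge0 k q0).
have cauchy k m : n (u (m + k)%N - u k) <= B * q ^+ k.
  suff h : n (u (m + k)%N - u k) <= B * (q ^+ k - q ^+ (m + k)).
    by apply: le_trans h _; rewrite ler_wpM2l// gerBl exprn_ge0.
  elim: m => [|m IH].
    rewrite subrr subrr mulr0 (_ : n _ = 0)//.
    by have := l2normZ 0 (0 : l2 pi); rewrite scaler0 normc0 mul0r.
  rewrite (_ : u _ - u k = (u (m.+1 + k)%N - u (m + k)%N) + (u (m + k)%N - u k)); last first.
    by rewrite addrA subrK.
  apply: le_trans (l2normD _ _) _; apply: le_trans (lerD (hu _) IH) _.
  rewrite /B addSn exprS le_eqVlt; apply/orP; left; apply/eqP; field.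
  by rewrite gt_eqF.
pose p := (1 + q) / 2.
have qp : q < p by rewrite /p; lra.
have p1 : p < 1 by rewrite /p; lra.
have p0 : 0 <= p by rewrite (le_trans q0)// ltW.
have mcm v : measurable_fun [set: T] (cmod v).
  by have [m1 _] := l2P v; exact: measurable_cmod.
have := @geometric_ae _ _ _ pi (fun k => cmod (u k.+1 - u k)) D q p.
move=> /(_ (fun k => mcm _) (fun k x => normc_ge0 _)) hae.
have {hae}[N0 [mN0 pN0 hN0]] : {ae pi, forall x, exists2 W, 0 <= W &
    forall j, cmod (u j.+1 - u j) x <= W * p ^+ j}.
  apply: hae; last by rewrite q0.
  by move=> j; apply: le_trans (int_cmod_le _) _; rewrite lee_fin.
have bnd x : ~ N0 x -> exists2 W, 0 <= W & forall j, cmod (u j.+1 - u j) x <= W * p ^+ j.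
  by move=> nx; apply: contrapT => h; apply: nx; exact: hN0.
have cv (pr : R[i] -> R) (prB : forall a b, pr (a - b) = pr a - pr b)
    (prle : forall a, `|pr a| <= normc a) x : ~ N0 x -> cvgn (fun k => pr (u k x)).
  move=> /bnd[W W0 hW].
  have p01 : 0 <= p < 1 by rewrite p0.
  have := @geometric_series_cvg _ (fun j => pr (u j.+1 x) - pr (u j x)) W p p01.
  have -> : series (fun j => pr (u j.+1 x) - pr (u j x)) = (fun k => pr (u k x) - pr (u 0%N x)).
    by apply/funext => k; rewrite seriesEnat /= telescope_sumr.
  have hb j : `|pr (u j.+1 x) - pr (u j x)| <= W * p ^+ j.
    by rewrite -prB; apply: le_trans (prle _) (hW j).
  move=> /(_ hb) /cvg_ex[l hl]; apply/cvg_ex; exists (l + pr (u 0%N x)).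
  have : (fun k => pr (u k x) - pr (u 0%N x) + pr (u 0%N x)) @ \oo --> l + pr (u 0%N x).
    by apply: cvgD => //; exact: cvg_cst.
  by under eq_fun do rewrite subrK.
have cvR x : ~ N0 x -> cvgn (fun k => Re (u k x)).
  by apply: cv => [a b|]; [case: a => ? ?; case: b|exact: Re_le_normc].
have cvI x : ~ N0 x -> cvgn (fun k => Im (u k x)).
  by apply: cv => [a b|]; [case: a => ? ?; case: b|exact: Im_le_normc].
(* The limit is set to 0 on the null set [N0], where convergence may fail. *)
pose lm (pr : R[i] -> R) x := if x \in N0 then 0 else limn (fun k => pr (u k x)).
have lmE pr x : (x \in N0) = false -> lm pr x = limn (fun k => pr (u k x)).
  by rewrite /lm => ->.
pose w0 x := lm Re x +i* lm Im x.
have mlm (pr : R[i] -> R) : (forall k, measurable_fun [set: T] (fun x => pr (u k x))) ->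
    (forall x, ~ N0 x -> cvgn (fun k => pr (u k x))) -> measurable_fun [set: T] (lm pr).
  move=> mp cp; apply/measurable_EFinP.
  apply: (@emeasurable_fun_cvg _ _ _ _ (fun k x => (pr (u k x) * \1_(~` N0) x)%:E)).
    move=> k; apply/measurable_EFinP; apply: measurable_funM => //.
    by apply: measurable_indic; exact: measurableC.
  move=> x _; apply: cvg_EFin; first exact: nearW.
  rewrite /lm indicE in_setC; have [xN|xN] /= := boolP (x \in N0).
    by under eq_fun do rewrite mulr0; exact: cvg_cst.
  under eq_fun do rewrite mulr1; apply: cp => /mem_set; exact/negP.
have mw0 : cmeasurable w0.
  split; apply: mlm => // k; by have [[m1 m2] _] := l2P (u k).
have mD := measurableC mN0.
have fat k : (\int[pi]_x (cmod (fun x => w0 x - u k x) x ^+ 2)%:E <= ((B * q ^+ k) ^+ 2)%:E)%E.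
  have [m1 m2] := l2P (u k).
  have mdiff : cmeasurable (fun x => w0 x - u k x).
    have := cmeasurable_lin (-1) m1 mw0; congr cmeasurable.
    by apply/funext => x; rewrite mulN1r addrC.
  have msq : measurable_fun [set: T] (fun x => (cmod (fun x => w0 x - u k x) x ^+ 2)%:E).
    by apply/measurable_EFinP; apply: measurable_funX; exact: measurable_cmod.
  rewrite (ge0_negligible_integral mN0 _ _ _ pN0)//; last first.
    by move=> x _; rewrite lee_fin sqr_ge0.
  rewrite setTD; apply: (@fatou_bound _ _ _ _ _
    (fun m x => (cmod (u (m + k)%N - u k) x ^+ 2)%:E)) => //.
  - move=> m; apply: (@measurable_funS _ _ _ _ setT) => //.
    by apply/measurable_EFinP; exact: measurable_funX.
  - by move=> m x _; rewrite lee_fin sqr_ge0.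
  - move=> x Nx; apply: cvg_EFin; first exact: nearW.
    have xN : (x \in N0) = false by apply/negbTE/negP => /set_mem.
    rewrite cmodE /=.
    under eq_fun do rewrite cmodE.
    have part (pr : R[i] -> R) : (forall a b, pr (a - b) = pr a - pr b) ->
        cvgn (fun k => pr (u k x)) ->
        (fun m => pr ((u (m + k)%N - u k) x) ^+ 2) @ \oo --> (lm pr x - pr (u k x)) ^+ 2.
      move=> prB cp.
      have h : (fun m => pr ((u (m + k)%N - u k) x)) @ \oo --> lm pr x - pr (u k x).
        under eq_fun do rewrite l2_BE prB.
        rewrite lmE//; apply: cvgB; last exact: cvg_cst.
        by have := cp; rewrite -(cvg_shiftn k).
      by rewrite expr2; under eq_fun do rewrite expr2; exact: cvgM.
    have eR : complex.Re (w0 x - u k x) = lm Re x - Re (u k x) by rewrite /w0; case: (u k x).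
    have eI : complex.Im (w0 x - u k x) = lm Im x - Im (u k x) by rewrite /w0; case: (u k x).
    rewrite eR eI; apply: cvgD; apply: part.
    + by move=> a b; case: a => ? ?; case: b.
    + exact: cvR.
    + by move=> a b; case: a => ? ?; case: b.
    + exact: cvI.
  - move=> m; apply: (@le_trans _ _ (\int[pi]_x (cmod (u (m + k)%N - u k) x ^+ 2)%:E)%E).
      apply: ge0_subset_integral => //.
      + by apply/measurable_EFinP; exact: measurable_funX.
      + by move=> x _; rewrite lee_fin sqr_ge0.
    rewrite -l2norm_sq; last exact: l2P.
    by rewrite lee_fin; apply: lerXn2r; rewrite ?nnegrE ?l2norm_ge0 ?Bq0.
have Ld k : L2 pi (fun x => w0 x - u k x).
  apply/L2_sq; split; last by apply: le_lt_trans (fat k) _; exact: ltry.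
  have [m1 _] := l2P (u k); have := cmeasurable_lin (-1) m1 mw0; congr cmeasurable.
  by apply/funext => x; rewrite mulN1r addrC.
have Lw : L2 pi w0.
  have [+ _] := L2_add (Ld 0%N) (l2P (u 0%N)); congr (L2 _ _).
  by apply/funext => x; rewrite subrK.
exists (mkl2 pi w0), B => k.
rewrite -(@ler_pXn2r _ 2) ?nnegrE ?l2norm_ge0 ?Bq0// -lee_fin.
rewrite l2norm_sq; last exact: l2P.
apply: le_trans (fat k); rewrite le_eqVlt; apply/orP; left; apply/eqP.
by apply: eq_integral => x _; rewrite /cmod l2_BE mkl2E.
Qed.

End l2_space.

(** * Transfer of the contraction to complex L_2 *)

Section l2_operator.
Context d (T : measurableType d) (R : realType) (P : R.-pker T ~> T).
Variables (pi : probability T R) (hrev : reversible P pi).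
Local Notation Re := (@complex.Re R).
Local Notation Im := (@complex.Im R).
Implicit Types (u v w : l2 pi) (f g : bfun T R).
Local Notation I := (bint pi).
Local Notation N := (nrm (bip pi)).
Local Notation n := (l2norm pi).
Local Notation op := (l2op P (pi := pi)).

Let nZ := l2normZ (mu := pi).
Let nD := l2normD (mu := pi).

Definition l2one : l2 pi := emb pi (bcst T 1) 0.

Lemma l2oneE x : l2one x = 1.
Proof. by rewrite embE bcstE. Qed.

(** With [emb_dense], this transfers facts about [kop] on real bounded functions to all of L_2. *)
Lemma l2op_emb f g : op (emb pi f g) = emb pi (kop P f) (kop P g).
Proof.
apply: l2_ext => x; rewrite l2opE// embE /kernel_op /cintegral !kopE.
by congr (_ +i* _); apply: eq_Rintegral => y _; rewrite embE.
Qed.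

Lemma embB f g f' g' : emb pi (f - f') (g - g') = emb pi f g - emb pi f' g'.
Proof. by apply: l2_ext => x; rewrite l2_BE !embE !bfunB. Qed.

Let lsub (u v : l2 pi) : -1 *: v + u = u - v.
Proof. by rewrite scaleN1r addrC. Qed.

Lemma l2op_dist u v : n (op u - op v) <= n (u - v).
Proof.
have E := seminorm_eq nZ nD (l2op_lin hrev (-1) v u).
by rewrite !lsub in E; rewrite -E; exact: l2op_le.
Qed.

Let meanB u v : l2mean (u - v) = l2mean u - l2mean v.
Proof. by rewrite -lsub l2mean_lin mulN1r addrC. Qed.

Let le_eps (x c : R) : (forall e, 0 < e -> x <= c * e) -> 0 < c -> x <= 0.
Proof.
move=> h c0; apply/ler_addgt0Pl => e e0; rewrite addr0.
by have := h (e / c) (divr_gt0 e0 c0); rewrite mulrCA divff ?gt_eqF// mulr1.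
Qed.

Lemma l2mean_op u : l2mean (op u) = l2mean u.
Proof.
apply/eqP; rewrite -subr_eq0; apply/eqP; apply: eq0_normc.
apply/eqP; rewrite eq_le normc_ge0 andbT; apply: (@le_eps _ 2) => // e e0.
have [f [g fg]] := emb_dense u e0.
have -> : l2mean (op u) - l2mean u =
    l2mean (op u - op (emb pi f g)) - l2mean (u - emb pi f g).
  rewrite !meanB l2op_emb !emb_mean !kop_inv// opprB addrA subrK //.
apply: le_trans (le_normcD _ _) _; rewrite normcN mulr_natl mulr2n lerD//.
  by apply: le_trans (l2mean_le _) _; apply: le_trans (l2op_dist _ _) (ltW fg).
by apply: le_trans (l2mean_le _) (ltW fg).
Qed.

Lemma l2one_mean : l2mean l2one = 1.
Proof. by rewrite emb_mean pint_cst (blin0 (bint_lin (prob_lty pi))). Qed.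

Lemma l2one_norm : n l2one = 1.
Proof.
apply/eqP; rewrite -(@eqrXn2 _ 2) ?l2norm_ge0// emb_norm nrm1.
rewrite /nrm (_ : bip pi 0 0 = 0) ?sqrtr0 ?expr0n ?addr0//.
exact: (ip0l (bipZl (prob_lty pi))).
Qed.

Lemma l2one_op : op l2one = l2one.
Proof. by rewrite l2op_emb kop_cst linear0. Qed.

Section gap.
Variable r : R.
Hypothesis r0 : 0 < r.
Hypothesis gap : forall f, I f = 0 -> N (kop P f) <= r * N f.

Let sq_le (x y a' b' a b : R) : 0 <= x -> 0 <= y -> 0 <= a' -> 0 <= b' ->
  x ^+ 2 = a' ^+ 2 + b' ^+ 2 -> y ^+ 2 = a ^+ 2 + b ^+ 2 ->
  a' <= r * a -> b' <= r * b -> x <= r * y.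
Proof.
move=> x0 y0 a0 b0 hx hy ha hb.
rewrite -(@ler_pXn2r _ 2) ?nnegrE ?mulr_ge0 ?(ltW r0)// exprMn hx hy mulrDr -!exprMn.
by apply: lerD; apply: lerXn2r; rewrite ?nnegrE//; apply: le_trans ha || apply: le_trans hb.
Qed.

(** Approximate [u] by a bounded function and subtract its mean, which is small because [u] has mean
    zero; the contraction then holds separately on real and imaginary parts. *)
Lemma l2_gap u : l2mean u = 0 -> n (op u) <= r * n u.
Proof.
move=> mu; rewrite -subr_le0; apply: (@le_eps _ (2 + r * 2)); last first.
  by rewrite addr_gt0// mulr_gt0.
move=> e e0; have [f [g fg]] := emb_dense u e0.
pose B := emb pi f g; pose f0 := f - bcst T (I f); pose g0 := g - bcst T (I g).
pose B0 := emb pi f0 g0.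
have B0E : B0 = B - l2mean B *: l2one.
  rewrite /B0 embB; congr (_ - _); apply: l2_ext => x.
  by rewrite l2_ZE l2oneE mulr1 embE !bcstE emb_mean.
have mB : normc (l2mean B) <= e.
  rewrite -normcN -sub0r -mu -meanB; apply: le_trans (l2mean_le _) (ltW fg).
have dB : n (u - B0) <= 2 * e.
  rewrite B0E opprB addrCA addrC; apply: le_trans (nD _ _) _.
  by rewrite nZ l2one_norm mulr1 mulr_natl mulr2n lerD// ltW.
have gB : n (op B0) <= r * n B0.
  have If0 : I f0 = 0 by rewrite (blinB _ _ (bint_lin (prob_lty pi))) pint_cst subrr.
  have Ig0 : I g0 = 0 by rewrite (blinB _ _ (bint_lin (prob_lty pi))) pint_cst subrr.
  have E1 := emb_norm pi (kop P f0) (kop P g0); have E2 := emb_norm pi f0 g0.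
  rewrite /B0 l2op_emb.
  exact: (@sq_le _ _ (N (kop P f0)) (N (kop P g0)) (N f0) (N g0) (l2norm_ge0 _ _)
    (l2norm_ge0 _ _) (sqrtr_ge0 _) (sqrtr_ge0 _) E1 E2 (gap If0) (gap Ig0)).
have nB0 : n B0 <= n u + 2 * e.
  apply: le_trans (_ : _ <= n u + n (u - B0)) _; last by rewrite lerD2l.
  rewrite addrC -(seminormN nZ (u - B0)) opprB; apply: le_trans (nD _ _).
  by rewrite subrK.
have : n (op u) <= 2 * e + r * (n u + 2 * e).
  rewrite -[op u](subrK (op B0)); apply: le_trans (nD _ _) _; apply: lerD.
    by apply: le_trans (l2op_dist _ _) dB.
  by apply: le_trans gB _; rewrite ler_wpM2l// ltW.
lra.
Qed.
End gap.

Section inner.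
Variable G : l2 pi.

Let prod_fun u := fun x : T => u x * (G x)^*%C.

Let prod_meas u : cmeasurable (prod_fun u).
Proof.
have [[ur ui] _] := l2P u; have [[gr gi] _] := l2P G; split.
  rewrite (_ : (fun x => _) = (fun x => Re (u x) * Re (G x) + Im (u x) * Im (G x))).
    by apply: measurable_funD; exact: measurable_funM.
  by apply/funext => x; rewrite /prod_fun; case: (u x) (G x) => [a b] [c e] /=; ring.
rewrite (_ : (fun x => _) = (fun x => Im (u x) * Re (G x) - Re (u x) * Im (G x))).
  by apply: measurable_funB; exact: measurable_funM.
by apply/funext => x; rewrite /prod_fun; case: (u x) (G x) => [a b] [c e] /=; ring.
Qed.

Let cmod_meas u : measurable_fun [set: T] (cmod u).
Proof. by have [m1 _] := l2P u; exact: measurable_cmod. Qed.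

Let prod_int u : (\int[pi]_x (cmod (prod_fun u) x)%:E <= (n u * n G)%:E)%E.
Proof.
have := @hoelder _ _ _ pi (cmod u) (cmod G) 2 2 (cmod_meas u) (cmod_meas G).
move=> /(_ _ _ _); rewrite Lnorm1 => h.
have -> : ((n u * n G)%:E = L2norm pi u * L2norm pi G)%E.
  by rewrite (L2norm_fine (l2P u)) (L2norm_fine (l2P G)).
apply: le_trans (h _ _ _); rewrite ?ltr0n//; last by lra.
rewrite le_eqVlt; apply/orP; left; apply/eqP; apply: eq_integral => x _ /=.
rewrite ger0_norm ?mulr_ge0 ?normc_ge0// /cmod /prod_fun normcM; congr (_ * _)%:E.
by case: (G x) => a b /=; rewrite sqrrN.
Qed.

Let part_int (pr : R[i] -> R) u : measurable_fun [set: T] (fun x => pr (prod_fun u x)) ->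
  (forall a, `|pr a| <= normc a) ->
  pi.-integrable [set: T] (EFin \o (fun x => pr (prod_fun u x))) /\
  `|\int[pi]_x pr (prod_fun u x)| <= n u * n G.
Proof.
move=> mp hp.
have le : (\int[pi]_x `|(pr (prod_fun u x))%:E| <= (n u * n G)%:E)%E.
  apply: le_trans (prod_int u); apply: ge0_le_integral => //.
  - by apply: measurableT_comp => //; exact/measurable_EFinP.
  - by apply/measurable_EFinP; exact: measurable_cmod.
  - by move=> x _; rewrite lee_fin; exact: hp.
have i1 : pi.-integrable [set: T] (EFin \o (fun x => pr (prod_fun u x))).
  apply/integrableP; split; first exact/measurable_EFinP.
  by apply: le_lt_trans le _; exact: ltry.
split => //; rewrite -lee_fin; apply: le_trans le.
apply: le_trans (le_abse_integral pi measurableT _); last exact/measurable_EFinP.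
rewrite /Rintegral -abse_EFin fineK//; exact: (integrable_fin_num measurableT i1).
Qed.

Let reI u := part_int (prod_meas u).1 (@Re_le_normc R).
Let imI u := part_int (prod_meas u).2 (@Im_le_normc R).

Lemma L2inner_lin (a : R[i]) u v :
  L2inner pi (a *: u + v : l2 pi) G = a * L2inner pi u G + L2inner pi v G.
Proof.
rewrite /L2inner -(cintegral_lin a (reI u).1 (imI u).1 (reI v).1 (imI v).1).
by congr cintegral; apply/funext => x; rewrite l2_linE mulrDl mulrA.
Qed.

(** The factor 2 comes from bounding real and imaginary parts separately. *)
Lemma L2inner_le u : normc (L2inner pi u G) <= 2 * n G * n u.
Proof.
rewrite /L2inner /cintegral -/(prod_fun u).
set a := \int[pi]_x _; set b := \int[pi]_x _.
have ha : `|a| <= n u * n G := (reI u).2; have hb : `|b| <= n u * n G := (imI u).2.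
have : normc (a +i* b) <= `|a| + `|b|.
  rewrite -(@ler_pXn2r _ 2) ?nnegrE ?addr_ge0 ?normc_ge0// normc_sq /= sqrrD.
  by rewrite !real_normK ?num_real// lerD2r lerDl mulrn_wge0// mulr_ge0.
by move=> h; apply: le_trans h _; lra.
Qed.

Lemma L2inner_sum K (c : 'I_K -> R[i]) (v : 'I_K -> l2 pi) :
  L2inner pi (\sum_(k < K) c k *: v k) G = \sum_(k < K) c k * L2inner pi (v k) G.
Proof.
have L0 : L2inner pi (0 : l2 pi) G = 0.
  by have := L2inner_lin (-1) 0 0; rewrite scaler0 addr0 mulN1r addNr.
by elim/big_rec2: _ => [|i y z _ <-]//; rewrite L2inner_lin.
Qed.

End inner.
End l2_operator.

(** * Spectrum, spectral projection and the gap *)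

Section spectral.
Context d (T : measurableType d) (R : realType) (P : R.-pker T ~> T).
Variables (pi : probability T R) (hrev : reversible P pi).
Implicit Types (u v w : l2 pi) (f : bfun T R) (F G : T -> R[i]).
Local Notation I := (bint pi).
Local Notation N := (nrm (bip pi)).
Local Notation n := (l2norm pi).
Local Notation op := (l2op P (pi := pi)).
Local Notation one := (l2one pi).
Local Notation pen := (pencil op).

Let nZ := l2normZ (mu := pi).
Let nD := l2normD (mu := pi).
Let Plin := @l2op_lin _ _ _ _ _ hrev.
Let Ple := @l2op_le _ _ _ _ _ hrev.
Let mlin := @l2mean_lin _ _ _ pi.
Let mle := @l2mean_le _ _ _ pi.
Let mP := @l2mean_op _ _ _ _ _ hrev.
Let me := @l2one_mean _ _ _ pi.
Let ne := @l2one_norm _ _ _ pi.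
Let complete := @l2_complete _ _ _ pi.

Let n0 : n (0 : l2 pi) = 0.
Proof. exact: (seminorm0 nZ). Qed.

Let Pe : n (op one - one) = 0.
Proof. by rewrite (l2one_op hrev) subrr n0. Qed.

Let zmk (a : R[i]) F G : L2 pi F -> L2 pi G ->
  mkl2 pi (fun x => a * F x + G x) = a *: mkl2 pi F + mkl2 pi G.
Proof.
move=> LF LG; apply: l2_ext => x; rewrite l2_linE !mkl2E//.
have [La _] := L2_scale a LF; exact: (L2_add La LG).1.
Qed.

Let pencilE (z : R[i]) u : pen z u = (fun x => z * u x - kernel_op P u x) :> (T -> R[i]).
Proof. by apply/funext => x; rewrite /pencil l2_BE l2_ZE l2opE. Qed.

Lemma resolvent_of (z : R[i]) (M : R) :
  (forall w, exists u, n (pen z u - w) = 0) ->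
  (forall u, n u <= M * n (pen z u)) -> exists S, is_resolvent P pi z S.
Proof.
move=> surj low; have [t ht] := choice surj.
have [tlin tle tp] := pencil_inverse nZ nD Plin Ple low ht.
exists (fun F => t (mkl2 pi F) : T -> R[i]); split; last first.
  move=> F LF; have FE := mkl2E LF; split.
    rewrite -[X in mkl2 pi (fun x => _ * X x - kernel_op P X x)]FE -pencilE.
    have -> : mkl2 pi (pen z (mkl2 pi F)) = pen z (mkl2 pi F).
      by apply: l2_ext => x; rewrite mkl2E//; exact: l2P.
    rewrite -[X in _ = X %[ae _]]FE; apply/l2_aeP; apply: tp.
    by rewrite subrr n0.
  have : (pen z (t (mkl2 pi F)) : T -> R[i]) = F %[ae pi].
    by rewrite -[X in _ = X %[ae _]]FE; apply/l2_aeP; exact: ht.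
  by rewrite pencilE.
split.
- by move=> F _; exact: l2P.
- move=> a F G LF LG; rewrite zmk//.
  have /l2_aeP := tlin a (mkl2 pi F) (mkl2 pi G).
  by apply: filterS => x h y; rewrite (h y); exact: l2_linE.
- exists M => F LF.
  rewrite (L2norm_fine (l2P _)) (L2norm_fine LF) -EFinM lee_fin.
  by apply: le_trans (tle _) _; rewrite mkl2E.
Qed.

Lemma resolvent_pencil (z : R[i]) S F : is_resolvent P pi z S -> L2 pi F ->
  n (pen z (mkl2 pi (S F)) - mkl2 pi F) = 0.
Proof.
move=> [[SL _ _] h] LF; apply/l2_aeP; rewrite pencilE mkl2E; last exact: SL.
by rewrite (mkl2E LF); exact: (h F LF).2.
Qed.

(** A bounded left inverse makes the pencil bounded below. *)
Lemma resolvent_lower (z : R[i]) S : is_resolvent P pi z S ->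
  exists2 M, 0 < M & forall u, n u <= M * n (pen z u).
Proof.
move=> [[SL _ [M hM]] h]; exists (Num.max M 1); first by rewrite lt_max ltr01 orbT.
move=> u; have Lp : L2 pi (pen z u) := l2P _.
have [e _] := h u (l2P u); rewrite -pencilE in e.
have Su : n (mkl2 pi (S (pen z u)) - u) = 0.
  by apply/l2_aeP; rewrite mkl2E//; exact: SL.
rewrite -(seminorm_eq nZ nD Su); apply: (@le_trans _ _ (M * n (pen z u))).
  have := hM _ Lp; rewrite (L2norm_fine (SL _ Lp)) (L2norm_fine Lp) -EFinM lee_fin.
  by rewrite /l2norm mkl2E//; exact: SL.
by rewrite ler_wpM2r ?l2norm_ge0// le_max lexx.
Qed.

(** 1 - P annihilates the constants, so it is not bounded below. *)
Lemma one_spectrum : spectrum2 P pi 1.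
Proof.
split; first exact: oner_neq0.
move=> [S /resolvent_lower[M _ hM]].
have := hM one; rewrite /pencil scale1r (l2one_op hrev) subrr n0 mulr0 ne.
by rewrite ler10.
Qed.

Section contracting.
Variable r : R.
Hypothesis r01 : 0 < r < 1.
Hypothesis rgap : forall f, I f = 0 -> N (kop P f) <= r * N f.

Let r0 : 0 < r. Proof. by case/andP: r01. Qed.
Let r1 : r < 1. Proof. by case/andP: r01. Qed.
Let gap := @l2_gap _ _ _ _ _ hrev _ r0 rgap.

Lemma resolvent_exists (z : R[i]) : r < normc z -> z != 1 -> exists S, is_resolvent P pi z S.
Proof.
move=> rz z1.
have [M hM] := pencil_lower nZ nD Plin Ple mlin mle mP me ne Pe gap rz z1.
apply: (@resolvent_of z M) => // w.
exact: (pencil_surj nZ nD Plin Ple complete mlin mle mP me Pe r01 gap w rz z1).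
Qed.

Definition mean_op F : T -> R[i] := fun=> l2mean (mkl2 pi F).

Let mean_opE F : mean_op F = l2mean (mkl2 pi F) *: one :> (T -> R[i]).
Proof. by apply/funext => x; rewrite l2_ZE l2oneE mulr1. Qed.

Lemma mean_op_bounded : bounded_operator pi mean_op.
Proof.
split.
- by move=> F _; rewrite mean_opE; exact: l2P.
- move=> a F G LF LG; apply: nearW => x _; rewrite /mean_op zmk//; exact: mlin.
- exists 1 => F LF; rewrite mul1e mean_opE (L2norm_fine (l2P _)) (L2norm_fine LF) lee_fin.
  rewrite -/(l2norm pi _) nZ ne mulr1.
  by apply: le_trans (mle _) _; rewrite mkl2E.
Qed.

Lemma mean_op_rank : has_rank pi mean_op 1.
Proof.
have one1 : one = (fun=> 1) :> (T -> R[i]) by apply/funext => x; exact: l2oneE.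
exists (fun _ _ => 1); split.
- move=> _; rewrite -one1; split; first exact: l2P.
  exists one; first exact: l2P.
  apply: nearW => x _; rewrite /mean_op ?l2oneE.
  have -> : mkl2 pi one = one by apply: l2_ext => y; rewrite mkl2E//; exact: l2P.
  by rewrite me.
- move=> c h i; rewrite (ord1 i); apply: eq0_normc.
  have : n (c ord0 *: one - 0) = 0.
    apply/l2_aeP; apply: filterS h => x h y.
    by rewrite l2_ZE l2oneE mulr1; have := h y; rewrite big_ord1 mulr1.
  by rewrite subr0 nZ ne mulr1.
- move=> F LF; exists (fun=> l2mean (mkl2 pi F)); apply: nearW => x _.
  by rewrite big_ord1 mulr1.
Qed.

Let rho := (1 - r) / 2.
Let rho0 : 0 < rho. Proof. by rewrite divr_gt0// subr_gt0. Qed.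

Let near1 (z : R[i]) : normc (z - 1) <= rho -> r < normc z.
Proof.
move=> h; have := le_normcD z (1 - z); rewrite addrC subrK normc1 -(normcN (1 - z)) opprB.
by move: h r1; rewrite /rho; lra.
Qed.

(** A choice of resolvent for each z; the default [id] is never met on the circle. *)
Let res (z : R[i]) : (T -> R[i]) -> T -> R[i] :=
  if pselect (exists S, is_resolvent P pi z S) is left h then sval (cid h) else id.

Let resP (z : R[i]) : r < normc z -> z != 1 -> is_resolvent P pi z (res z).
Proof.
move=> rz z1; rewrite /res; case: pselect => [h|[]]; last exact: resolvent_exists.
exact: svalP (cid h).
Qed.

(** On the circle of radius (1 - r)/2 about 1, [pencil_laurent] exhibits a simple pole whose residue
    pairs the mean of F with G, plus a uniformly convergent power series; [circle_integral_pole]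
    extracts the residue. *)
Lemma mean_op_projection : spectral_projection P pi 1 mean_op.
Proof.
split; first exact: mean_op_bounded.
exists rho, res; split.
- by rewrite rho0 normc1 /rho; move: r0; lra.
- move=> z [_ nz] hz; apply/eqP/negPn/negP => z1; apply: nz.
  exact: resolvent_exists (near1 hz) z1.
- move=> z hz; apply: resP; first by apply: near1; rewrite hz.
  by apply/eqP => z1; move: rho0; rewrite -hz z1 subrr normc0 ltxx.
move=> F G LF LG; pose u := mkl2 pi F; pose v := mkl2 pi G.
have [t [t0 mt pt]] := neumann_sequence nZ nD Plin Ple complete mlin mle mP me r01 gap u.
have ellE H : L2inner pi H G = L2inner pi H v by rewrite /v mkl2E.
have -> : L2inner pi (mean_op F) G = l2mean u * L2inner pi one v.
  have := L2inner_lin v (l2mean u) one 0.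
  have -> : L2inner pi (0 : l2 pi) v = 0.
    by have := L2inner_lin v (-1) 0 0; rewrite scaler0 addr0 mulN1r addNr.
  by rewrite !addr0 => <-; rewrite ellE mean_opE.
set A := l2mean u * _.
have h0 : 0 <= 2^-1 :> R by lra.
have h1 : 2^-1 < 1 :> R by lra.
have q01 : 0 <= (2^-1 : R) < 1 by rewrite h0 h1.
rewrite (@circle_integral_pole _ _ 1 A (fun k => (-1) ^+ k * L2inner pi (t k.+1) v) rho
   (2 * n v * (2 / (1 - r) * n (u - l2mean u *: one))) 2^-1) //.
  rewrite mulKf// !mulf_neq0//.
  - by apply/eqP => /(congr1 (@complex.Im R)) /eqP; rewrite /= oner_eq0.
  - by rewrite (inj_eq (@complexI R)) gt_eqF// pi_gt0.
move=> z K hz.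
have rz : r < normc z by apply: near1; rewrite hz.
have z1 : z != 1.
  by apply/eqP => z1; move: rho0; rewrite -hz z1 subrr normc0 ltxx.
have zr := resP rz z1.
have hz' : normc (1 - z) <= (1 - r) / 2 by rewrite -normcN opprB hz.
have -> : L2inner pi (res z F) G = L2inner pi (mkl2 pi (res z F)) v.
  by rewrite ellE mkl2E//; have [[SL _ _] _] := zr; exact: SL.
apply: (pencil_laurent nZ nD Plin Ple mlin mle mP me Pe r01 gap K (L2inner_lin v) _
  (L2inner_le v) hz' z1 t0 mt pt (resolvent_pencil zr LF)).
by rewrite mulr_ge0// l2norm_ge0.
Qed.

Lemma gap_spectral_gap : spectral_gap P pi.
Proof.
exists rho => //=.
have U1 z : (spectrum2 P pi `&` [set z | 1 - rho <= normc z]) z -> z = 1.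
  move=> [[_ nz] /= hz]; apply/eqP/negPn/negP => z1; apply: nz.
  apply: resolvent_exists z1; apply: lt_le_trans hz; rewrite /rho; move: r1; lra.
split; first by apply: (@sub_finite_set _ _ [set 1]) => [z /U1|]; [|exact: finite_set1].
move=> z /U1 ->; exists 1%N; split; first exact: one_spectrum.
by exists mean_op; [exact: mean_op_projection|exact: mean_op_rank].
Qed.

End contracting.

(** The lower bound on complex L_2 restricts to real bounded functions, on which the pencil at a
    real point stays real. *)
Lemma real_resolvent_lower (t : R) S : is_resolvent P pi t%:C S ->
  exists2 c, 0 < c & forall f, c * N f <= N (t *: f - kop P f).
Proof.
move=> /resolvent_lower[M M0 hM]; exists M^-1; first by rewrite invr_gt0.
have nN f : n (emb pi f 0) = N f.
  apply/eqP; rewrite -(@eqrXn2 _ 2) ?l2norm_ge0//; last exact: sqrtr_ge0.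
  rewrite emb_norm [N 0]/nrm (_ : bip pi 0 0 = 0) ?sqrtr0 ?expr0n ?addr0//.
  exact: (ip0l (bipZl (prob_lty pi))).
move=> f; have E : pen t%:C (emb pi f 0) = emb pi (t *: f - kop P f) 0.
  have op0 : op (emb pi f 0) = emb pi (kop P f) 0.
    by rewrite (l2op_emb hrev); congr (emb _ _ _); exact: linear0.
  apply: l2_ext => x; rewrite /pencil l2_BE l2_ZE op0.
  rewrite (embE _ f) (embE _ (kop P f)) (embE _ (_ - _)) bfunB bfunZ bfun0.
  by apply/eqP; rewrite eq_complex /=; apply/andP; split; apply/eqP; ring.
have := hM (emb pi f 0); rewrite E !nN => h.
by rewrite mulrC ler_pdivrMr// mulrC.
Qed.

(** Finitely many spectral points have modulus at least 1 - eps, so a ring strictly inside the unit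
    circle is free of spectrum; it contains both t and -t. *)
Lemma spectral_gap_resolvent : spectral_gap P pi -> exists2 eps : R, 0 < eps &
  forall t, 1 - eps < t < 1 ->
    (exists2 c, 0 < c & forall f, c * N f <= N (t *: f - kop P f)) /\
    (exists2 c, 0 < c & forall f, c * N f <= N (t *: f + kop P f)).
Proof.
move=> [eps eps0 /= [/finite_seqP[s hs] _]].
(* [e] separates from 1 the finitely many moduli below 1; points on the unit circle are left
   alone. *)
have [e e0 he] : exists2 e : R, 0 < e & forall z, z \in s -> normc z < 1 -> normc z <= 1 - e.
  elim: (s) => [|z s' [e e0 IH]]; first by exists 1.
  have [z1|z1] := ltP (normc z) 1.
    exists (Num.min e (1 - normc z)); first by rewrite lt_min e0 subr_gt0.
    move=> y; rewrite inE => /orP[/eqP ->|ys] hy.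
      by rewrite lerBrDr -lerBrDl ge_min lexx orbT.
    by apply: le_trans (IH y ys hy) _; rewrite lerD2l lerN2 ge_min lexx.
  exists e => // y; rewrite inE => /orP[/eqP ->|]; last exact: IH.
  by rewrite ltNge z1.
exists (Num.min 1 (Num.min eps e)); first by rewrite !lt_min ltr01 eps0.
move=> t /andP[ht t1].
have m1 : Num.min 1 (Num.min eps e) <= 1 by rewrite ge_min lexx.
have m2 : Num.min 1 (Num.min eps e) <= eps by rewrite !ge_min lexx orbT.
have m3 : Num.min 1 (Num.min eps e) <= e by rewrite !ge_min lexx !orbT.
have t0 : 0 < t by lra.
have ex (z : R[i]) : normc z = t -> exists S, is_resolvent P pi z S.
  move=> hz; apply: contrapT => nz.
  have : (spectrum2 P pi `&` [set z | 1 - eps <= normc z]) z.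
    split; last by rewrite /= hz; lra.
    by split => //; apply/eqP => z0; move: t0; rewrite -hz z0 normc0 ltxx.
  rewrite hs /= => /he; rewrite hz => /(_ t1); lra.
have nC (a : R) : normc a%:C = `|a| by rewrite /= expr0n addr0 sqrtr_sqr.
split.
  have [S] := ex t%:C (etrans (nC t) (gtr0_norm t0)); exact: real_resolvent_lower.
have [S] := ex (- t)%:C (etrans (nC (- t)) (etrans (normrN t) (gtr0_norm t0))).
move=> /real_resolvent_lower[c c0 hc]; exists c => // f; apply: le_trans (hc f) _.
rewrite -(nrmN (bipC pi) (bipZl (prob_lty pi))) le_eqVlt; apply/orP; left; apply/eqP; congr (nrm _ _).
by rewrite scaleNr -opprD opprK.
Qed.

End spectral.

Theorem proposition1p2 (d : measure_display) (T : measurableType d)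
    (R : realType) (P : R.-pker T ~> T) (pi : probability T R)
    (hT : countably_generated T)
    (hP : psi_irreducible_aperiodic P)
    (hrev : reversible P pi) :
  geometrically_ergodic P <-> spectral_gap P pi.
Proof.
have [psi [[psiT irr] _]] := hP; split=> [ge|].
  have [q q01 hq] := geometric_contraction hrev hT psiT irr ge.
  exact: (gap_spectral_gap hrev q01 hq).
move=> /(spectral_gap_resolvent hrev)[eps eps0 heps].
have [q q01 hq] := resolvent_contraction hrev psiT irr eps0 heps.
exact: (gap_geometrically_ergodic hrev psiT irr hT q01 hq).
Qed.
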